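(* Let $A$ be an analytic function in the unit disc $\mathbb{D}$. If $|A(z)|(1-|z|^2)\,dm(z)$ is a Carleson measure, then the zero-sequence of each non-trivial solution $f\not\equiv 0$ of $f''+Af=0$ in $\mathbb{D}$ is uniformly separated.
   Context: $dm$ denotes Lebesgue area measure on the unit disc $\mathbb{D}\subset\mathbb{C}$. A positive Borel measure $\mu$ on $\mathbb{D}$ is a Carleson measure if for $0<p<\infty$ there is a positive constant $C$ with $\int_{\mathbb{D}}|f|^p\,d\mu\le C\|f\|_{H^p}^p$ for all $f$ in the Hardy space $H^p$; equivalently, $$\sup_{a\in\mathbb{D}}\int_{\mathbb{D}}\frac{1-|a|^2}{|1-\overline{a}z|^2}\,d\mu(z)<\infty.$$ A sequence $\{z_n\}\subset\mathbb{D}$ (possibly finite or empty, as zero-sequences may be) is uniformly separated if $$\inf_{k}\prod_{n\neq k}\left|\frac{z_n-z_k}{1-\overline{z}_nz_k}\right|>0.$$ Solutions $f$ are analytic functions in $\mathbb{D}$. *)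

(* Defs.v *)
From HB Require Import structures.
From mathcomp Require Import all_boot all_order all_algebra complex.
From mathcomp Require Import all_classical all_reals all_analysis.

Set Implicit Arguments.
Unset Strict Implicit.
Unset Printing Implicit Defensive.

Import Order.TTheory GRing.Theory Num.Theory.
Import numFieldNormedType.Exports.

Local Open Scope classical_set_scope.
Local Open Scope ring_scope.
Local Open Scope complex_scope.

Notation normc := ComplexField.Normc.normc.

(* Measures live on R * R, which carries the product Borel sigma-algebra; the
   point (x, y) stands for x + iy. *)
Notation plane R := (measurableTypeR R * measurableTypeR R)%type.

Section UnitDisc.
Context {R : realType}.
Implicit Types (z a : R[i]) (f : R[i] -> R[i]).

Definition disc : set R[i] := [set z | normc z < 1].

(* R[i]^o is the normed line over the field R[i], so that derivability and
   derivatives are complex ones. *)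
Definition cderivable f z : Prop := derivable (f : R[i]^o -> R[i]^o) z 1.

Definition cderive f : R[i] -> R[i] := derive1 (f : R[i]^o -> R[i]^o).

(* Functions on the disc are total functions on R[i] whose values off the disc
   are irrelevant: the disc is open, so derivatives in it only depend on the
   values taken in it. *)
Definition analytic_disc f : Prop := forall z, disc z -> cderivable f z.

Definition plane_to_C (w : plane R) : R[i] := w.1 +i* w.2.

Definition disc_plane : set (plane R) := [set w | disc (plane_to_C w)].

Definition area : set (plane R) -> \bar R := (lebesgue_measure \x lebesgue_measure)%E.

Definition polar (r t : R) : R[i] := (r * cos t) +i* (r * sin t).

Definition hardy_mean (p : R) f (r : R) : \bar R :=
  (((2 * pi)^-1)%:E *
   \int[lebesgue_measure]_(t in `[0%R, (2 * pi)%R])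
     (normc (f (polar r t)) `^ p)%:E)%E.

Definition hardy_norm (p : R) f : \bar R :=
  (ereal_sup [set hardy_mean p f r | r in `[0%R, 1%R[] `^ p^-1)%E.

Definition hardy (p : R) f : Prop :=
  analytic_disc f /\ (hardy_norm p f < +oo)%E.

Definition carleson_measure (mu : {measure set (plane R) -> \bar R}) : Prop :=
  forall p : R, 0 < p ->
    exists2 C : R, 0 < C &
      forall f, hardy p f ->
        (\int[mu]_(w in disc_plane) (normc (f (plane_to_C w)) `^ p)%:E
           <= C%:E * (hardy_norm p f) `^ p)%E.

Definition zero_order f a (m : nat) : Prop :=
  exists g : R[i] -> R[i],
    [/\ analytic_disc g, g a != 0 &
        forall z, disc z -> f z = (z - a) ^+ m * g z].

(* A sequence is indexed by a set I of natural numbers, so as to be infinite,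
   finite or empty.  Zeros are repeated according to their multiplicity, and
   m = 0 says that a is not a zero. *)
Definition zero_sequence f (I : set nat) (z : nat -> R[i]) : Prop :=
  (forall n, I n -> disc (z n)) /\
  (forall a, disc a -> exists2 m : nat,
     zero_order f a m & ([set n | I n /\ z n = a] #= `I_m)%card).

(* For points of the disc the factors are in [0, 1], so the partial products
   converge.  The infimum over an empty I is +oo. *)
Definition uniformly_separated (I : set nat) (z : nat -> R[i]) : Prop :=
  (0 < ereal_inf
    [set (limn (fun N : nat =>
           \prod_(0 <= n < N | (n \in I) && (n != k))
              normc ((z n - z k) / (1 - (z n)^* * z k))))%:E | k in I])%E.

End UnitDisc.

(* Main.v *)
From HB Require Import structures.
Require Import Defs.
From mathcomp Require Import all_boot all_order all_algebra complex.
From mathcomp Require Import all_classical all_reals all_analysis.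
From mathcomp Require Import measurable_realfun.
From mathcomp Require Import ring lra.
Set Implicit Arguments.
Unset Strict Implicit.
Unset Printing Implicit Defensive.
Import Order.TTheory GRing.Theory Num.Theory.
Import numFieldNormedType.Exports.
Local Open Scope classical_set_scope.
Local Open Scope ring_scope.
Local Open Scope complex_scope.
Local Notation Re := (@complex.Re (Real.sort _)).
Local Notation Im := (@complex.Im (Real.sort _)).

(** Let [a] be a zero of [f]. The involution [mobius a] exchanges [a] and [0], and
    [g z = (1 - a^* z) f (mobius a z)] solves an equation [g'' + B g = 0] again,
    with [B = potential A a] (lemma [transform_ode]). The zeros of [g] are [0] and
    the points [mobius a b] for the other zeros [b] of [f], so the claim is a lower
    bound for [\prod_b |mobius a b|] that depends on neither [a] nor the number of
    zeros [b]. Jensen's formula deduces such a bound from an upper bound for the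
    mean of [log |g|] over circles about [0].

    Along the ray with direction [u], [|u| = 1], a Gronwall argument ([ray_bound])
    gives [|g (r u)| <= r |g' 0| exp (U u)], where [U u] is the integral of
    [t (1 - t) |B (t u)|] over [0 <= t <= r]. In particular a double zero would make
    [f] vanish ([double_zero]), so the zeros are simple. The mean of [U] over [u] is
    bounded independently of [a] and [r]: the value of [|A|] at a point is at most
    its mean over a square about this point, up to a constant ([area_submean]),
    which turns the mean of [U] into an area integral, and Tonelli's theorem bounds
    this by a multiple of the integral of [|A w| (1 - |mobius a w|^2)] over the disc
    ([averaged_potential]). The latter integrals are bounded by the Carleson
    condition, tested on the derivative of [mobius a], which has norm at most one
    in the Hardy space with exponent one ([carleson_invariant]).

    The means over circles are taken over finitely many equidistributed points,
    the roots of unity of order [N], a power of two. Then Jensen's inequality is the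
    maximum principle for the product of the [N] rotated copies of a function
    ([jensen_average]), and the Poisson kernel has averages of the expected size on
    the circle of radius [r] once [r ^+ N <= 1 / 2] ([unit_points_poisson]). The maximum
    principle follows from the test on second derivatives at a maximum once
    derivatives of holomorphic functions are known to be holomorphic; this is
    proved from Cauchy's formula for rectangles, and so is [area_submean].

    Together this gives [r ^+ n <= expR L * \prod_b |mobius a b|] for [n] zeros [b]
    and [0 < r < 1], with [L] depending only on the Carleson constant
    ([zeros_product_bound]). Let [r] tend to [1], then add the remaining zeros. *)

(** * The complex modulus *)

Section Modulus.
Context {R : realType}.
Implicit Types (z w : R[i]) (x y : R).

Lemma complex_normE z : `|z| = (normc z)%:C.
Proof. by []. Qed.

Lemma normc_ge0 z : 0 <= normc z.
Proof. by case: z => x y; exact: sqrtr_ge0. Qed.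

Lemma normc0 : normc (0 : R[i]) = 0. Proof. exact: ComplexField.Normc.normc0. Qed.

Lemma normc1 : normc (1 : R[i]) = 1. Proof. exact: ComplexField.Normc.normc1. Qed.

Lemma normc_eq0 z : (normc z == 0) = (z == 0).
Proof.
apply/eqP/eqP => [|->]; last exact: normc0.
exact: ComplexField.Normc.eq0_normc.
Qed.

Lemma normc_gt0 z : (0 < normc z) = (z != 0).
Proof. by rewrite lt_def normc_ge0 andbT normc_eq0. Qed.

Lemma normcM z w : normc (z * w) = normc z * normc w.
Proof. exact: ComplexField.Normc.normcM. Qed.

Lemma normcV z : normc z^-1 = (normc z)^-1.
Proof. exact: ComplexField.Normc.normcV. Qed.

Lemma normc_div z w : normc (z / w) = normc z / normc w.
Proof. by rewrite normcM normcV. Qed.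

Lemma normcX z n : normc (z ^+ n) = normc z ^+ n.
Proof. by elim: n => [|n ih]; rewrite ?expr0 ?normc1// !exprS normcM ih. Qed.

Lemma normcN z : normc (- z) = normc z.
Proof. exact: normcN. Qed.

Lemma normcB z w : normc (z - w) = normc (w - z).
Proof. by rewrite -normcN opprB. Qed.

Lemma normcD z w : normc (z + w) <= normc z + normc w.
Proof. exact: le_normcD. Qed.

Lemma normcDB z w : normc (z - w) <= normc z + normc w.
Proof. by rewrite -(normcN w); exact: normcD. Qed.

Lemma normc_triangle u z w : normc (z - w) <= normc (z - u) + normc (u - w).
Proof. by rewrite (_ : z - w = (z - u) + (u - w)) ?normcD//; ring. Qed.

Lemma normc_le_dist z w : normc z <= normc w + normc (z - w).
Proof. by rewrite {1}(_ : z = w + (z - w)) ?normcD//; ring. Qed.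

Lemma normc_dist z w : `|normc z - normc w| <= normc (z - w).
Proof.
have h1 := normc_le_dist z w; have h2 := normc_le_dist w z.
by rewrite normcB in h2; rewrite ler_norml; apply/andP; split; lra.
Qed.

Lemma conjE z : Num.conj z = Re z -i* Im z.
Proof. by case: z. Qed.

Lemma normcJ z : normc (Num.conj z) = normc z.
Proof. by rewrite conjE; case: z => x y /=; rewrite sqrrN. Qed.

Lemma normc_sqr z : normc z ^+ 2 = Re z ^+ 2 + Im z ^+ 2.
Proof. by case: z => x y /=; rewrite sqr_sqrtr// addr_ge0// sqr_ge0. Qed.

Lemma normc_real x : normc x%:C = `|x|.
Proof. by rewrite /= expr0n addr0 sqrtr_sqr. Qed.

Lemma normc_nat n : normc (n%:R : R[i]) = n%:R.
Proof. by rewrite -(rmorph_nat (real_complex R)) normc_real normr_nat. Qed.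

Lemma normc_i : normc ('i : R[i]) = 1.
Proof. by rewrite /= expr0n add0r expr1n sqrtr1. Qed.

Lemma normc_sqrJ z : (normc z ^+ 2)%:C = z * Num.conj z.
Proof.
rewrite normc_sqr conjE; case: z => x y /=; apply/eqP; rewrite eq_complex /=.
by apply/andP; split; apply/eqP; ring.
Qed.

Lemma cReD z w : Re (z + w) = Re z + Re w. Proof. by case: z w => [? ?] []. Qed.
Lemma cImD z w : Im (z + w) = Im z + Im w. Proof. by case: z w => [? ?] []. Qed.
Lemma cReN z : Re (- z) = - Re z. Proof. by case: z. Qed.
Lemma cImN z : Im (- z) = - Im z. Proof. by case: z. Qed.
Lemma cReM z w : Re (z * w) = Re z * Re w - Im z * Im w.
Proof. by case: z w => [? ?] []. Qed.
Lemma cImM z w : Im (z * w) = Re z * Im w + Im z * Re w.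
Proof. by case: z w => [? ?] []. Qed.

Lemma cReC x : Re x%:C = x. Proof. by []. Qed.
Lemma cImC x : Im x%:C = 0. Proof. by []. Qed.

Lemma Re_sum I (s : seq I) (P : pred I) (F : I -> R[i]) :
  Re (\sum_(j <- s | P j) F j) = \sum_(j <- s | P j) Re (F j).
Proof. by elim/big_rec2: _ => // j y1 y2 _ <-; rewrite cReD. Qed.

Lemma complex_eqP z w : Re z = Re w -> Im z = Im w -> z = w.
Proof. by case: z w => [? ?] [? ?] /= -> ->. Qed.

Lemma Re_le_normc z : `|Re z| <= normc z.
Proof.
rewrite -(ler_pXn2r (ltn0Sn 1)) ?nnegrE ?normc_ge0// normc_sqr real_normK ?num_real//.
by rewrite lerDl sqr_ge0.
Qed.

Lemma Im_le_normc z : `|Im z| <= normc z.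
Proof.
rewrite -(ler_pXn2r (ltn0Sn 1)) ?nnegrE ?normc_ge0// normc_sqr.
by rewrite real_normK ?num_real// lerDr sqr_ge0.
Qed.

Lemma normc_le_ReIm z : normc z <= `|Re z| + `|Im z|.
Proof.
rewrite -(ler_pXn2r (ltn0Sn 1)) ?nnegrE ?normc_ge0 ?addr_ge0// normc_sqr.
rewrite -(real_normK (num_real (Re z))) -(real_normK (num_real (Im z))).
have := normr_ge0 (Re z); have := normr_ge0 (Im z); nra.
Qed.

Lemma normc_prod I (s : seq I) (P : pred I) (F : I -> R[i]) :
  normc (\prod_(j <- s | P j) F j) = \prod_(j <- s | P j) normc (F j).
Proof.
by elim/big_rec2: _ => [|j y1 y2 _ <-]; rewrite ?normc1 ?normcM.
Qed.

End Modulus.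

#[global] Arguments ComplexField.Normc.normc : simpl never.

(** * Complex derivatives and continuity in terms of the modulus *)

Section ComplexDerivative.
Context {R : realType}.
Implicit Types (z w l : R[i]) (f g : R[i] -> R[i]).

(** Records rather than abbreviations: they keep unification from unfolding the
    filters underneath. *)
Record cdiff f z l : Prop := Cdiff {
  cdiff_is_derive :
    is_derive (z : R[i]^o) (1 : R[i]^o) (f : R[i]^o -> R[i]^o) (l : R[i]^o) }.

Record ccont f z : Prop := Ccont {
  ccont_continuous : {for z, continuous (f : R[i]^o -> R[i]^o)} }.

Lemma cderivableP f z : cderivable f z <-> cdiff f z (cderive f z).
Proof.
rewrite /cderivable /cderive derive1E; split => [h|[[]]//].
by split; exact: derivableP.
Qed.

Lemma cdiff_derivable f z l : cdiff f z l -> cderivable f z.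
Proof. by case=> -[]. Qed.

Lemma cdiff_val f z l : cdiff f z l -> cderive f z = l.
Proof. by case=> -[_]; rewrite /cderive derive1E. Qed.

Lemma nbhsCP z (P : R[i] -> Prop) :
  nbhs (z : R[i]^o) P <->
  exists2 d : R, 0 < d & forall w, normc (w - z) < d -> P w.
Proof.
split.
  move/(@nbhs_normP _ R[i]^o) => [e /= e0 he].
  have /eqP Ie : Im e == 0 by move: e0; rewrite ltcE => /andP[].
  have Re0 : 0 < Re e by move: e0; rewrite ltcE => /andP[].
  exists (Re e) => // w hw; apply: he; rewrite /= /ball_ /= complex_normE ltcE /=.
  by rewrite Ie eqxx /= normcB.
move=> [d d0 hd]; apply/(@nbhs_normP _ R[i]^o); exists d%:C; rewrite /= ?ltcR//.
by move=> w; rewrite /= /ball_ /= complex_normE ltcR normcB => /hd.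
Qed.

Lemma ccontP f z : ccont f z <-> forall e : R, 0 < e ->
  exists2 d : R, 0 < d & forall w, normc (w - z) < d -> normc (f w - f z) < e.
Proof.
split => [[h] e e0|h].
  apply/(nbhsCP z (fun w => normc (f w - f z) < e)).
  apply: (h (fun y => normc (y - f z) < e)).
  by apply/nbhsCP; exists e.
split=> P /nbhsCP [e e0 he]; have [d d0 hd] := h _ e0.
by apply/(nbhsCP z (fun w => P (f w))); exists d => // w /hd /he.
Qed.

Lemma cdiffP f z l : cdiff f z l <-> forall e : R, 0 < e ->
  exists2 d : R, 0 < d & forall h, normc h < d ->
    normc (f (z + h) - f z - l * h) <= e * normc h.
Proof.
have quot h : h != 0 ->
    h^-1 * (f (z + h) - f z) - l = h^-1 * (f (z + h) - f z - l * h).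
  by move=> h0; field.
split.
  move=> [[hd hv]] e e0.
  have : (fun h : R[i]^o => h^-1 *: (f (h *: 1 + z) - f z)) @ 0^' -->
      (l : R[i]^o).
    rewrite -hv /derive; move: hd; rewrite /derivable => /cvg_ex[/= l' hl'].
    have := hl' => /cvg_lim -> //.
  have N : nbhs (l : R[i]^o) (fun y : R[i]^o => normc (y - l) < e).
    by apply/nbhsCP; exists e.
  move=> /(_ _ N).
  rewrite /nbhs /= /dnbhs /within /= => /nbhsCP[d d0 H].
  exists d => // h hd'; have [->|h0] := eqVneq h 0.
    by rewrite addr0 subrr mulr0 subr0 normc0 mulr0.
  have := H h; rewrite subr0 => /(_ hd' h0) /ltW.
  rewrite /GRing.scale /= mulr1 (addrC h z) quot// normcM normcV.
  by rewrite mulrC ler_pdivrMr ?normc_gt0.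
move=> H.
have Hc : (fun h : R[i]^o => h^-1 *: (f (h *: 1 + z) - f z)) @ 0^' -->
      (l : R[i]^o).
  move=> P /nbhsCP[e e0 he].
  have e20 : 0 < e / 2 by lra.
  have [d d0 hd] := H _ e20.
  rewrite /nbhs /= /dnbhs /within /=; apply/nbhsCP; exists d => // h.
  rewrite subr0 => hh h0; apply: he.
  rewrite /GRing.scale /= mulr1 (addrC h z) quot// normcM normcV mulrC.
  rewrite ltr_pdivrMr ?normc_gt0//; apply: le_lt_trans (hd _ hh) _.
  by rewrite ltr_pM2r ?normc_gt0//; lra.
split; split; first by apply/cvg_ex; exists l.
by apply: cvg_lim => //.
Qed.

End ComplexDerivative.

#[global] Opaque cderivable cderive.

Section ComplexCalculus.
Context {R : realType}.
Implicit Types (z w l m : R[i]) (f g : R[i] -> R[i]).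

Lemma cdiff_eq f z l m : cdiff f z l -> l = m -> cdiff f z m.
Proof. by move=> + <-. Qed.

Lemma cdiff_near f g z l : cdiff f z l ->
  (exists2 d : R, 0 < d & forall w, normc (w - z) < d -> f w = g w) ->
  cdiff g z l.
Proof. move=> [fl] /nbhsCP h; split.
exact: (@near_eq_is_derive R[i] R[i]^o R[i]^o f g z 1 l h fl). Qed.

Lemma cdiff_ext f g z l : cdiff f z l -> (forall w, f w = g w) -> cdiff g z l.
Proof. by move=> fl fg; apply: cdiff_near fl _; exists 1. Qed.

Lemma cdiff_cst c z : cdiff (fun=> c) z 0.
Proof. by split; exact: is_derive_cst. Qed.

Lemma cdiff_id z : cdiff (fun w => w) z 1.
Proof. by split; exact: is_derive_id. Qed.

Lemma cdiffD f g z l m :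
  cdiff f z l -> cdiff g z m -> cdiff (fun w => f w + g w) z (l + m).
Proof. by move=> [fl] [gm]; split; exact: (is_deriveD fl gm). Qed.

Lemma cdiffB f g z l m :
  cdiff f z l -> cdiff g z m -> cdiff (fun w => f w - g w) z (l - m).
Proof. by move=> [fl] [gm]; split; exact: (is_deriveB fl gm). Qed.

Lemma cdiffM f g z l m : cdiff f z l -> cdiff g z m ->
  cdiff (fun w => f w * g w) z (l * g z + f z * m).
Proof.
move=> [fl] [gm]; split; rewrite addrC (mulrC l).
exact: (is_deriveM fl gm).
Qed.

Lemma cdiffZ c f z l : cdiff f z l -> cdiff (fun w => c * f w) z (c * l).
Proof.
by move=> fl; apply: cdiff_eq (cdiffM (cdiff_cst c z) fl) _; rewrite mul0r add0r.
Qed.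

Lemma cdiffV f z l : f z != 0 -> cdiff f z l ->
  cdiff (fun w => (f w)^-1) z (- l / f z ^+ 2).
Proof.
move=> f0 [[fd fl]]; split; split; first exact: (derivableV f0 fd).
apply: etrans (deriveV f0 fd) _.
by rewrite fl /GRing.scale /= mulNr mulrC mulNr.
Qed.

Lemma cdiff_div f g z l m : g z != 0 -> cdiff f z l -> cdiff g z m ->
  cdiff (fun w => f w / g w) z ((l * g z - f z * m) / g z ^+ 2).
Proof.
move=> g0 fl gm; apply: cdiff_eq (cdiffM fl (cdiffV g0 gm)) _.
by field.
Qed.

Lemma cdiff_comp f g z l m : cdiff f z l -> cdiff g (f z) m ->
  cdiff (fun w => g (f w)) z (m * l).
Proof.
move=> /cdiffP fl /cdiffP gm; apply/cdiffP => e e0.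
have l0 := normc_ge0 l; have m0 := normc_ge0 m.
have [|d1 d10 h1] := gm (e / 2 / (normc l + 1)); first by rewrite !divr_gt0//; lra.
have [|d2 d20 h2] := fl (Num.min 1 (e / 2 / (normc m + 1))).
  by rewrite lt_min ltr01 /= !divr_gt0//; lra.
exists (Num.min d2 (d1 / (normc l + 1))) => [|h].
  by rewrite lt_min d20 divr_gt0//; lra.
rewrite lt_min => /andP[/h2 {}h2]; rewrite ltr_pdivlMr; last by lra.
move=> hd; set k := f (z + h) - f z in h2.
have k1 : normc k <= (normc l + 1) * normc h.
  apply: le_trans (normc_le_dist k (l * h)) _; rewrite normcM mulrDl lerD2l.
  by apply: le_trans h2 _; rewrite ler_wpM2r ?normc_ge0// ge_min lexx.
have fk : f (z + h) = f z + k by rewrite /k; ring.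
have {h1}H1 : normc (g (f z + k) - g (f z) - m * k) <= e / 2 * normc h.
  apply: le_trans (h1 _ _) _; first by apply: le_lt_trans k1 _; rewrite mulrC.
  rewrite -mulrA ler_wpM2l//; first lra.
  by rewrite ler_pdivrMl//; lra.
have {h2}H2 : normc (m * (k - l * h)) <= e / 2 * normc h.
  rewrite normcM; apply: le_trans (ler_wpM2l m0 h2) _.
  rewrite mulrA ler_wpM2r ?normc_ge0//.
  apply: (@le_trans _ _ (normc m * (e / 2 / (normc m + 1)))).
    by rewrite ler_wpM2l// ge_min lexx orbT.
  rewrite mulrA ler_pdivrMr; last by lra.
  by rewrite mulrC ler_wpM2l//; lra.
rewrite fk (_ : _ - _ - _ = (g (f z + k) - g (f z) - m * k) + m * (k - l * h)).
  by apply: le_trans (normcD _ _) _; lra.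
by ring.
Qed.

Lemma cdiff_ccont f z l : cdiff f z l -> ccont f z.
Proof.
by move=> [[fd _]]; split; apply: differentiable_continuous; apply/derivable1_diffP.
Qed.

Lemma cdiff_unique f z l m : cdiff f z l -> cdiff f z m -> l = m.
Proof. by move=> /cdiff_val <- /cdiff_val <-. Qed.

Lemma ccont_cst c z : ccont (fun=> c) z.
Proof. exact: cdiff_ccont (cdiff_cst c z). Qed.

Lemma ccont_id z : ccont (fun w => w) z.
Proof. exact: cdiff_ccont (cdiff_id z). Qed.

Lemma ccontD f g z : ccont f z -> ccont g z -> ccont (fun w => f w + g w) z.
Proof. by move=> [fc] [gc]; split; exact: (@cvgD R[i] R[i]^o R[i]^o (nbhs (z : R[i]^o)) _ f g (f z) (g z) fc gc). Qed.

Lemma ccontB f g z : ccont f z -> ccont g z -> ccont (fun w => f w - g w) z.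
Proof. by move=> [fc] [gc]; split; exact: (@cvgB R[i] R[i]^o R[i]^o (nbhs (z : R[i]^o)) _ f g (f z) (g z) fc gc). Qed.

Lemma ccontM f g z : ccont f z -> ccont g z -> ccont (fun w => f w * g w) z.
Proof. by move=> [fc] [gc]; split; exact: (@cvgZ R[i] R[i]^o R[i]^o (nbhs (z : R[i]^o)) _ f g (f z) (g z) fc gc). Qed.

Lemma ccontV f z : f z != 0 -> ccont f z -> ccont (fun w => (f w)^-1) z.
Proof.
move=> f0 [fc]; split.
exact: (@cvgV R[i] R[i]^o (nbhs (z : R[i]^o)) _ f (f z) f0 fc).
Qed.

Lemma ccont_comp f g z : ccont f z -> ccont g (f z) -> ccont (fun w => g (f w)) z.
Proof. by move=> [fc] [gc]; split; exact: (continuous_comp fc gc). Qed.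

(** A function that does not vanish at a point of continuity stays away from
    zero near it. *)
Lemma ccont_neq0 f z : ccont f z -> f z != 0 ->
  exists2 d : R, 0 < d & forall w, normc (w - z) < d -> f w != 0.
Proof.
move=> /ccontP fc f0; have [|d d0 h] := fc (normc (f z)); first by rewrite normc_gt0.
exists d => // w /h; apply: contraTneq => ->.
by rewrite sub0r normcN ltxx.
Qed.

End ComplexCalculus.

(** * Complex valued functions of a real variable *)

Section RealVariable.
Context {R : realType}.
Implicit Types (P Q : R -> R[i]) (t a b : R).

Lemma is_deriveP (f : R -> R) t l : is_derive t 1 f l <->
  forall e, 0 < e -> exists2 d, 0 < d & forall h, `|h| < d ->
    `|f (t + h) - f t - l * h| <= e * `|h|.
Proof.
have quot h : h != 0 ->
    h^-1 * (f (t + h) - f t) - l = h^-1 * (f (t + h) - f t - l * h).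
  by move=> h0; field.
split.
  move=> [hd hv] e e0.
  have : (fun h : R => h^-1 *: (f (h *: 1 + t) - f t)) @ 0^' --> l.
    rewrite -hv /derive; move: hd; rewrite /derivable => /cvg_ex[/= l' hl'].
    have := hl' => /cvg_lim -> //.
  move=> /cvgrPdist_lt /(_ _ e0).
  rewrite /nbhs /= /dnbhs /within /= => /nbhs_ballP [d d0 H].
  exists d => // h hd'; have [->|h0] := eqVneq h 0.
    by rewrite addr0 subrr mulr0 subr0 normr0 mulr0.
  have := H h; rewrite /ball /= sub0r normrN => /(_ hd' h0) /ltW.
  rewrite /GRing.scale /= mulr1 (addrC h t) distrC quot// normrM normfV.
  by rewrite mulrC ler_pdivrMr ?normr_gt0.
move=> H.
have Hc : (fun h : R => h^-1 *: (f (h *: 1 + t) - f t)) @ 0^' --> l.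
  apply/cvgrPdist_lt => e e0.
  have e20 : 0 < e / 2 by lra.
  have [d d0 hd] := H _ e20.
  rewrite /nbhs /= /dnbhs /within /=; apply/nbhs_ballP; exists d => // h.
  rewrite /ball /= sub0r normrN => hh h0.
  rewrite /GRing.scale /= mulr1 (addrC h t) distrC quot// normrM normfV mulrC.
  rewrite ltr_pdivrMr ?normr_gt0//; apply: le_lt_trans (hd _ hh) _.
  by rewrite ltr_pM2r ?normr_gt0//; lra.
split; first by apply/cvg_ex; exists l.
by apply: cvg_lim => //.
Qed.

Definition rdiff P t (l : R[i]) : Prop :=
  is_derive t 1 (fun s => Re (P s)) (Re l) /\
  is_derive t 1 (fun s => Im (P s)) (Im l).

Definition rcont P t : Prop :=
  {for t, continuous (fun s => Re (P s))} /\
  {for t, continuous (fun s => Im (P s))}.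

Definition line (p v : R[i]) t : R[i] := p + t%:C * v.

Lemma line_dist p v t s : line p v s - line p v t = (s - t)%:C * v.
Proof. by rewrite /line rmorphB /=; ring. Qed.

Lemma rdiff_line f p v t l : cdiff f (line p v t) l ->
  rdiff (fun s => f (line p v s)) t (l * v).
Proof.
move=> /cdiffP fl.
suff H (e : R) : 0 < e -> exists2 d : R, 0 < d & forall h, `|h| < d ->
    normc (f (line p v (t + h)) - f (line p v t) - l * v * h%:C) <= e * `|h|.
  split; apply/is_deriveP => e /H [d d0 hd]; exists d => // h /hd.
    apply: le_trans; apply: le_trans (Re_le_normc _); rewrite le_eqVlt; apply/orP; left.
    by apply/eqP; congr `|_|; rewrite !(cReD, cReN, cReM, cImM, cReC, cImC); ring.
  apply: le_trans; apply: le_trans (Im_le_normc _); rewrite le_eqVlt; apply/orP; left.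
  by apply/eqP; congr `|_|; rewrite !(cImD, cImN, cReM, cImM, cReC, cImC); ring.
move=> e0; have v1 : 0 < normc v + 1 by rewrite ltr_wpDl ?normc_ge0.
have [|d d0 hd] := fl (e / (normc v + 1)); first by rewrite divr_gt0.
exists (d / (normc v + 1)) => [|h]; first by rewrite divr_gt0.
rewrite ltr_pdivlMr// => hh.
have nE : normc (h%:C * v) = `|h| * normc v by rewrite normcM normc_real.
have := hd (h%:C * v); rewrite nE.
have -> : line p v t + h%:C * v = line p v (t + h) by rewrite /line rmorphD /=; ring.
have -> : l * (h%:C * v) = l * v * h%:C by ring.
move=> /(_ _)/le_trans; apply.
  by apply: le_lt_trans hh; rewrite ler_wpM2l// lerDl.
rewrite mulrAC ler_pdivrMr//.
have := mulr_ge0 (ltW e0) (normr_ge0 h); lra.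
Qed.

Lemma rcont_line f p v t : ccont f (line p v t) ->
  rcont (fun s => f (line p v s)) t.
Proof.
move=> /ccontP fc.
suff H (e : R) : 0 < e -> exists2 d : R, 0 < d & forall s, `|t - s| < d ->
    normc (f (line p v t) - f (line p v s)) < e.
  split; apply/cvgrPdist_lt => e /H [d d0 hd]; apply/nbhs_ballP; exists d => //= s /hd.
    by apply: le_lt_trans; rewrite -cReN -cReD; exact: Re_le_normc.
  by apply: le_lt_trans; rewrite -cImN -cImD; exact: Im_le_normc.
move=> /fc [d d0 hd]; have v1 : 0 < normc v + 1 by rewrite ltr_wpDl ?normc_ge0.
exists (d / (normc v + 1)) => [|s]; first by rewrite divr_gt0.
rewrite ltr_pdivlMr// => hh; rewrite normcB; apply: hd.
rewrite line_dist normcM normc_real distrC; apply: le_lt_trans hh.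
by rewrite ler_wpM2l// lerDl.
Qed.

Lemma is_derive_within (f df : R -> R) a b :
  (forall t, a <= t <= b -> is_derive t 1 f (df t)) ->
  {within `[a, b], continuous f}.
Proof.
move=> h; apply: derivable_within_continuous => t; rewrite in_itv /= => /h.
by case.
Qed.

Lemma is_derive_le (f df : R -> R) a b : a <= b ->
  (forall t, a <= t <= b -> is_derive t 1 f (df t)) ->
  (forall t, a <= t <= b -> 0 <= df t) -> f a <= f b.
Proof.
move=> ab h h0.
apply: (@ger0_derive1_le_cc _ f a b) => //.
- by move=> t; rewrite in_itv /= => /andP[ta tb]; case: (h t) => //; rewrite !ltW.
- move=> t; rewrite in_itv /= => /andP[ta tb].
  have tab : a <= t <= b by rewrite !ltW.
  by rewrite derive1E (@derive_val _ _ _ _ _ _ _ (h _ tab)) h0.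
- exact: is_derive_within h.
- by rewrite in_itv /= lexx.
- by rewrite in_itv /= lexx andbT.
Qed.

(** Testing against the direction of the increment turns the claim into the
    monotonicity of a real function. *)
Lemma mean_value_ineq P dP (G dG : R -> R) a b : a <= b ->
  (forall t, a <= t <= b -> rdiff P t (dP t)) ->
  (forall t, a <= t <= b -> is_derive t 1 G (dG t)) ->
  (forall t, a <= t <= b -> normc (dP t) <= dG t) ->
  normc (P b - P a) <= G b - G a.
Proof.
move=> ab hP hG hd; set v := P b - P a.
pose k t := normc v * G t - (Re v * Re (P t) + Im v * Im (P t)).
pose dk t := normc v * dG t - (Re v * Re (dP t) + Im v * Im (dP t)).
have cs (l : R[i]) : Re v * Re l + Im v * Im l <= normc v * normc l.
  apply: le_trans (_ : `|Re (v^* * l)| <= _).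
    apply: le_trans (ler_norm _); rewrite cReM; case: (v) => x y /=.
    by rewrite mulNr opprK.
  by rewrite -(normcJ v) -normcM; exact: Re_le_normc.
have : k a <= k b.
  apply: (@is_derive_le k dk) => // t tab.
    have [hr hi] := hP _ tab; have hg := hG _ tab; rewrite /dk.
    have := is_deriveB (is_deriveZ (normc v) hg)
      (is_deriveD (is_deriveZ (Re v) hr) (is_deriveZ (Im v) hi)).
    by apply.
  by rewrite subr_ge0; apply: le_trans (cs _) _; rewrite ler_wpM2l ?normc_ge0// hd.
have vv : normc v ^+ 2 = Re v * (Re (P b) - Re (P a)) + Im v * (Im (P b) - Im (P a)).
  by rewrite normc_sqr /v !(cReD, cReN, cImD, cImN); ring.
rewrite /k => kk.
have : normc v ^+ 2 <= normc v * (G b - G a) by rewrite vv; lra.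
have := normc_ge0 v; rewrite le_eqVlt => /predU1P[<- _|v0].
  have : G a <= G b; last by lra.
  apply: (@is_derive_le G dG) => // t tab.
  exact: le_trans (normc_ge0 _) (hd _ tab).
by rewrite expr2 ler_pM2l.
Qed.

(** Extending the integrand by its end values makes its integral function
    differentiable on a neighbourhood of the closed interval. *)
Lemma primitive_exists (f : R -> R) a b : a <= b ->
  (forall t, a <= t <= b -> {for t, continuous f}) ->
  exists F : R -> R, forall t, a <= t <= b -> is_derive t 1 F (f t).
Proof.
move=> ab fc.
pose cl t := Num.max a (Num.min b t).
have clE t : a <= t <= b -> cl t = t.
  by move=> /andP[at_ tb]; rewrite /cl (min_idPr tb) (max_idPr at_).
have clab t : a <= cl t <= b.
  by rewrite /cl le_max lexx /= ge_max ab ge_min lexx.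
have clc : continuous cl.
  move=> t; apply: continuous_max; first exact: cvg_cst.
  by apply: continuous_min; [exact: cvg_cst|exact: cvg_id].
have gc : continuous (f \o cl).
  move=> t; apply: continuous_comp; first exact: clc.
  exact: fc (clab t).
exists (fun x => \int[lebesgue_measure]_(t in `[a - 1, x]) (f \o cl) t) => t tab.
have tb1 : t < b + 1 by move/andP: tab => []; lra.
have [] := @continuous_FTC1 R (f \o cl) (BLeft (a - 1)) t (b + 1) tb1 _ _ (gc t).
- apply: continuous_compact_integrable; first exact: segment_compact.
  by apply: continuous_subspaceT.
- by rewrite lte_fin /=; move/andP: tab => []; lra.
rewrite /= (clE t tab) derive1E => hd <-; exact: derivableP.
Qed.

Lemma FTC2_closed (f F : R -> R) a b : a < b ->
  (forall t, a <= t <= b -> {for t, continuous f}) ->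
  (forall t, a <= t <= b -> is_derive t 1 F (f t)) ->
  (\int[lebesgue_measure]_(t in `[a, b]) (f t)%:E = (F b - F a)%:E)%E.
Proof.
move=> ab fc Ff; rewrite EFinB; apply: continuous_FTC2 => //.
- apply: continuous_in_subspaceT => t; rewrite inE /= in_itv /=; exact: fc.
- have Fc t : a <= t <= b -> {for t, continuous F}.
    by move=> /Ff[h _]; apply: differentiable_continuous; apply/derivable1_diffP.
  split.
  + by move=> t; rewrite in_itv /= => /andP[h1 h2]; case: (Ff t) => //; rewrite !ltW.
  + by apply: cvg_at_right_filter; apply: Fc; rewrite lexx ltW.
  + by apply: cvg_at_left_filter; apply: Fc; rewrite lexx ltW.
- move=> t; rewrite in_itv /= => /andP[h1 h2].
  by rewrite derive1E; case: (Ff t) => //; rewrite !ltW.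
Qed.

End RealVariable.

(** * Integrals over the boundary of a rectangle *)

Section CurveIntegral.
Context {R : realType}.
Implicit Types (P Q : R -> R[i]) (t a b : R).

Definition cint P a b : R[i] :=
  (\int[lebesgue_measure]_(t in `[a, b]) Re (P t))%R +i*
  (\int[lebesgue_measure]_(t in `[a, b]) Im (P t))%R.

Definition rcont_on P a b := forall t, a <= t <= b -> rcont P t.

Lemma cint_primitive P Q a b : a <= b -> rcont_on P a b ->
  (forall t, a <= t <= b -> rdiff Q t (P t)) -> cint P a b = Q b - Q a.
Proof.
rewrite le_eqVlt => /predU1P[<- _ _|ab Pc QP].
  by rewrite /cint set_itv1 !Rintegral_set1 subrr.
apply: complex_eqP; rewrite /= ?(cReD, cReN, cImD, cImN) /Rintegral.
- by rewrite (FTC2_closed ab (fun t tab => proj1 (Pc t tab))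
    (fun t tab => proj1 (QP t tab))).
- by rewrite (FTC2_closed ab (fun t tab => proj2 (Pc t tab))
    (fun t tab => proj2 (QP t tab))).
Qed.

Lemma cprimitive_exists P a b : a <= b -> rcont_on P a b ->
  exists Q, forall t, a <= t <= b -> rdiff Q t (P t).
Proof.
move=> ab Pc.
have [t tab|U hU] := @primitive_exists R (fun t => Re (P t)) a b ab.
  by case: (Pc _ tab).
have [t tab|V hV] := @primitive_exists R (fun t => Im (P t)) a b ab.
  by case: (Pc _ tab).
by exists (fun t => U t +i* V t) => t tab; split; [exact: hU|exact: hV].
Qed.

Lemma rdiffD P Q t l m : rdiff P t l -> rdiff Q t m ->
  rdiff (fun s => P s + Q s) t (l + m).
Proof.
move=> [h1 h2] [k1 k2]; split.
  rewrite cReD; under eq_fun do rewrite cReD; exact: (is_deriveD h1 k1).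
rewrite cImD; under eq_fun do rewrite cImD; exact: (is_deriveD h2 k2).
Qed.

Lemma rdiffZ c P t l : rdiff P t l -> rdiff (fun s => c * P s) t (c * l).
Proof.
move=> [h1 h2]; split.
  rewrite cReM; under eq_fun do rewrite cReM.
  exact: (is_deriveB (is_deriveZ (Re c) h1) (is_deriveZ (Im c) h2)).
rewrite cImM; under eq_fun do rewrite cImM.
exact: (is_deriveD (is_deriveZ (Re c) h2) (is_deriveZ (Im c) h1)).
Qed.

Lemma rcontD P Q t : rcont P t -> rcont Q t -> rcont (fun s => P s + Q s) t.
Proof.
move=> [h1 h2] [k1 k2]; split.
  rewrite (_ : (fun s => Re (P s + Q s)) = (fun s => Re (P s) + Re (Q s))).
    exact: (cvgD h1 k1).
  by apply/funext => s; rewrite cReD.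
rewrite (_ : (fun s => Im (P s + Q s)) = (fun s => Im (P s) + Im (Q s))).
  exact: (cvgD h2 k2).
by apply/funext => s; rewrite cImD.
Qed.

Lemma rcontZ c P t : rcont P t -> rcont (fun s => c * P s) t.
Proof.
move=> [h1 h2]; split.
  rewrite (_ : (fun s => Re (c * P s)) =
      (fun s => Re c * Re (P s) - Im c * Im (P s))).
    by apply: cvgB; (apply: cvgM; [exact: cvg_cst|]).
  by apply/funext => s; rewrite cReM.
rewrite (_ : (fun s => Im (c * P s)) =
    (fun s => Re c * Im (P s) + Im c * Re (P s))).
  by apply: cvgD; (apply: cvgM; [exact: cvg_cst|]).
by apply/funext => s; rewrite cImM.
Qed.

Lemma cintD P Q a b : a <= b -> rcont_on P a b -> rcont_on Q a b ->
  cint (fun t => P t + Q t) a b = cint P a b + cint Q a b.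
Proof.
move=> ab Pc Qc; have [F hF] := cprimitive_exists ab Pc.
have [G hG] := cprimitive_exists ab Qc.
rewrite (cint_primitive ab Pc hF) (cint_primitive ab Qc hG).
rewrite (@cint_primitive _ (fun t => F t + G t))//; first by ring.
- by move=> t tab; apply: rcontD; [exact: Pc|exact: Qc].
- by move=> t tab; apply: rdiffD; [exact: hF|exact: hG].
Qed.

Lemma cintZ c P a b : a <= b -> rcont_on P a b ->
  cint (fun t => c * P t) a b = c * cint P a b.
Proof.
move=> ab Pc; have [F hF] := cprimitive_exists ab Pc.
rewrite (cint_primitive ab Pc hF).
rewrite (@cint_primitive _ (fun t => c * F t))//; first by ring.
- by move=> t tab; apply: rcontZ; exact: Pc.
- by move=> t tab; apply: rdiffZ; exact: hF.
Qed.

Lemma cint_split P a b c : a <= b <= c -> rcont_on P a c ->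
  cint P a c = cint P a b + cint P b c.
Proof.
move=> /andP[ab bc] Pc; have ac := le_trans ab bc.
have [F hF] := cprimitive_exists ac Pc.
rewrite (cint_primitive ac Pc hF).
rewrite (@cint_primitive P F a b)// ?(@cint_primitive P F b c)//; first by ring.
- by move=> t /andP[h1 h2]; apply: Pc; rewrite (le_trans ab)//=.
- by move=> t /andP[h1 h2]; apply: hF; rewrite (le_trans ab)//=.
- by move=> t /andP[h1 h2]; apply: Pc; rewrite h1 (le_trans h2).
- by move=> t /andP[h1 h2]; apply: hF; rewrite h1 (le_trans h2).
Qed.

Lemma cint_normc_le P (G dG : R -> R) a b : a <= b -> rcont_on P a b ->
  (forall t, a <= t <= b -> is_derive t 1 G (dG t)) ->
  (forall t, a <= t <= b -> normc (P t) <= dG t) ->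
  normc (cint P a b) <= G b - G a.
Proof.
move=> ab Pc hG hd; have [F hF] := cprimitive_exists ab Pc.
by rewrite (cint_primitive ab Pc hF); apply: mean_value_ineq hd.
Qed.

Lemma cint_bound P M a b : a <= b -> rcont_on P a b ->
  (forall t, a <= t <= b -> normc (P t) <= M) ->
  normc (cint P a b) <= M * (b - a).
Proof.
move=> ab Pc hM; rewrite mulrBr.
apply: (@cint_normc_le P (fun t => M * t) (fun=> M)) => // t _.
by have := is_deriveZ M (is_derive_id t 1); rewrite /GRing.scale /= mulr1.
Qed.

Lemma cint_Im_ge P m a b : a <= b -> rcont_on P a b ->
  (forall t, a <= t <= b -> m <= Im (P t)) -> m * (b - a) <= Im (cint P a b).
Proof.
move=> ab Pc hM; have [F hF] := cprimitive_exists ab Pc.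
rewrite (cint_primitive ab Pc hF) cImD cImN.
suff : Im (F a) - m * a <= Im (F b) - m * b by lra.
apply: (@is_derive_le _ (fun t => Im (F t) - m * t) (fun t => Im (P t) - m)) => //.
- move=> t /hF[_ h].
  have := is_deriveB h (is_deriveZ m (is_derive_id t 1)).
  by rewrite /GRing.scale /= mulr1.
- by move=> t /hM; rewrite subr_ge0.
Qed.

End CurveIntegral.

#[global] Arguments cint : simpl never.

Section Rectangle.
Context {R : realType}.
Implicit Types (f g : R[i] -> R[i]) (z w l : R[i]).

(** The boundary is run through counterclockwise; [x0 x1] and [y0 y1] are the
    ranges of the real and the imaginary part. *)
Definition rect f (x0 x1 y0 y1 : R) : R[i] :=
  cint (fun t => f (t +i* y0)) x0 x1 + 'i * cint (fun t => f (x1 +i* t)) y0 y1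
  - cint (fun t => f (t +i* y1)) x0 x1 - 'i * cint (fun t => f (x0 +i* t)) y0 y1.

Definition bdry (x0 x1 y0 y1 : R) z : Prop :=
  x0 <= Re z <= x1 /\ (Im z = y0 \/ Im z = y1) \/
  y0 <= Im z <= y1 /\ (Re z = x0 \/ Re z = x1).

Definition inrect (x0 x1 y0 y1 : R) z : Prop := x0 <= Re z <= x1 /\ y0 <= Im z <= y1.

Lemma hlineE (y t : R) : line (0 +i* y) 1 t = t +i* y.
Proof. by rewrite /line; apply/eqP; rewrite eq_complex /=; apply/andP; split; apply/eqP; ring. Qed.

Lemma vlineE (x t : R) : line (x +i* 0) 'i t = x +i* t.
Proof. by rewrite /line; apply/eqP; rewrite eq_complex /=; apply/andP; split; apply/eqP; ring. Qed.

Lemma rdiff_h f y t l : cdiff f (t +i* y) l -> rdiff (fun s => f (s +i* y)) t l.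
Proof.
rewrite -hlineE => /rdiff_line; rewrite mulr1.
by under [fun s => f (line _ _ _)]eq_fun do rewrite hlineE.
Qed.

Lemma rdiff_v f x t l : cdiff f (x +i* t) l ->
  rdiff (fun s => f (x +i* s)) t (l * 'i).
Proof.
rewrite -vlineE => /rdiff_line.
by under [fun s => f (line _ _ _)]eq_fun do rewrite vlineE.
Qed.

Lemma rcont_h f y t : ccont f (t +i* y) -> rcont (fun s => f (s +i* y)) t.
Proof.
by rewrite -hlineE => /rcont_line; under eq_fun do rewrite hlineE.
Qed.

Lemma rcont_v f x t : ccont f (x +i* t) -> rcont (fun s => f (x +i* s)) t.
Proof.
by rewrite -vlineE => /rcont_line; under eq_fun do rewrite vlineE.
Qed.

Section Fixed.
Variables (x0 x1 y0 y1 : R).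
Hypotheses (x01 : x0 <= x1) (y01 : y0 <= y1).
Local Notation bd := (bdry x0 x1 y0 y1).

Lemma bdry_bottom t : x0 <= t <= x1 -> bd (t +i* y0).
Proof. by move=> h; left; split => //; left. Qed.
Lemma bdry_top t : x0 <= t <= x1 -> bd (t +i* y1).
Proof. by move=> h; left; split => //; right. Qed.
Lemma bdry_left t : y0 <= t <= y1 -> bd (x0 +i* t).
Proof. by move=> h; right; split => //; left. Qed.
Lemma bdry_right t : y0 <= t <= y1 -> bd (x1 +i* t).
Proof. by move=> h; right; split => //; right. Qed.

Lemma bdry_inrect z : bd z -> inrect x0 x1 y0 y1 z.
Proof.
by move=> [[h]|[h]] [] e; split; rewrite // e lexx// andbT.
Qed.

Lemma bdry_rcont f : (forall z, bd z -> ccont f z) ->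
  [/\ rcont_on (fun t => f (t +i* y0)) x0 x1, rcont_on (fun t => f (x1 +i* t)) y0 y1,
      rcont_on (fun t => f (t +i* y1)) x0 x1 & rcont_on (fun t => f (x0 +i* t)) y0 y1].
Proof.
move=> fc; split=> t tab.
- by apply: rcont_h; apply: fc; exact: bdry_bottom.
- by apply: rcont_v; apply: fc; exact: bdry_right.
- by apply: rcont_h; apply: fc; exact: bdry_top.
- by apply: rcont_v; apply: fc; exact: bdry_left.
Qed.

Lemma rectD f g : (forall z, bd z -> ccont f z) -> (forall z, bd z -> ccont g z) ->
  rect (fun z => f z + g z) x0 x1 y0 y1 = rect f x0 x1 y0 y1 + rect g x0 x1 y0 y1.
Proof.
move=> /bdry_rcont[f1 f2 f3 f4] /bdry_rcont[g1 g2 g3 g4].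
by rewrite /rect !cintD//; ring.
Qed.

Lemma rectZ c f : (forall z, bd z -> ccont f z) ->
  rect (fun z => c * f z) x0 x1 y0 y1 = c * rect f x0 x1 y0 y1.
Proof.
move=> /bdry_rcont[f1 f2 f3 f4].
by rewrite /rect !cintZ//; ring.
Qed.

Lemma rect_eq f g : (forall z, bd z -> f z = g z) -> rect f x0 x1 y0 y1 = rect g x0 x1 y0 y1.
Proof.
move=> fg; rewrite /rect /cint.
do ! [congr (_ + _)|congr (- _)|congr ('i * _)|congr (_ +i* _)];
  apply: eq_Rintegral => t; rewrite inE /= in_itv /= => tab; rewrite fg//;
  by [exact: bdry_bottom|exact: bdry_right|exact: bdry_top|exact: bdry_left].
Qed.

Lemma rect_bound M f : (forall z, bd z -> ccont f z) ->
  (forall z, bd z -> normc (f z) <= M) ->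
  normc (rect f x0 x1 y0 y1) <= M * (2 * (x1 - x0) + 2 * (y1 - y0)).
Proof.
move=> /bdry_rcont[f1 f2 f3 f4] fM.
have h1 := cint_bound x01 f1 (fun t tab => fM _ (bdry_bottom tab)).
have h2 := cint_bound y01 f2 (fun t tab => fM _ (bdry_right tab)).
have h3 := cint_bound x01 f3 (fun t tab => fM _ (bdry_top tab)).
have h4 := cint_bound y01 f4 (fun t tab => fM _ (bdry_left tab)).
rewrite /rect; apply: le_trans (normcDB _ _) _.
rewrite normcM normc_i mul1r.
have : normc (cint (fun t => f (t +i* y0)) x0 x1 + 'i * cint (fun t => f (x1 +i* t)) y0 y1
  - cint (fun t => f (t +i* y1)) x0 x1) <= M * (x1 - x0) + M * (y1 - y0) + M * (x1 - x0).
  apply: le_trans (normcDB _ _) _; apply: lerD h3.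
  by apply: le_trans (normcD _ _) _; rewrite normcM normc_i mul1r lerD.
lra.
Qed.

Lemma rect_primitive f F : (forall z, bd z -> ccont f z) ->
  (forall z, bd z -> cdiff F z (f z)) -> rect f x0 x1 y0 y1 = 0.
Proof.
move=> /bdry_rcont[f1 f2 f3 f4] hF; rewrite /rect.
rewrite (@cint_primitive _ _ (fun t => F (t +i* y0)))//; last first.
  by move=> t tab; apply: rdiff_h; apply: hF; exact: bdry_bottom.
rewrite (@cint_primitive _ (fun t => f (t +i* y1)) (fun t => F (t +i* y1)))//; last first.
  by move=> t tab; apply: rdiff_h; apply: hF; exact: bdry_top.
rewrite -!cintZ//.
rewrite (@cint_primitive _ _ (fun t => F (x1 +i* t)))//; last first.
- by move=> t tab; rewrite mulrC; apply: rdiff_v; apply: hF; exact: bdry_right.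
- by move=> t tab; apply: rcontZ; exact: f2.
rewrite (@cint_primitive _ _ (fun t => F (x0 +i* t)))//; last first.
- by move=> t tab; rewrite mulrC; apply: rdiff_v; apply: hF; exact: bdry_left.
- by move=> t tab; apply: rcontZ; exact: f4.
ring.
Qed.

Lemma rect_splitx f xm : x0 <= xm <= x1 -> (forall z, bd z -> ccont f z) ->
  rect f x0 x1 y0 y1 = rect f x0 xm y0 y1 + rect f xm x1 y0 y1.
Proof.
move=> xm01 /bdry_rcont[f1 f2 f3 f4].
by rewrite /rect (cint_split xm01 f1) (cint_split xm01 f3); ring.
Qed.

Lemma rect_splity f ym : y0 <= ym <= y1 -> (forall z, bd z -> ccont f z) ->
  rect f x0 x1 y0 y1 = rect f x0 x1 y0 ym + rect f x0 x1 ym y1.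
Proof.
move=> ym01 /bdry_rcont[f1 f2 f3 f4].
by rewrite /rect (cint_split ym01 f2) (cint_split ym01 f4); ring.
Qed.

End Fixed.
End Rectangle.

#[global] Arguments rect : simpl never.

(** * Goursat's lemma and Cauchy's formula for rectangles *)

Section Goursat.
Context {R : realType}.
Implicit Types (f g : R[i] -> R[i]) (z w l : R[i]).

Lemma nested_intervals (a b : nat -> R) : (forall n, a n <= a n.+1) ->
  (forall n, b n.+1 <= b n) -> (forall n, a n <= b n) ->
  exists p, forall n, a n <= p <= b n.
Proof.
move=> ai bd ab.
have am := proj1 (nondecreasing_seqP a) ai.
have bm := proj1 (nonincreasing_seqP b) bd.
have aub m n : a n <= b m.
  apply: le_trans (am _ _ (leq_maxl n m)) _.
  exact: le_trans (ab _) (bm _ _ (leq_maxr n m)).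
have hs : has_sup (range a).
  by split; [exists (a 0%N), 0%N | exists (b 0%N) => _ [n _ <-]].
exists (sup (range a)) => n; apply/andP; split.
  by apply: sup_upper_bound => //; exists n.
by apply: ge_sup; [exists (a 0%N), 0%N|move=> _ [m _ <-]].
Qed.

Let quad := (R * R * (R * R))%type.
Let wd (q : quad) := q.1.2 - q.1.1.
Let ht (q : quad) := q.2.2 - q.2.1.
Let rectq f (q : quad) := rect f q.1.1 q.1.2 q.2.1 q.2.2.

Lemma goursat_step f (e : R) (q : quad) : q.1.1 <= q.1.2 -> q.2.1 <= q.2.2 ->
  (forall z, inrect q.1.1 q.1.2 q.2.1 q.2.2 z -> ccont f z) ->
  e * (wd q ^+ 2 + ht q ^+ 2) < normc (rectq f q) ->
  exists q' : quad,
    [/\ q.1.1 <= q'.1.1 /\ q'.1.2 <= q.1.2, q.2.1 <= q'.2.1 /\ q'.2.2 <= q.2.2,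
        wd q' = wd q / 2, ht q' = ht q / 2 &
        e * (wd q' ^+ 2 + ht q' ^+ 2) < normc (rectq f q')].
Proof.
case: q => [[x0 x1] [y0 y1]] /= x01 y01 fc big.
pose xm := (x0 + x1) / 2; pose ym := (y0 + y1) / 2.
have xm01 : x0 <= xm <= x1 by rewrite /xm; apply/andP; split; lra.
have ym01 : y0 <= ym <= y1 by rewrite /ym; apply/andP; split; lra.
have fb : forall z, bdry x0 x1 y0 y1 z -> ccont f z.
  by move=> z /(bdry_inrect x01 y01) /fc.
have [x0m xm1] := andP xm01; have [y0m ym1] := andP ym01.
have sub a b (c d : R) : x0 <= a -> b <= x1 -> y0 <= c -> d <= y1 -> a <= b -> c <= d ->
    forall z, bdry a b c d z -> ccont f z.
  move=> h1 h2 h3 h4 ab cd z /(bdry_inrect ab cd) [/andP[k1 k2] /andP[k3 k4]].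
  by apply: fc; split; apply/andP; split; lra.
rewrite /rectq /= in big.
rewrite (rect_splitx xm01 fb) in big.
rewrite (rect_splity ym01) in big; last by apply: sub.
rewrite (rect_splity ym01) in big; last by apply: sub.
set r1 := rect f x0 xm y0 ym in big; set r2 := rect f x0 xm ym y1 in big.
set r3 := rect f xm x1 y0 ym in big; set r4 := rect f xm x1 ym y1 in big.
have t1 := normcD (r1 + r2) (r3 + r4).
have t2 := normcD r1 r2; have t3 := normcD r3 r4.
rewrite {1}/wd {1}/ht /= in big.
pose B := e * (((x1 - x0) / 2) ^+ 2 + ((y1 - y0) / 2) ^+ 2).
have BE : e * ((x1 - x0) ^+ 2 + (y1 - y0) ^+ 2) = 4 * B by rewrite /B; field.
have half : [/\ xm - x0 = (x1 - x0) / 2, x1 - xm = (x1 - x0) / 2,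
    ym - y0 = (y1 - y0) / 2 & y1 - ym = (y1 - y0) / 2].
  by rewrite /xm /ym; split; field.
case: half => e1 e2 e3 e4.
have [h1|h1] := ltP B (normc r1).
  exists ((x0, xm), (y0, ym)); rewrite /rectq /wd /ht /= e1 e3.
  by split=> //; split.
have [h2|h2] := ltP B (normc r2).
  exists ((x0, xm), (ym, y1)); rewrite /rectq /wd /ht /= e1 e4.
  by split=> //; split.
have [h3|h3] := ltP B (normc r3).
  exists ((xm, x1), (y0, ym)); rewrite /rectq /wd /ht /= e2 e3.
  by split=> //; split.
exists ((xm, x1), (ym, y1)); rewrite /rectq /wd /ht /= e2 e4.
split=> //; change (B < normc r4); lra.
Qed.

(** Bisection: a rectangle violating the claim contains ever smaller ones that
    violate it in proportion to their squared size, contradicting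
    differentiability at their common point. *)
Lemma goursat f x0 x1 y0 y1 : x0 <= x1 -> y0 <= y1 ->
  (forall z, inrect x0 x1 y0 y1 z -> exists l, cdiff f z l) ->
  rect f x0 x1 y0 y1 = 0.
Proof.
move=> x01 y01 fd; apply/eqP/negP => /negP; rewrite -normc_gt0 => r0.
pose q0 : quad := ((x0, x1), (y0, y1)).
pose e := normc (rect f x0 x1 y0 y1) / 2 / ((x1 - x0) ^+ 2 + (y1 - y0) ^+ 2 + 1).
have s0 : 0 < (x1 - x0) ^+ 2 + (y1 - y0) ^+ 2 + 1.
  by rewrite ltr_wpDl// addr_ge0// sqr_ge0.
have e0 : 0 < e by rewrite /e !divr_gt0.
pose ok (q : quad) := [/\ x0 <= q.1.1 /\ q.1.2 <= x1, y0 <= q.2.1 /\ q.2.2 <= y1,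
  0 <= wd q, 0 <= ht q & e * (wd q ^+ 2 + ht q ^+ 2) < normc (rectq f q)].
have ok0 : ok q0.
  split=> //=; rewrite /wd /ht /= ?subr_ge0//.
  rewrite /rectq /= /e mulrAC ltr_pdivrMr//.
  by have := sqr_ge0 (x1 - x0); have := sqr_ge0 (y1 - y0); nra.
have step (q : quad) : exists q' : quad, ok q ->
    [/\ ok q', q.1.1 <= q'.1.1 /\ q'.1.2 <= q.1.2, q.2.1 <= q'.2.1 /\ q'.2.2 <= q.2.2,
        wd q' = wd q / 2 & ht q' = ht q / 2].
  have [[[a b] [c d]]|nok] := pselect (ok q); last by exists q.
  rewrite /wd /ht !subr_ge0 => w0 h0 big.
  have [|q' [[h1 h2] [h3 h4] h5 h6 h7]] := goursat_step w0 h0 _ big.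
    move=> z [/andP[k1 k2] /andP[k3 k4]].
    have [|l /cdiff_ccont//] := fd z.
    by split; apply/andP; split; lra.
  exists q' => _; split=> //; split=> //.
  - by split; lra.
  - by split; lra.
  - by rewrite h5 /wd divr_ge0 ?subr_ge0.
  - by rewrite h6 /ht divr_ge0 ?subr_ge0.
have [F hF] := choice step.
pose s n := iter n F q0.
have oks n : ok (s n) by elim: n => [//|n /hF[]].
have [p1 hp1] : exists p1, forall n, (s n).1.1 <= p1 <= (s n).1.2.
  apply: nested_intervals => n; have [okn [a b] [c d] _ _] := hF _ (oks n) => //.
  by case: (oks n) => _ _; rewrite /wd subr_ge0.
have [p2 hp2] : exists p2, forall n, (s n).2.1 <= p2 <= (s n).2.2.
  apply: nested_intervals => n; have [okn [a b] [c d] _ _] := hF _ (oks n) => //.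
  by case: (oks n) => _ _ _; rewrite /ht subr_ge0.
have wdn n : wd (s n) = wd q0 / 2 ^+ n.
  elim: n => [|n ih]; first by rewrite expr0 divr1.
  have [_ _ _ + _] := hF _ (oks n); rewrite /s iterS -/(s n) => ->; rewrite ih exprS.
  by field; rewrite expf_neq0.
have htn n : ht (s n) = ht q0 / 2 ^+ n.
  elim: n => [|n ih]; first by rewrite expr0 divr1.
  have [_ _ _ _ +] := hF _ (oks n); rewrite /s iterS -/(s n) => ->; rewrite ih exprS.
  by field; rewrite expf_neq0.
pose p := p1 +i* p2.
have [l /cdiffP fl] : exists l, cdiff f p l.
  by apply: fd; split; [exact: hp1 0%N|exact: hp2 0%N].
have e40 : 0 < e / 4 by lra.
have [d d0 hd] := fl _ e40.
have [n hn] : exists n, wd (s n) + ht (s n) < d.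
  have S0 : 0 <= wd q0 + ht q0 by case: ok0 => _ _ *; rewrite addr_ge0.
  have [n hn] : exists n : nat, (wd q0 + ht q0) / d < n%:R.
    exists (Num.truncn ((wd q0 + ht q0) / d)).+1.
    by apply: truncnS_gt.
  exists n; rewrite wdn htn -mulrDl ltr_pdivrMr ?exprn_gt0//.
  rewrite ltr_pdivrMr// in hn; apply: lt_le_trans hn _.
  rewrite mulrC ler_wpM2l ?(ltW d0)//.
  by rewrite -natrX ler_nat ltnW// ltn_expl.
have [[a b] [a' b'] w0 h0 big] := oks n.
move: big; apply/negP; rewrite -leNgt.
have wn0 : (s n).1.1 <= (s n).1.2 by move: w0; rewrite subr_ge0.
have hn0 : (s n).2.1 <= (s n).2.2 by move: h0; rewrite subr_ge0.
have inr z : bdry (s n).1.1 (s n).1.2 (s n).2.1 (s n).2.2 z ->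
    (exists l, cdiff f z l) /\ normc (z - p) <= wd (s n) + ht (s n).
  move=> /(bdry_inrect wn0 hn0) [/andP[k1 k2] /andP[k3 k4]]; split.
    by apply: fd; split; apply/andP; split; lra.
  have /andP[k5 k6] := hp1 n; have /andP[k7 k8] := hp2 n.
  apply: le_trans (normc_le_ReIm _) _; rewrite cReD cReN cImD cImN /= /wd /ht.
  by apply: lerD; rewrite ler_norml; apply/andP; split; lra.
have fc z : bdry (s n).1.1 (s n).1.2 (s n).2.1 (s n).2.2 z -> ccont f z.
  by move=> /inr[[m /cdiff_ccont]].
(* the affine part of [f] at [p] has a primitive, so only the remainder counts *)
pose lin z := f p + l * (z - p).
pose Lin z := f p * z + l * ((z - p) * (z - p) * (2^-1)).
have linD z : cdiff lin z l.
  apply: cdiff_eq (cdiffD (cdiff_cst _ _) (cdiffZ l (cdiffB (cdiff_id z) (cdiff_cst _ _)))) _.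
  ring.
have LinD z : cdiff Lin z (lin z).
  have zp := cdiffB (cdiff_id z) (cdiff_cst p z).
  apply: cdiff_eq (cdiffD (cdiffZ (f p) (cdiff_id z))
    (cdiffZ l (cdiffM (cdiffM zp zp) (cdiff_cst (2^-1) z)))) _.
  by rewrite /lin; field.
have lin0 : rectq lin (s n) = 0.
  apply: (@rect_primitive _ _ _ _ _ wn0 hn0 lin Lin) => u _; last exact: LinD.
  exact: cdiff_ccont (linD u).
have -> : rectq f (s n) = rectq (fun w => f w + (-1) * lin w) (s n).
  have lc u : ccont lin u := cdiff_ccont (linD u).
  have nlc u : ccont (fun w => (-1) * lin w) u by apply: ccontM => //; exact: ccont_cst.
  by rewrite /rectq rectD// rectZ// -/(rectq lin (s n)) lin0; ring.
pose D := wd (s n) + ht (s n).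
apply: (@le_trans _ _ (e / 4 * D * (2 * wd (s n) + 2 * ht (s n)))).
  apply: rect_bound => // z /[dup] zb /inr[[m fm] zp].
    apply: ccontD; first exact: cdiff_ccont fm.
    by apply: ccontM; [exact: ccont_cst|exact: cdiff_ccont (linD z)].
  have {}hd := hd (z - p) (le_lt_trans zp hn).
  rewrite (_ : _ + _ = f (p + (z - p)) - f p - l * (z - p)); last first.
    by rewrite (_ : p + (z - p) = z) /lin; ring.
  by apply: le_trans hd _; rewrite ler_wpM2l// ltW.
rewrite /D; set x := wd _ in w0 *; set y := ht _ in h0 *.
have : (x + y) ^+ 2 <= 2 * (x ^+ 2 + y ^+ 2) by have := sqr_ge0 (x - y); lra.
move=> /(ler_wpM2l (ltW e0)); lra.
Qed.

End Goursat.

Section CauchyFormula.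
Context {R : realType}.
Implicit Types (f g k : R[i] -> R[i]) (z w l : R[i]).

(** Only the shrinking square around the puncture contributes to the integral,
    and its contribution is bounded by its perimeter. *)
Lemma goursat_puncture g w x0 x1 y0 y1 M (d : R) :
  x0 < Re w < x1 -> y0 < Im w < y1 ->
  (forall z, inrect x0 x1 y0 y1 z -> z != w -> exists l, cdiff g z l) ->
  0 < d -> (forall z, z != w -> normc (z - w) < d -> normc (g z) <= M) ->
  rect g x0 x1 y0 y1 = 0.
Proof.
case: w => a b /= /andP[x0a ax1] /andP[y0b by1] gd d0 gM.
set w := a +i* b.
suff small (e : R) : 0 < e -> e < a - x0 -> e < x1 - a -> e < b - y0 -> e < y1 - b ->
    2 * e < d -> normc (rect g x0 x1 y0 y1) <= 8 * `|M| * e.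
  apply/eqP; rewrite -normc_eq0; apply/negP => /negP r0.
  have {}r0 : 0 < normc (rect g x0 x1 y0 y1) by rewrite lt_def r0 normc_ge0.
  set r := normc _ in r0.
  pose e1 := Num.min (Num.min (a - x0) (x1 - a)) (Num.min (b - y0) (y1 - b)).
  pose e2 := Num.min d (r / (8 * `|M| + 1)).
  pose e := Num.min e1 e2 / 2 / 2.
  have M1 : 0 < 8 * `|M| + 1 by have := normr_ge0 M; lra.
  have e10 : 0 < e1 by rewrite /e1 !lt_min; apply/andP; split; apply/andP; split; lra.
  have e20 : 0 < e2 by rewrite /e2 !lt_min d0 divr_gt0.
  have m0 : 0 < Num.min e1 e2 by rewrite lt_min e10.
  have [m1 m2] : Num.min e1 e2 <= e1 /\ Num.min e1 e2 <= e2.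
    by split; rewrite ge_min lexx ?orbT.
  have [k1 k2] : e1 <= Num.min (a - x0) (x1 - a) /\ e1 <= Num.min (b - y0) (y1 - b).
    by split; rewrite ge_min lexx ?orbT.
  have [k3 k4] : Num.min (a - x0) (x1 - a) <= a - x0 /\ Num.min (a - x0) (x1 - a) <= x1 - a.
    by split; rewrite ge_min lexx ?orbT.
  have [k5 k6] : Num.min (b - y0) (y1 - b) <= b - y0 /\ Num.min (b - y0) (y1 - b) <= y1 - b.
    by split; rewrite ge_min lexx ?orbT.
  have [k7 k8] : e2 <= d /\ e2 <= r / (8 * `|M| + 1) by split; rewrite ge_min lexx ?orbT.
  have e0 : 0 < e by rewrite /e; lra.
  have := small e e0; rewrite -/r.
  have -> : (e < a - x0) by rewrite /e; lra.
  have -> : (e < x1 - a) by rewrite /e; lra.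
  have -> : (e < b - y0) by rewrite /e; lra.
  have -> : (e < y1 - b) by rewrite /e; lra.
  have -> : (2 * e < d) by rewrite /e; lra.
  move=> /(_ isT isT isT isT isT).
  have : e < r / (8 * `|M| + 1) by rewrite /e; lra.
  by rewrite ltr_pdivlMr// => h1 h2; lra.
move=> e0 h1 h2 h3 h4 h5.
have side x x' y y' : x0 <= x -> x <= x' -> x' <= x1 -> y0 <= y -> y <= y' -> y' <= y1 ->
    ~ inrect x x' y y' w -> rect g x x' y y' = 0.
  move=> p1 p2 p3 p4 p5 p6 nin; apply: goursat => // z inz; apply: gd.
    by case: inz => /andP[? ?] /andP[? ?]; split; apply/andP; split; lra.
  by apply/eqP => zw; apply: nin; move: inz; rewrite zw.
have gc x x' y y' : x0 <= x -> x <= x' -> x' <= x1 -> y0 <= y -> y <= y' -> y' <= y1 ->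
    ~ bdry x x' y y' w -> forall z, bdry x x' y y' z -> ccont g z.
  move=> p1 p2 p3 p4 p5 p6 nin z bz.
  have [l /cdiff_ccont//] : exists l, cdiff g z l.
  apply: gd; last by apply/eqP => zw; apply: nin; move: bz; rewrite zw.
  have [/andP[? ?] /andP[? ?]] := bdry_inrect p2 p5 bz.
  by split; apply/andP; split; lra.
rewrite (@rect_splitx _ _ _ _ _ _ (a - e)); last 2 first.
- by apply/andP; split; lra.
- apply: gc; rewrite ?lexx//; try lra.
  by move=> [] /= [_ []]; lra.
rewrite [rect g x0 _ _ _]side ?lexx//; try lra; last first.
  by move=> [] /= /andP[? ?] _; lra.
rewrite add0r (@rect_splitx _ _ _ _ _ _ (a + e)); last 2 first.
- by apply/andP; split; lra.
- apply: gc; rewrite ?lexx//; try lra.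
  by move=> [] /= [_ []]; lra.
rewrite [rect g (a + e) _ _ _]side ?lexx//; try lra; last first.
  by move=> [] /= /andP[? ?] _; lra.
rewrite addr0 (@rect_splity _ _ _ _ _ _ (b - e)); last 2 first.
- by apply/andP; split; lra.
- apply: gc; rewrite ?lexx//; try lra.
  by move=> [] /= [_ []]; lra.
rewrite [rect g _ _ y0 _]side ?lexx//; try lra; last first.
  by move=> [] /= _ /andP[? ?]; lra.
rewrite add0r (@rect_splity _ _ _ _ _ _ (b + e)); last 2 first.
- by apply/andP; split; lra.
- apply: gc; rewrite ?lexx//; try lra.
  by move=> [] /= [_ []]; lra.
rewrite [rect g _ _ (b + e) _]side ?lexx//; try lra; last first.
  by move=> [] /= _ /andP[? ?]; lra.
rewrite addr0.
have xe : a - e <= a + e by lra.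
have ye : b - e <= b + e by lra.
have nb : ~ bdry (a - e) (a + e) (b - e) (b + e) w by move=> [] /= [_ []]; lra.
apply: (@le_trans _ _ (`|M| * (2 * ((a + e) - (a - e)) + 2 * ((b + e) - (b - e))))).
  apply: rect_bound => // [|z bz]; first by apply: gc; rewrite //; lra.
  apply: le_trans (ler_norm M).
  apply: gM; first by apply/eqP => zw; apply: nb; move: bz; rewrite zw.
  have [/andP[? ?] /andP[? ?]] := bdry_inrect xe ye bz.
  apply: le_lt_trans (normc_le_ReIm _) _; rewrite cReD cReN cImD cImN /=.
  apply: (@le_lt_trans _ _ (e + e)); last by lra.
  by apply: lerD; rewrite ler_norml; apply/andP; split; lra.
by rewrite le_eqVlt; apply/orP; left; apply/eqP; ring.
Qed.

Lemma bdry_neq w x0 x1 y0 y1 : x0 < Re w < x1 -> y0 < Im w < y1 ->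
  forall z, bdry x0 x1 y0 y1 z -> z - w != 0.
Proof.
move=> /andP[h1 h2] /andP[h3 h4] z bz; rewrite subr_eq0; apply/eqP => zw.
by move: bz; rewrite zw => -[] [_ []]; lra.
Qed.

Lemma ccont_kernel f w z : ccont f z -> z - w != 0 -> ccont (fun u => f u / (u - w)) z.
Proof.
move=> fc zw; have uc := ccontB (ccont_id z) (ccont_cst w z).
exact: (ccontM fc (ccontV (f := fun u => u - w) zw uc)).
Qed.

(** The difference quotient at [w] is bounded near [w] and holomorphic
    elsewhere. *)
Lemma cauchy_formula f w x0 x1 y0 y1 :
  x0 < Re w < x1 -> y0 < Im w < y1 ->
  (forall z, inrect x0 x1 y0 y1 z -> exists l, cdiff f z l) ->
  f w * rect (fun z => 1 / (z - w)) x0 x1 y0 y1 = rect (fun z => f z / (z - w)) x0 x1 y0 y1.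
Proof.
move=> wx wy fd.
have x01 : x0 <= x1 by move/andP: wx => []; lra.
have y01 : y0 <= y1 by move/andP: wy => []; lra.
have [l fl] : exists l, cdiff f w l.
  by apply: fd; case/andP: wx => ? ?; case/andP: wy => ? ?; split; apply/andP; split; lra.
have [d d0 hd] := iffLR (cdiffP _ _ _) fl 1 ltr01.
pose g z := (f z - f w) / (z - w).
have g0 : rect g x0 x1 y0 y1 = 0.
  apply: (@goursat_puncture g w _ _ _ _ (normc l + 1) d) => //.
    move=> z /fd[m fm] zw; have zw0 : z - w != 0 by rewrite subr_eq0.
    eexists; exact: (@cdiff_div _ (fun u => f u - f w) (fun u => u - w) z _ _ zw0
      (cdiffB fm (cdiff_cst (f w) z))
      (cdiffB (cdiff_id z) (cdiff_cst w z))).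
  move=> z zw /hd; rewrite (_ : w + (z - w) = z); last by ring.
  have zw0 : z - w != 0 by rewrite subr_eq0.
  rewrite /g normc_div mul1r ler_pdivrMr ?normc_gt0// => h.
  have := normc_le_dist (f z - f w) (l * (z - w)).
  by rewrite normcM mulrDl; lra.
have nz := bdry_neq wx wy.
have fc z : bdry x0 x1 y0 y1 z -> ccont f z.
  by move=> /(bdry_inrect x01 y01) /fd[m /cdiff_ccont].
have kc z : bdry x0 x1 y0 y1 z -> ccont (fun z => 1 / (z - w)) z.
  by move=> /nz; apply: ccont_kernel; exact: ccont_cst.
have fkc z : bdry x0 x1 y0 y1 z -> ccont (fun z => f z / (z - w)) z.
  by move=> /[dup] /fc h /nz; apply: ccont_kernel.
move: g0; rewrite (@rect_eq _ _ _ _ _ g (fun z => f z / (z - w) + (- f w) * (1 / (z - w)))).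
  rewrite rectD//; last by move=> z zb; exact: (ccontM (ccont_cst _ _) (kc _ zb)).
  by rewrite rectZ// mulNr => /subr0_eq ->.
by move=> z /nz zb; rewrite /g; field.
Qed.

Lemma ccont_inv w z : z - w != 0 -> ccont (fun z => 1 / (z - w)) z.
Proof. by apply: ccont_kernel; exact: ccont_cst. Qed.

(** On each side of the square the imaginary part of the integrand is at least
    the inverse of the side length; the exact value is [2 * pi]. *)
Lemma index_ge4 w (s : R) : 0 < s ->
  4 <= Im (rect (fun z => 1 / (z - w)) (Re w - s) (Re w + s) (Im w - s) (Im w + s)).
Proof.
case: w => a b s0; set w := a +i* b.
change (Re w) with a; change (Im w) with b.
have xs : a - s <= a + s by lra.
have ys : b - s <= b + s by lra.
have nz : forall z, bdry (a - s) (a + s) (b - s) (b + s) z -> z - w != 0.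
  by apply: bdry_neq; rewrite /=; apply/andP; split; lra.
have [c1 c2 c3 c4] := bdry_rcont (f := (fun z => 1 / (z - w))) (fun z zb => ccont_inv (nz z zb)).
have invE (x y : R) : 1 / (x +i* y : R[i]) = (x / (x ^+ 2 + y ^+ 2)) +i* (- y / (x ^+ 2 + y ^+ 2)).
  by rewrite mul1r -[(_ +i* _)^-1]/(ComplexField.invc _) /= !mulNr.
have est (x : R) : - s <= x <= s -> (2 * s)^-1 <= s / (x ^+ 2 + s ^+ 2).
  move=> /andP[h1 h2]; have p : 0 < x ^+ 2 + s ^+ 2.
    by rewrite ltr_wpDl ?sqr_ge0 ?exprn_gt0.
  rewrite ler_pdivlMr// -ler_pdivlMl ?invr_gt0; last by lra.
  by rewrite invrK; nra.
have subE (x y : R) : (x +i* y) - w = (x - a) +i* (y - b) by [].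
pose m := (2 * s)^-1.
have mE u : m * ((u + s) - (u - s)) = 1 by rewrite /m; field; lra.
have I1 : m * ((a + s) - (a - s)) <= Im (cint (fun t => 1 / ((t +i* (b - s)) - w)) (a - s) (a + s)).
  apply: cint_Im_ge => // t /andP[h1 h2]; rewrite subE invE /=.
  rewrite (_ : - (b - s - b) = s); last by ring.
  rewrite (_ : (b - s - b) ^+ 2 = s ^+ 2); last by ring.
  by apply: est; apply/andP; split; lra.
have I2 : m * ((b + s) - (b - s)) <= Im ('i * cint (fun t => 1 / (((a + s) +i* t) - w)) (b - s) (b + s)).
  rewrite -cintZ//; apply: cint_Im_ge => // [t tb|t /andP[h1 h2]].
    by apply: rcontZ; exact: c2.
  rewrite subE invE cImM /= mul0r add0r mul1r.
  rewrite (_ : (a + s - a) = s); last by ring.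
  by rewrite [s ^+ 2 + _]addrC; apply: est; apply/andP; split; lra.
have I3 : m * ((a + s) - (a - s)) <= Im (-1 * cint (fun t => 1 / ((t +i* (b + s)) - w)) (a - s) (a + s)).
  rewrite -cintZ//; apply: cint_Im_ge => // [t tb|t /andP[h1 h2]].
    by apply: rcontZ; exact: c3.
  rewrite subE invE mulN1r cImN /=.
  rewrite (_ : (b + s - b) = s); last by ring.
  by rewrite mulNr opprK; apply: est; apply/andP; split; lra.
have I4 : m * ((b + s) - (b - s)) <= Im (-'i * cint (fun t => 1 / (((a - s) +i* t) - w)) (b - s) (b + s)).
  rewrite -cintZ//; apply: cint_Im_ge => // [t tb|t /andP[h1 h2]].
    by apply: rcontZ; exact: c4.
  rewrite subE invE mulNr cImN cImM /= mul0r add0r mul1r.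
  rewrite (_ : (a - s - a) = - s); last by ring.
  by rewrite mulNr opprK sqrrN [s ^+ 2 + _]addrC; apply: est; apply/andP; split; lra.
rewrite !mE in I1 I2 I3 I4.
rewrite /rect. rewrite !cImD !cImN; move: I3 I4; rewrite mulN1r mulNr !cImN; lra.
Qed.

End CauchyFormula.

(** * Real functions on the plane *)

Section PlaneContinuity.
Context {R : realType}.
Implicit Types (v : R[i] -> R) (z w c : R[i]).

Definition vcont v z : Prop := forall e : R, 0 < e ->
  exists2 d : R, 0 < d & forall w, normc (w - z) < d -> `|v w - v z| < e.

Lemma vcont_normc f z : ccont f z -> vcont (fun w => normc (f w)) z.
Proof.
move=> /ccontP fc e /fc [d d0 hd]; exists d => // w /hd.
exact: le_lt_trans (normc_dist _ _).
Qed.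

Lemma vcontD u v z : vcont u z -> vcont v z -> vcont (fun w => u w + v w) z.
Proof.
move=> uc vc e e0; have e20 : 0 < e / 2 by lra.
have [d1 d10 h1] := uc _ e20; have [d2 d20 h2] := vc _ e20.
exists (Num.min d1 d2) => [|w]; first by rewrite lt_min d10.
rewrite lt_min => /andP[/h1 k1 /h2 k2].
rewrite (_ : _ - _ = (u w - u z) + (v w - v z)); last by ring.
by apply: le_lt_trans (ler_normD _ _) _; lra.
Qed.

Lemma vcontM u v z : vcont u z -> vcont v z -> vcont (fun w => u w * v w) z.
Proof.
move=> uc vc e e0.
pose B := `|u z| + `|v z| + 1.
have B0 : 0 < B by rewrite /B ltr_wpDl ?addr_ge0.
pose e' := Num.min 1 (e / 2 / B).
have e'0 : 0 < e' by rewrite /e' lt_min ltr01 /= !divr_gt0.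
have [d1 d10 h1] := uc _ e'0; have [d2 d20 h2] := vc _ e'0.
exists (Num.min d1 d2) => [|w]; first by rewrite lt_min d10.
rewrite lt_min => /andP[/h1 k1 /h2 k2].
rewrite (_ : _ - _ = u w * (v w - v z) + v z * (u w - u z)); last by ring.
apply: le_lt_trans (ler_normD _ _) _; rewrite !normrM.
have e'1 : e' <= 1 by rewrite /e' ge_min lexx.
have e'2 : e' * B <= e / 2 by rewrite -ler_pdivlMr// /e' ge_min lexx orbT.
have uw : `|u w| <= `|u z| + 1.
  have := ler_normD (u z) (u w - u z); rewrite addrC subrK; lra.
have := normr_ge0 (u z); have := normr_ge0 (v z).
move=> V0 U0; apply: (@le_lt_trans _ _ ((`|u z| + 1) * e' + `|v z| * e')).
  by apply: lerD; apply: ler_pM => //; lra.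
by move: e'2; rewrite /B; lra.
Qed.

Lemma vcont_cst (a : R) z : vcont (fun=> a) z.
Proof. by move=> e e0; exists 1 => // w _; rewrite subrr normr0. Qed.

Lemma vcont_plane v (p : R * R) : vcont v (p.1 +i* p.2) ->
  {for p, continuous (fun q : R * R => v (q.1 +i* q.2))}.
Proof.
move=> vc; apply/cvgrPdist_lt => e /vc[d d0 hd]; apply/(@nbhs_ballP R (R * R)%type).
exists (d / 2) => [|q [/= h1 h2]]; first by rewrite /= divr_gt0.
rewrite distrC; apply: hd; apply: le_lt_trans (normc_le_ReIm _) _.
rewrite cReD cImD cReN cImN /=.
by move: h1 h2; rewrite /ball /= distrC (distrC p.2); lra.
Qed.

Lemma EVT_cdisc v c (r : R) : 0 <= r -> (forall z, normc (z - c) <= r -> vcont v z) ->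
  exists2 m, normc (m - c) <= r & forall z, normc (z - c) <= r -> v z <= v m.
Proof.
move=> r0 vc.
pose toC (q : R * R) : R[i] := q.1 +i* q.2.
pose A := [set q : R * R | normc (toC q - c) <= r].
pose Bx := `[Re c - r, Re c + r]%classic `*` `[Im c - r, Im c + r]%classic.
have nc : continuous (fun q : R * R => normc (toC q - c)).
  move=> q; apply: (@vcont_plane (fun z => normc (z - c)) q).
  by apply: vcont_normc; apply: ccontB; [exact: ccont_id|exact: ccont_cst].
have AB : A = Bx `&` A.
  apply/seteqP; split => [q qA|q []//]; split => //.
  have h1 := le_trans (Re_le_normc _) qA; have h2 := le_trans (Im_le_normc _) qA.
  move: h1 h2; rewrite cReD cReN cImD cImN /= !ler_norml => /andP[? ?] /andP[? ?].
  by split; rewrite /= in_itv /=; apply/andP; split; lra.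
have Ac : compact A.
  rewrite AB; apply: compact_closedI.
    by apply: compact_setX; exact: segment_compact.
  have -> : A = (fun q : R * R => normc (toC q - c)) @^-1` [set x | x <= r] by [].
  by apply: closed_comp => [q _|]; [exact: nc|exact: closed_le].
have [|||m mA hm] := @compact_EVT_max _ R (fun q : R * R => v (toC q)) A.
- exists (Re c, Im c); rewrite /A /toC /=; case: (c) => x y /=.
  by rewrite subrr normc0.
- exact: Ac.
- by apply: continuous_in_subspaceT => q; rewrite inE => qA; exact: vcont_plane (vc _ qA).
exists (toC m); first by move: mA; rewrite inE.
move=> z zr; have := hm (Re z, Im z); rewrite /toC /=; case: z zr => x y zr; apply.
by rewrite inE.
Qed.

End PlaneContinuity.

(** * Derivatives of holomorphic functions are holomorphic *)

Section HolomorphicDerivative.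
Context {R : realType}.
Implicit Types (f g k : R[i] -> R[i]) (z w l : R[i]).

(** Differentiation under the integral sign; a remainder that is quadratic,
    uniformly on the boundary, makes limit theorems superfluous. *)
Lemma rect_param_cdiff x0 x1 y0 y1 (K : R[i] -> R[i] -> R[i]) K' w (c d : R) :
  x0 <= x1 -> y0 <= y1 -> 0 <= c -> 0 < d ->
  (forall h z, normc h < d -> bdry x0 x1 y0 y1 z -> ccont (K (w + h)) z) ->
  (forall z, bdry x0 x1 y0 y1 z -> ccont K' z) ->
  (forall h z, normc h < d -> bdry x0 x1 y0 y1 z ->
     normc (K (w + h) z - K w z - h * K' z) <= c * normc h ^+ 2) ->
  cdiff (fun v => rect (K v) x0 x1 y0 y1) w (rect K' x0 x1 y0 y1).
Proof.
move=> x01 y01 c0 d0 Kc Kc' hK; apply/cdiffP => e e0.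
pose L := 2 * (x1 - x0) + 2 * (y1 - y0).
have L0 : 0 <= L by rewrite /L; lra.
have cL0 : 0 < c * L + 1 by rewrite ltr_wpDl ?mulr_ge0.
exists (Num.min d (e / (c * L + 1))) => [|h]; first by rewrite lt_min d0 divr_gt0.
rewrite lt_min => /andP[hd]; rewrite ltr_pdivlMr// => he.
have Kwc z : bdry x0 x1 y0 y1 z -> ccont (K w) z.
  by move=> zb; have := Kc 0 z; rewrite addr0 normc0; apply.
have Kwhc z : bdry x0 x1 y0 y1 z -> ccont (K (w + h)) z by exact: Kc.
have nKwc z : bdry x0 x1 y0 y1 z -> ccont (fun z => (-1) * K w z) z.
  by move=> zb; exact: (ccontM (ccont_cst _ _) (Kwc _ zb)).
have hKc z : bdry x0 x1 y0 y1 z -> ccont (fun z => (- h) * K' z) z.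
  by move=> zb; exact: (ccontM (ccont_cst _ _) (Kc' _ zb)).
have sc z : bdry x0 x1 y0 y1 z -> ccont (fun z => (-1) * K w z + (- h) * K' z) z.
  by move=> zb; exact: (ccontD (nKwc _ zb) (hKc _ zb)).
have -> : rect (K (w + h)) x0 x1 y0 y1 - rect (K w) x0 x1 y0 y1 - rect K' x0 x1 y0 y1 * h =
    rect (fun z => K (w + h) z + ((-1) * K w z + (- h) * K' z)) x0 x1 y0 y1.
  by rewrite !rectD// !rectZ//; ring.
apply: le_trans (_ : c * normc h ^+ 2 * L <= _).
  apply: rect_bound => // z zb.
    exact: (ccontD (Kwhc _ zb) (sc _ zb)).
  apply: le_trans (hK h z hd zb); rewrite le_eqVlt; apply/orP; left.
  by apply/eqP; congr normc; ring.
have h0 := normc_ge0 h.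
rewrite expr2 (_ : c * _ * L = (normc h * (c * L)) * normc h); last by ring.
rewrite ler_wpM2r//; apply: le_trans (_ : normc h * (c * L + 1) <= _); last exact: ltW.
by rewrite ler_wpM2l//; lra.
Qed.

Lemma kernel1_remainder (k u h : R[i]) (M m : R) : 0 < m -> normc k <= M ->
  m <= normc u -> normc h < m / 2 ->
  normc (k / (u - h) - k / u - h * (k / u ^+ 2)) <= M * (2 / m ^+ 3) * normc h ^+ 2.
Proof.
move=> m0 kM mu hm.
have uh : m / 2 <= normc (u - h) by have := normc_le_dist u h; lra.
have u0 : u != 0 by rewrite -normc_gt0; lra.
have uh0 : u - h != 0 by rewrite -normc_gt0; lra.
rewrite (_ : _ - _ = k * (u ^+ 2 * (u - h))^-1 * h ^+ 2); last by field; rewrite u0 uh0.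
rewrite !(normcX, normcV, normcM) ler_wpM2r ?sqr_ge0//.
apply: ler_pM => //; rewrite ?invr_ge0 ?mulr_ge0 ?exprn_ge0 ?normc_ge0//.
rewrite (_ : 2 / m ^+ 3 = (m ^+ 2 * (m / 2))^-1); last by field; lra.
rewrite lef_pV2 ?posrE ?mulr_gt0 ?exprn_gt0//; try lra.
by apply: ler_pM => //; rewrite ?exprn_ge0 ?lerXn2r ?nnegrE//; lra.
Qed.

Lemma kernel2_remainder (k u h : R[i]) (M m : R) : 0 < m -> normc k <= M ->
  m <= normc u -> normc h < m / 2 ->
  normc (k / (u - h) ^+ 2 - k / u ^+ 2 - h * (2 * (k / u ^+ 3)))
    <= M * (8 / m ^+ 4) * normc h ^+ 2.
Proof.
move=> m0 kM mu hm.
have uh : m / 2 <= normc (u - h) by have := normc_le_dist u h; lra.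
have u0 : u != 0 by rewrite -normc_gt0; lra.
have uh0 : u - h != 0 by rewrite -normc_gt0; lra.
have M0 : 0 <= M := le_trans (normc_ge0 k) kM.
rewrite (_ : _ - _ = k * (3 * (u ^+ 3 * (u - h))^-1 + h * (u ^+ 3 * (u - h) ^+ 2)^-1) * h ^+ 2);
  last by field; rewrite u0 uh0.
rewrite [normc (_ * h ^+ 2)]normcM normcX ler_wpM2r ?sqr_ge0// normcM.
apply: ler_pM => //; rewrite ?normc_ge0//.
have p1 : normc (u ^+ 3 * (u - h))^-1 <= 2 / m ^+ 4.
  rewrite !(normcX, normcV, normcM) (_ : 2 / m ^+ 4 = (m ^+ 3 * (m / 2))^-1); last by field; lra.
  rewrite lef_pV2 ?posrE ?mulr_gt0 ?exprn_gt0//; try lra.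
  by apply: ler_pM => //; rewrite ?exprn_ge0 ?lerXn2r ?nnegrE//; lra.
have p2 : normc (h * (u ^+ 3 * (u - h) ^+ 2)^-1) <= 2 / m ^+ 4.
  rewrite !(normcX, normcV, normcM) (_ : 2 / m ^+ 4 = (m / 2) * (m ^+ 3 * (m / 2) ^+ 2)^-1);
    last by field; lra.
  apply: ler_pM; rewrite ?normc_ge0 ?invr_ge0 ?mulr_ge0 ?exprn_ge0 ?normc_ge0//; first exact: ltW.
  rewrite lef_pV2 ?posrE ?mulr_gt0 ?exprn_gt0//; try lra.
  by apply: ler_pM => //; rewrite ?exprn_ge0 ?lerXn2r ?nnegrE//; lra.
apply: le_trans (normcD _ _) _.
rewrite [normc (3 * _)]normcM normc_nat; lra.
Qed.

(** Cauchy's formula represents [f] as the quotient of two Cauchy integrals,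
    and these can be differentiated twice under the integral sign. *)
Lemma analytic_cderive f : analytic_disc f -> analytic_disc (cderive f).
Proof.
move=> fa w0 w0D; rewrite /disc /= in w0D.
pose s := (1 - normc w0) / 4; have s0 : 0 < s by rewrite /s; lra.
set x0 := Re w0 - s; set x1 := Re w0 + s; set y0 := Im w0 - s; set y1 := Im w0 + s.
have x01 : x0 <= x1 by rewrite /x0 /x1; lra.
have y01 : y0 <= y1 by rewrite /y0 /y1; lra.
have fd z : disc z -> cdiff f z (cderive f z) by move=> /fa /cderivableP.
have inD z : normc (z - w0) <= 2 * s -> disc z.
  by move=> h; rewrite /disc /=; have := normc_le_dist z w0; rewrite /s in h *; lra.
have inrD z : inrect x0 x1 y0 y1 z -> normc (z - w0) <= 2 * s.
  move=> [/andP[h1 h2] /andP[h3 h4]]; apply: le_trans (normc_le_ReIm _) _.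
  rewrite cReD cReN cImD cImN mulr2n mulrDl mul1r.
  by move: h1 h2 h3 h4; rewrite /x0 /x1 /y0 /y1 => *; apply: lerD; rewrite ler_norml; apply/andP; split; lra.
have bdD z : bdry x0 x1 y0 y1 z -> disc z by move=> /(bdry_inrect x01 y01) /inrD /inD.
have bdfar z : bdry x0 x1 y0 y1 z -> s <= normc (z - w0).
  move=> [] [_ h].
    apply: le_trans (Im_le_normc _); rewrite cImD cImN.
    by case: h => ->; rewrite /y0 /y1 addrAC subrr add0r ?normrN ger0_norm ?(ltW s0).
  apply: le_trans (Re_le_normc _); rewrite cReD cReN.
  by case: h => ->; rewrite /x0 /x1 addrAC subrr add0r ?normrN ger0_norm ?(ltW s0).
have [mx _ hM] : exists2 m, normc (m - w0) <= 2 * s & forall z, normc (z - w0) <= 2 * s ->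
    normc (f z) <= normc (f m).
  apply: (@EVT_cdisc _ (fun z => normc (f z))); first lra.
  by move=> z /inD /fd /cdiff_ccont; exact: vcont_normc.
set M := normc (f mx) in hM.
have fM z : bdry x0 x1 y0 y1 z -> normc (f z) <= M.
  by move=> /(bdry_inrect x01 y01) /inrD /hM.
have fc z : bdry x0 x1 y0 y1 z -> ccont f z by move=> /bdD /fd /cdiff_ccont.
(* [m] bounds from below the distance to the boundary of points near [w0] *)
pose m := s / 2; have m0 : 0 < m by rewrite /m; lra.
have far z w : bdry x0 x1 y0 y1 z -> normc (w - w0) < m -> m <= normc (z - w).
  move=> /bdfar h1 h2; have := normc_triangle w z w0; rewrite /m in h2 *; lra.
have uc (w z : R[i]) n : z - w != 0 -> ccont (fun z => ((z - w) ^+ n)^-1) z.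
  move=> zw; have : ccont (fun z => (z - w) ^+ n) z.
    elim: n => [|n ih].
      rewrite (_ : (fun z => (z - w) ^+ 0) = (fun=> 1)); first exact: ccont_cst.
      by apply/funext => u; rewrite expr0.
    rewrite (_ : (fun z => (z - w) ^+ n.+1) = (fun z => (z - w) * (z - w) ^+ n)).
      exact: (ccontM (ccontB (ccont_id z) (ccont_cst w z)) ih).
    by apply/funext => u; rewrite exprS.
  by apply: ccontV; rewrite expf_neq0.
have kc k w z n : (forall z, bdry x0 x1 y0 y1 z -> ccont k z) ->
    normc (w - w0) < m -> bdry x0 x1 y0 y1 z -> ccont (fun z => k z / (z - w) ^+ n) z.
  move=> kc wm zb; apply: (ccontM (kc _ zb)); apply: uc.
  by rewrite -normc_gt0; apply: lt_le_trans m0 (far _ _ zb wm).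
(* by Cauchy's formula [f w] is [Phi f 1 w / Phi one 1 w] near [w0] *)
pose Phi k n w := rect (fun z => k z / (z - w) ^+ n) x0 x1 y0 y1.
have near_ok w : normc (w - w0) < m / 2 -> forall h, normc h < m / 2 ->
    normc (w + h - w0) < m.
  move=> wm h hm; rewrite (_ : w + h - w0 = (w - w0) + h); last by ring.
  by apply: le_lt_trans (normcD _ _) _; lra.
have half w : normc (w - w0) < m / 2 -> normc (w - w0) < m by lra.
have Phi1 k N w : (forall z, bdry x0 x1 y0 y1 z -> ccont k z) ->
    (forall z, bdry x0 x1 y0 y1 z -> normc (k z) <= N) ->
    normc (w - w0) < m / 2 -> cdiff (Phi k 1%N) w (Phi k 2%N w).
  move=> kcont kN wm.
  apply: (@rect_param_cdiff _ _ _ _ (fun w z => k z / (z - w) ^+ 1) _ _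
     (`|N| * (2 / m ^+ 3)) (m / 2)) => //; try lra.
  - by rewrite mulr_ge0// divr_ge0// exprn_ge0// ltW.
  - by move=> h z hm zb; apply: kc => //; exact: near_ok.
  - by move=> z zb; apply: kc => //; exact: half.
  - move=> h z hm zb; rewrite !expr1 opprD addrA.
    apply: kernel1_remainder => //; first exact: le_trans (kN _ zb) (ler_norm _).
    by apply: far => //; exact: half.
have Phi2 k N w : (forall z, bdry x0 x1 y0 y1 z -> ccont k z) ->
    (forall z, bdry x0 x1 y0 y1 z -> normc (k z) <= N) ->
    normc (w - w0) < m / 2 -> exists l, cdiff (Phi k 2%N) w l.
  move=> kcont kN wm; eexists.
  apply: (@rect_param_cdiff _ _ _ _ (fun w z => k z / (z - w) ^+ 2)
     (fun z => 2 * (k z / (z - w) ^+ 3)) _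
     (`|N| * (8 / m ^+ 4)) (m / 2)) => //; try lra.
  - by rewrite mulr_ge0// divr_ge0// exprn_ge0// ltW.
  - by move=> h z hm zb; apply: kc => //; exact: near_ok.
  - move=> z zb; apply: (ccontM (ccont_cst _ _)).
    by apply: kc => //; exact: half.
  - move=> h z hm zb; rewrite opprD addrA.
    apply: kernel2_remainder => //; first exact: le_trans (kN _ zb) (ler_norm _).
    by apply: far => //; exact: half.
pose one := fun _ : R[i] => 1 : R[i].
have onec z : bdry x0 x1 y0 y1 z -> ccont one z by move=> _; exact: ccont_cst.
have oneN z : bdry x0 x1 y0 y1 z -> normc (one z) <= 1 by rewrite normc1.
have w0m : normc (w0 - w0) < m / 2 by rewrite subrr normc0; lra.
have c0 : Phi one 1%N w0 != 0.
  apply/eqP => c0; have := index_ge4 w0 s0.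
  rewrite (_ : rect _ _ _ _ _ = Phi one 1%N w0); first by rewrite c0 /=; lra.
  by rewrite /Phi; congr rect; apply/funext => z; rewrite expr1.
have [d d0 hd] := ccont_neq0 (cdiff_ccont (Phi1 _ _ _ onec oneN w0m)) c0.
have [l1 hl1] := Phi2 _ _ _ fc fM w0m.
have [l2 hl2] := Phi2 _ _ _ onec oneN w0m.
have hf1 := Phi1 _ _ _ fc fM w0m; have h11 := Phi1 _ _ _ onec oneN w0m.
have fE w : normc (w - w0) < s -> f w * Phi one 1%N w = Phi f 1%N w.
  move=> ws.
  have h1 := le_lt_trans (Re_le_normc _) ws; have h2 := le_lt_trans (Im_le_normc _) ws.
  move: h1 h2; rewrite cReD cReN cImD cImN !ltr_norml => /andP[? ?] /andP[? ?].
  have PhiE k : Phi k 1%N w = rect (fun z => k z / (z - w)) x0 x1 y0 y1.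
    by rewrite /Phi; congr rect; apply/funext => z; rewrite expr1.
  rewrite !PhiE; apply: cauchy_formula.
  - by rewrite /x0 /x1; apply/andP; split; lra.
  - by rewrite /y0 /y1; apply/andP; split; lra.
  - by move=> z /inrD /inD /fd h; eexists; exact: h.
apply: cdiff_derivable.
apply: (@cdiff_near _ (fun w => (Phi f 2%N w * Phi one 1%N w - Phi f 1%N w * Phi one 2%N w)
    / Phi one 1%N w ^+ 2)).
  have c20 : Phi one 1%N w0 ^+ 2 != 0 by rewrite expf_neq0.
  apply: (cdiff_div (f := fun w => Phi f 2%N w * Phi one 1%N w - Phi f 1%N w * Phi one 2%N w)
    (g := fun w => Phi one 1%N w ^+ 2) c20).
    exact: (cdiffB (cdiffM hl1 h11) (cdiffM hf1 hl2)).
  exact: (cdiffM h11 h11).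
exists (Num.min d (m / 2)) => [|w]; first by rewrite lt_min d0; lra.
rewrite lt_min => /andP[wd wm]; apply/esym.
have wc0 := hd _ wd.
apply: cdiff_val.
apply: (@cdiff_near _ (fun w => Phi f 1%N w / Phi one 1%N w)).
  by apply: cdiff_div wc0 (Phi1 _ _ _ fc fM wm) (Phi1 _ _ _ onec oneN wm).
exists (Num.min (d - normc (w - w0)) (m / 2)) => [|u].
  by rewrite lt_min subr_gt0 wd; lra.
rewrite lt_min => /andP[ud um].
have ut := normc_triangle w u w0.
have uc0 : Phi one 1%N u != 0 by apply: hd; lra.
by rewrite -fE ?mulfK//; rewrite /m in um wm; lra.
Qed.

End HolomorphicDerivative.

(** * The maximum principle and averages over roots of unity *)

Section MaximumPrinciple.
Context {R : realType}.
Implicit Types (f g h : R[i] -> R[i]) (z w u : R[i]).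

Lemma analytic_cdiff f z : analytic_disc f -> disc z -> cdiff f z (cderive f z).
Proof. by move=> fa /fa /cderivableP. Qed.

Lemma second_derivative_test (u v : R -> R) (d l : R) : 0 < d ->
  (forall s : R, `|s| < d -> is_derive s 1 u (v s)) -> is_derive (0 : R) 1 v l ->
  (forall s, `|s| < d -> u s <= u 0) -> l <= 0.
Proof.
move=> d0 uv vl umax; rewrite leNgt; apply/negP => l0.
have v0 : v 0 = 0.
  have u0 : is_derive (0 : R) 1 u 0.
    apply: (@derive1_at_max _ u (- d) d 0); first by lra.
    - by move=> t; rewrite in_itv /= -ltr_norml => /uv[].
    - by rewrite in_itv /=; apply/andP; split; lra.
    - by move=> t; rewrite in_itv /= -ltr_norml => /umax.
  have [_ <-] := uv 0 ltac:(by rewrite normr0).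
  by case: u0.
have l20 : 0 < l / 2 by lra.
have [e e0 he] := iffLR (is_deriveP _ _ _) vl _ l20.
pose t := Num.min d e / 2.
have m0 : 0 < Num.min d e by rewrite lt_min d0.
have [m1 m2] : Num.min d e <= d /\ Num.min d e <= e by split; rewrite ge_min lexx ?orbT.
have t0 : 0 < t by rewrite /t; lra.
have sm s : 0 <= s <= t -> `|s| < d /\ `|s| < e.
  by move=> /andP[s0 st]; rewrite ger0_norm//; rewrite /t in st; split; lra.
have : u 0 - l / 4 * (0 * 0) <= u t - l / 4 * (t * t).
  apply: (@is_derive_le _ (fun s => u s - l / 4 * (s * s))
    (fun s => v s - l / 4 * (s + s))); first exact: ltW.
    move=> s /sm[sd _].
    have := is_deriveB (uv s sd) (is_deriveZ (l / 4) (is_deriveM (is_derive_id s 1) (is_derive_id s 1))).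
    by rewrite /GRing.scale /= !mulr1.
  move=> s st; have [_ /he] := sm _ st; rewrite add0r v0 subr0.
  move/andP: st => [s0 _]; rewrite (ger0_norm s0) ler_norml => /andP[h1 _]; lra.
have : u t <= u 0 by apply: umax; have [] := sm t; rewrite ?lexx ?(ltW t0).
by have := mulr_gt0 t0 t0; nra.
Qed.

(** Adding a small multiple of the squared modulus makes [normc h ^+ 2] strictly
    subharmonic, which excludes an interior maximum. *)
Lemma max_principle h (r M : R) : analytic_disc h -> 0 < r < 1 ->
  (forall z, normc z = r -> normc (h z) <= M) -> normc (h 0) <= M.
Proof.
move=> ha /andP[r0 r1] hM; rewrite leNgt; apply/negP => big.
have M0 : 0 <= M.
  apply: le_trans (normc_ge0 (h r%:C)) _; apply: hM.
  by rewrite normc_real gtr0_norm.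
pose de := (normc (h 0) ^+ 2 - M ^+ 2) / 2.
have de0 : 0 < de.
  by rewrite /de divr_gt0// subr_gt0 ltrXn2r// ?nnegrE ?normc_ge0.
pose v z := normc (h z) * normc (h z) + de * (normc z * normc z).
have inD z : normc (z - 0) <= r -> disc z by rewrite subr0 /disc /=; lra.
have vc z : normc (z - 0) <= r -> vcont v z.
  move=> /inD zD; have hc := vcont_normc (cdiff_ccont (analytic_cdiff ha zD)).
  have ic := vcont_normc (ccont_id z).
  exact: (vcontD (vcontM hc hc) (vcontM (vcont_cst de z) (vcontM ic ic))).
have [m mr hm] := EVT_cdisc (ltW r0) vc.
have v0 : v 0 <= v m by apply: hm; rewrite subr0 normc0 ltW.
have {mr} : normc m <= r by rewrite subr0 in mr.
rewrite le_eqVlt => /predU1P[mr|mr].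
  have k1 := hM _ mr; have k0 := normc_ge0 (h m).
  move: v0; rewrite /v normc0 mulr0 mulr0 addr0 mr -!expr2.
  have : normc (h m) ^+ 2 <= M ^+ 2 by rewrite lerXn2r ?nnegrE.
  have : de * r ^+ 2 <= de * 1.
    by rewrite ler_wpM2l ?(ltW de0)// -(expr1n _ 2) lerXn2r ?nnegrE ?ltW.
  by rewrite /de in de0 *; lra.
have mD : disc m by rewrite /disc /=; lra.
have [h1 [h2 [hd1 hd2]]] : exists h1 h2 : R[i] -> R[i],
    (forall z, disc z -> cdiff h z (h1 z)) /\ (forall z, disc z -> cdiff h1 z (h2 z)).
  exists (cderive h), (cderive (cderive h)); split=> z zD; first exact: analytic_cdiff.
  exact: (analytic_cdiff (analytic_cderive ha) zD).
(* the second derivative of [v] at its maximum [m] in the direction [e] *)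
have dir (e : R[i]) : normc e = 1 ->
    2 * (Re (h1 m * e) ^+ 2 + Im (h1 m * e) ^+ 2
         + Re (h m) * Re (h2 m * e * e) + Im (h m) * Im (h2 m * e * e)) + 2 * de <= 0.
  move=> e1; pose L s := line m e s.
  have L0 : L 0 = m by rewrite /L /line mul0r addr0.
  have Ln s : normc (L s) <= normc m + `|s|.
    by apply: le_trans (normcD _ _) _; rewrite normcM normc_real e1 mulr1.
  have LD s : `|s| < r - normc m -> disc (L s).
    by move=> sr; rewrite /disc /=; have := Ln s; lra.
  have Ld s : rdiff L s e.
    by have := rdiff_line (cdiff_id (line m e s)); rewrite mul1r.
  have hd s : `|s| < r - normc m -> rdiff (fun t => h (L t)) s (h1 (L s) * e).
    by move=> /LD sD; apply: rdiff_line; exact: hd1.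
  have h1d s : `|s| < r - normc m -> rdiff (fun t => h1 (L t) * e) s (h2 (L s) * e * e).
    move=> /LD sD; apply: (@rdiff_line _ (fun z => h1 z * e)).
    apply: cdiff_eq (cdiffM (hd2 _ sD) (cdiff_cst e _)) _.
    by rewrite mulr0 addr0.
  pose u s := v (L s).
  pose u1 s := 2 * (Re (h (L s)) * Re (h1 (L s) * e) + Im (h (L s)) * Im (h1 (L s) * e))
    + 2 * de * (Re (L s) * Re e + Im (L s) * Im e).
  apply: (@second_derivative_test u u1 (r - normc m)); first by lra.
  - move=> s sr; have [a1 a2] := hd s sr; have [b1 b2] := Ld s.
    have uE : u = (fun s => (Re (h (L s)) * Re (h (L s)) + Im (h (L s)) * Im (h (L s)))
       + de * (Re (L s) * Re (L s) + Im (L s) * Im (L s))).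
      by apply/funext => t; rewrite /u /v -!expr2 !normc_sqr.
    rewrite uE.
    have := is_deriveD (is_deriveD (is_deriveM a1 a1) (is_deriveM a2 a2))
      (is_deriveZ de (is_deriveD (is_deriveM b1 b1) (is_deriveM b2 b2))).
    move=> H; apply: is_derive_eq H _; rewrite /GRing.scale /= /u1; ring.
  - have s0 : `|0 : R| < r - normc m by rewrite normr0; lra.
    have [a1 a2] := hd 0 s0; have [b1 b2] := Ld 0; have [c1 c2] := h1d 0 s0.
    have := is_deriveD (is_deriveZ 2 (is_deriveD (is_deriveM a1 c1) (is_deriveM a2 c2)))
      (is_deriveZ (2 * de) (is_deriveD (is_deriveZ (Re e) b1) (is_deriveZ (Im e) b2))).
    move=> H; rewrite (_ : u1 = (fun s => 2 * (Re (h (L s)) * Re (h1 (L s) * e) + Im (h (L s)) * Im (h1 (L s) * e))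
    + 2 * de * (Re e * Re (L s) + Im e * Im (L s)))); last first.
      by apply/funext => s; rewrite /u1 (mulrC (Re (L s))) (mulrC (Im (L s))).
    apply: is_derive_eq H _; rewrite /GRing.scale /= L0.
    have : Re e * Re e + Im e * Im e = 1 by rewrite -!expr2 -normc_sqr e1 expr1n.
    move=> ->; ring.
  - by move=> s sr; rewrite /u L0; apply: hm; rewrite subr0; have := Ln s; lra.
(* adding the directions [1] and ['i] cancels the terms with [h2 m], as
   ['i * 'i = -1]; what remains is positive *)
have := dir 1; rewrite normc1 !mulr1 => /(_ erefl) d1.
have := dir 'i; rewrite normc_i => /(_ erefl).
rewrite !(cReM, cImM) /= !(mulr0, mulr1, sub0r, add0r, addr0).
rewrite !mulrN; move: d1; set x := Re (h1 m); set y := Im (h1 m).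
by have := sqr_ge0 x; have := sqr_ge0 y; rewrite sqrrN; lra.
Qed.

End MaximumPrinciple.

Section RootsOfUnity.
Context {R : realType}.
Implicit Types (f g h : R[i] -> R[i]) (z w u : R[i]).

(** Unit vectors whose number is a power of two are built by taking both square
    roots of each vector, as
    [1 / (1 - s x) + 1 / (1 + s x) = 2 / (1 - s^2 x^2)]. *)
Lemma unit_points n : exists ws : seq R[i],
  [/\ size ws = (2 ^ n)%N, (forall w, w \in ws -> normc w = 1) &
   forall x : R[i], normc x < 1 ->
     \sum_(w <- ws) (1 - w * x)^-1 = (2 ^ n)%:R / (1 - x ^+ (2 ^ n))].
Proof.
elim: n => [|n [ws [sw wn wE]]].
  exists [:: 1]; split=> [//|w|x _]; first by rewrite inE => /eqP ->; exact: normc1.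
  by rewrite big_seq1 !mul1r expr1.
exists (map (@sqrtc R) ws ++ map (fun w => - sqrtc w) ws); split.
- by rewrite size_cat !size_map sw addnn -mul2n expnS.
- have sn w : w \in ws -> normc (sqrtc w) = 1.
    move=> /wn h; apply: (@pexpIrn _ 2); rewrite ?nnegrE ?normc_ge0//.
    by rewrite -normcX sqr_sqrtc h expr1n.
  by move=> w; rewrite mem_cat => /orP[] /mapP[u uw ->]; rewrite ?normcN sn.
move=> x x1; rewrite big_cat !big_map /= -big_split /=.
have x21 : normc (x ^+ 2) < 1 by rewrite normcX expr_lt1 ?normc_ge0.
rewrite (eq_big_seq (fun w => 2 * (1 - w * x ^+ 2)^-1)); last first.
  move=> w ww; have s1 : normc (sqrtc w) = 1.
    apply: (@pexpIrn _ 2); rewrite ?nnegrE ?normc_ge0//.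
    by rewrite -normcX sqr_sqrtc wn// expr1n.
  have n1 y : normc y < 1 -> 1 - y != 0 :> R[i].
    by move=> y1; rewrite subr_eq0; apply/eqP => yE; rewrite -yE normc1 ltxx in y1.
  rewrite -{3}(sqr_sqrtc w).
  have h1 : 1 - sqrtc w * x != 0 by apply: n1; rewrite normcM s1 mul1r.
  have h2 : 1 - - sqrtc w * x != 0 by apply: n1; rewrite normcM normcN s1 mul1r.
  have -> : 1 - sqrtc w ^+ 2 * x ^+ 2 = (1 - sqrtc w * x) * (1 - - sqrtc w * x) by ring.
  by field; rewrite h2 h1.
rewrite -mulr_sumr wE// expnS -exprM natrM; ring.
Qed.

Lemma poisson_kernel_Re (y : R[i]) : normc y < 1 ->
  (1 - normc y ^+ 2) / normc (1 - y) ^+ 2 = 2 * Re (1 - y)^-1 - 1.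
Proof.
move=> y1; have n0 : normc (1 - y) ^+ 2 != 0.
  rewrite expf_neq0// normc_eq0 subr_eq0; apply/eqP => yE.
  by rewrite -yE normc1 ltxx in y1.
rewrite !normc_sqr in n0 *; case: y y1 n0 => a b /= _; rewrite sub0r sqrrN => n0.
by field.
Qed.

(** By [poisson_kernel_Re] the sum of the kernels is the real part of
    [2 N / (1 - x^N) - N], and [|1 - x^N|] is at least [1 / 2]. *)
Lemma unit_points_poisson (ws : seq R[i]) N (x : R[i]) : size ws = N ->
  (forall w, w \in ws -> normc w = 1) ->
  \sum_(w <- ws) (1 - w * x)^-1 = N%:R / (1 - x ^+ N) ->
  normc x < 1 -> normc x ^+ N <= 2^-1 ->
  \sum_(w <- ws) (normc (1 - w * x) ^+ 2)^-1 <= 3 * N%:R / (1 - normc x ^+ 2).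
Proof.
move=> sw wn wE x1 xN.
have x20 : 0 < 1 - normc x ^+ 2 by rewrite subr_gt0 expr_lt1 ?normc_ge0.
rewrite ler_pdivlMr// mulr_suml.
rewrite (eq_big_seq (fun w => 2 * Re (1 - w * x)^-1 - 1)); last first.
  move=> w ww; have wx : normc (w * x) = normc x by rewrite normcM wn// mul1r.
  by rewrite -poisson_kernel_Re wx// mulrC.
rewrite big_split /= -mulr_sumr -Re_sum wE sumrN big_const_seq count_predT sw.
rewrite -Monoid.iteropE /= -/(1 *+ N).
have : Re (N%:R / (1 - x ^+ N)) <= 2 * N%:R.
  apply: le_trans (ler_norm _) _; apply: le_trans (Re_le_normc _) _.
  rewrite normc_div normc_nat mulrC ler_wpM2r// -[leRHS]invrK.
  have : 1 - normc (x ^+ N) <= normc (1 - x ^+ N).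
    have := normc_le_dist 1 (x ^+ N); rewrite normc1; lra.
  rewrite normcX => h; rewrite lef_pV2 ?posrE; lra.
lra.
Qed.

Lemma analytic_prod (ws : seq R[i]) h : analytic_disc h ->
  (forall w, w \in ws -> normc w = 1) ->
  analytic_disc (fun z => \prod_(w <- ws) h (z * w)).
Proof.
move=> ha; elim: ws => [|w ws ih] wn z zD.
  apply: (@cdiff_derivable _ _ _ 0); apply: cdiff_ext (cdiff_cst 1 z) _ => u.
  by rewrite big_nil.
have w1 : normc w = 1 by apply: wn; rewrite mem_head.
have zw : disc (z * w) by rewrite /disc /= normcM w1 mulr1.
have /ih/(_ z zD)/cderivableP hP : forall w, w \in ws -> normc w = 1.
  by move=> u uw; apply: wn; rewrite inE uw orbT.
have hw : cdiff (fun z => h (z * w)) z (cderive h (z * w) * (1 * w + z * 0)).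
  apply: (cdiff_comp (f := fun z => z * w)).
    exact: (cdiffM (cdiff_id z) (cdiff_cst w z)).
  exact: analytic_cdiff.
apply: cdiff_derivable; apply: cdiff_ext (cdiffM hw hP) _ => u.
by rewrite big_cons.
Qed.

(** This stands in for the mean value inequality for [log |h|]: the maximum
    principle is applied to the product of the rotated copies of [h]. *)
Lemma jensen_average h (r c L : R) (ws : seq R[i]) (U : R[i] -> R) :
  analytic_disc h -> 0 < r < 1 -> 0 <= c -> (0 < size ws)%N ->
  (forall w, w \in ws -> normc w = 1) ->
  (forall u, normc u = 1 -> normc (h (r%:C * u)) <= c * expR (U u)) ->
  (forall u, normc u = 1 -> \sum_(w <- ws) U (u * w) <= (size ws)%:R * L) ->
  normc (h 0) <= c * expR L.
Proof.
move=> ha /andP[r0 r1] c0 s0 wn hU UL.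
rewrite -(@ler_pXn2r _ (size ws)) ?nnegrE ?normc_ge0 ?mulr_ge0 ?expR_ge0//.
have -> : normc (h 0) ^+ size ws = normc (\prod_(w <- ws) h (0 * w)).
  rewrite normc_prod (eq_bigr (fun=> normc (h 0))); last by move=> w _; rewrite mul0r.
  by rewrite big_const_seq count_predT -Monoid.iteropE.
apply: (@max_principle _ (fun z => \prod_(w <- ws) h (z * w)) r).
- exact: analytic_prod.
- by rewrite r0.
move=> z zr; pose u := z / r%:C.
have rC0 : r%:C != 0 by rewrite -normc_gt0 normc_real gtr0_norm.
have u1 : normc u = 1 by rewrite normc_div zr normc_real gtr0_norm// divff// gt_eqF.
have zE : z = r%:C * u by rewrite /u mulrC divfK.
rewrite normc_prod; apply: (@le_trans _ _ (\prod_(w <- ws) (c * expR (U (u * w))))).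
  rewrite !big_seq; apply: ler_prod => w ww; rewrite normc_ge0 zE -mulrA.
  by apply: hU; rewrite normcM u1 wn// mulr1.
rewrite big_split /= big_const_seq count_predT -Monoid.iteropE exprMn.
rewrite ler_wpM2l ?exprn_ge0// -expR_sum -expRM_natl ler_expR.
by rewrite mulr_natl -mulr_natl; exact: UL.
Qed.

End RootsOfUnity.

(** * Disc automorphisms *)

Section Mobius.
Context {R : realType}.
Implicit Types (f g h : R[i] -> R[i]) (a z w u : R[i]).

(** The involution of the disc that exchanges [0] and [a]. *)
Definition mobius a z : R[i] := (a - z) / (1 - a^* * z).

Lemma mobius_den a z : disc a -> disc z -> 1 - a^* * z != 0.
Proof.
rewrite /disc /= => a1 z1; rewrite subr_eq0; apply/eqP => e.
have : normc (a^* * z) < 1.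
  by rewrite normcM normcJ; have := normc_ge0 a; have := normc_ge0 z; nra.
by rewrite -e normc1 ltxx.
Qed.

Definition defect a : R[i] := 1 - a * a^*.

Lemma normc_defect a : disc a -> normc (defect a) = 1 - normc a ^+ 2.
Proof.
rewrite /disc /= => a1; rewrite /defect -normc_sqrJ -(rmorph1 (real_complex R)) -rmorphB.
by rewrite /= normc_real ger0_norm// subr_ge0 expr_le1 ?normc_ge0 ?ltW.
Qed.

Lemma defect_neq0 a : disc a -> defect a != 0.
Proof.
move=> aD; rewrite -normc_gt0 normc_defect// subr_gt0 expr_lt1 ?normc_ge0//.
Qed.

Lemma mobius0 a : mobius a 0 = a.
Proof. by rewrite /mobius mulr0 !subr0 divr1. Qed.

Lemma mobiusa a : mobius a a = 0.
Proof. by rewrite /mobius subrr mul0r. Qed.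

Lemma mobiusK a z : disc a -> disc z -> mobius a (mobius a z) = z.
Proof.
move=> aD zD; have d0 := mobius_den aD zD; have a0 := defect_neq0 aD.
rewrite /mobius; set D := 1 - a^* * z in d0 *.
have -> : a - (a - z) / D = z * defect a / D by rewrite /defect /D; field.
have -> : 1 - a^* * ((a - z) / D) = defect a / D by rewrite /defect /D; field.
by field; rewrite d0 a0.
Qed.

Lemma mobius_sub a z w : disc a -> disc z -> disc w ->
  mobius a z - mobius a w = - defect a * (z - w) / ((1 - a^* * z) * (1 - a^* * w)).
Proof.
move=> aD zD wD; rewrite /mobius /defect.
have d0 := mobius_den aD zD; have d1 := mobius_den aD wD.
by field; rewrite d0 d1.
Qed.

Lemma mobius_conj_sub a z w : disc a -> disc z -> disc w ->
  1 - (mobius a w)^* * mobius a z =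
  defect a * (1 - w^* * z) / ((1 - a^* * z) * (1 - a^* * w)^*).
Proof.
move=> aD zD wD; have d0 := mobius_den aD zD; have d1 := mobius_den aD wD.
have d2 : Num.conj (1 - a^* * w) != 0 by rewrite conjC_eq0.
move: d2; rewrite /mobius /defect !(rmorphM, rmorphB, fmorphV, rmorph1) /= !conjCK => d2.
by field; rewrite d0 d2.
Qed.

Lemma one_sub_mobius_sqr a z : disc a -> disc z ->
  1 - normc (mobius a z) ^+ 2 =
  (1 - normc a ^+ 2) * (1 - normc z ^+ 2) / normc (1 - a^* * z) ^+ 2.
Proof.
move=> aD zD; apply: (@complexI R).
have E : defect (mobius a z) = defect a * defect z / ((1 - a^* * z) * (1 - a^* * z)^*).
  have := mobius_conj_sub aD zD zD.
  by rewrite /defect [mobius a z * _]mulrC [z * _]mulrC.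
move: E; rewrite /defect -!normc_sqrJ => E.
rewrite rmorphB rmorph1 E; apply/esym.
by rewrite rmorphM fmorphV rmorphM !rmorphB !rmorph1.
Qed.

Lemma mobius_disc a z : disc a -> disc z -> disc (mobius a z).
Proof.
move=> aD zD; have : 0 < 1 - normc (mobius a z) ^+ 2.
  rewrite one_sub_mobius_sqr//; apply: divr_gt0.
    by apply: mulr_gt0; rewrite subr_gt0 expr_lt1 ?normc_ge0.
  by rewrite exprn_gt0// normc_gt0 mobius_den.
by rewrite subr_gt0 expr_lt1 ?normc_ge0.
Qed.

Lemma cdiff_mobius_den a z : cdiff (fun u => 1 - a^* * u) z (- a^*).
Proof.
apply: cdiff_eq (cdiffB (cdiff_cst 1 z) (cdiffZ a^* (cdiff_id z))) _.
by rewrite mulr1 sub0r.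
Qed.

Lemma cdiff_mobius a z : disc a -> disc z ->
  cdiff (mobius a) z (- defect a / (1 - a^* * z) ^+ 2).
Proof.
move=> aD zD; have d0 := mobius_den aD zD.
apply: cdiff_eq (cdiff_div (f := fun u => a - u) (g := fun u => 1 - a^* * u) d0
  (cdiffB (cdiff_cst a z) (cdiff_id z)) (cdiff_mobius_den a z)) _.
by rewrite /defect; field.
Qed.

End Mobius.

(** * Growth of solutions along rays *)

Section RayBound.
Context {R : realType}.
Implicit Types (f g h B : R[i] -> R[i]) (a z w u : R[i]) (t s x r : R).

Lemma rdiff_fun_line f u t l : cdiff f (t%:C * u) l ->
  rdiff (fun s : R => f (s%:C * u)) t (l * u).
Proof.
have E s : line 0 u s = s%:C * u by rewrite /line add0r.
rewrite -E => /rdiff_line; rewrite (_ : (fun s => f (line 0 u s)) = (fun s => f (s%:C * u)))//.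
by apply/funext => s; rewrite E.
Qed.

(** For [p = g + (u - z) g'] one has [p' = (u - z) g''] and
    [(g / (u - z))' = p / (u - z)^2]. A bound [M E] for [|p|] with [E] the
    claimed exponential thus gives [t M E] for [|g|], hence again the bound
    [M E - M + |p(0)|] for [|p|]; with the best [M] this forces [M <= |p(0)|]. *)
Lemma ray_bound g g1 g2 B u r (be : R -> R) : normc u = 1 -> 0 <= r < 1 ->
  (forall z, disc z -> cdiff g z (g1 z)) -> (forall z, disc z -> cdiff g1 z (g2 z)) ->
  (forall z, disc z -> g2 z = - B z * g z) -> g 0 = 0 ->
  (forall t, 0 <= t <= r -> is_derive t 1 be (t * (1 - t) * normc (B (t%:C * u)))) ->
  forall t, 0 <= t <= r -> normc (g (t%:C * u)) <= t * (normc (g1 0) * expR (be t - be 0)).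
Proof.
move=> u1 /andP[r0 r1] gd g1d g2E g0 bed.
have inD t : 0 <= t <= r -> disc (t%:C * u).
  by move=> /andP[t0 tr]; rewrite /disc /= normcM u1 mulr1 normc_real ger0_norm//; lra.
have uz t : 0 <= t <= r -> normc (u - t%:C * u) = 1 - t.
  move=> /andP[t0 tr]; rewrite (_ : u - t%:C * u = (1 - t)%:C * u); last first.
    by rewrite rmorphB rmorph1; ring.
  by rewrite normcM u1 mulr1 normc_real ger0_norm//; lra.
have uz0 t : 0 <= t <= r -> u - t%:C * u != 0.
  by move=> tr; rewrite -normc_gt0 uz//; case/andP: tr; lra.
pose p z := g z + (u - z) * g1 z.
pose P t := p (t%:C * u).
have Pd t : 0 <= t <= r -> rdiff P t ((u - t%:C * u) * g2 (t%:C * u) * u).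
  move=> tr; apply: rdiff_fun_line; have zD := inD _ tr.
  apply: cdiff_eq (cdiffD (gd _ zD) (cdiffM (cdiffB (cdiff_cst u _) (cdiff_id _)) (g1d _ zD))) _.
  ring.
pose E t := expR (be t - be 0).
pose b t := t * (1 - t) * normc (B (t%:C * u)).
have Ed t : 0 <= t <= r -> is_derive t 1 E (E t * b t).
  move=> tr; have h := is_deriveB (bed t tr) (is_derive_cst (be 0) t 1).
  have := @is_derive1_comp _ expR (fun s => be s - be 0) t _ _ (is_derive_expR _) h.
  by rewrite subr0; exact.
have E0 t : 0 < E t by exact: expR_gt0.
have Emon s t : 0 <= s -> s <= t -> t <= r -> E s <= E t.
  move=> s0 st tr; apply: (@is_derive_le _ E (fun x => E x * b x)) => // x /andP[sx xt].
    by apply: Ed; apply/andP; split; lra.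
  by rewrite /b !mulr_ge0 ?normc_ge0 ?(ltW (E0 x))//; lra.
have Ec t : 0 <= t <= r -> {for t, continuous E}.
  by move=> /Ed[h _]; apply: differentiable_continuous; apply/derivable1_diffP.
have nPc t : 0 <= t <= r -> {for t, continuous (fun s => normc (P s))}.
  move=> tr; have zD := inD _ tr.
  have pc : ccont p (line 0 u t).
    rewrite /line add0r; apply: (ccontD (cdiff_ccont (gd _ zD))).
    exact: (ccontM (ccontB (ccont_cst u _) (ccont_id _)) (cdiff_ccont (g1d _ zD))).
  have [c1 c2] := rcont_line pc.
  have -> : (fun s => normc (P s)) = (fun s => Num.sqrt
      (Re (p (line 0 u s)) ^+ 2 + Im (p (line 0 u s)) ^+ 2)).
    by apply/funext => s; rewrite -normc_sqr sqrtr_sqr ger0_norm ?normc_ge0// /P /line add0r.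
  apply: (@continuous_comp _ _ _ (fun s => Re (p (line 0 u s)) ^+ 2 + Im (p (line 0 u s)) ^+ 2)
    Num.sqrt); last exact: sqrt_continuous.
  by apply: cvgD; rewrite expr2; under eq_fun do rewrite expr2; apply: cvgM.
have [s srr smax] : exists2 s, s \in `[0, r] & forall t, t \in `[0, r] ->
    normc (P t) / E t <= normc (P s) / E s.
  apply: (@EVT_max _ (fun t => normc (P t) / E t)) => //.
  apply: continuous_in_subspaceT => t; rewrite inE /= in_itv /= => tr.
  by apply: cvgM; [exact: nPc|apply: cvgV; [rewrite gt_eqF|exact: Ec]].
have {}srr : 0 <= s <= r by move: srr; rewrite in_itv.
set M := normc (P s) / E s in smax.
have M0 : 0 <= M by rewrite divr_ge0 ?normc_ge0// ltW.
have PM t : 0 <= t <= r -> normc (P t) <= M * E t.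
  by move=> tr; rewrite -ler_pdivrMr//; apply: smax; rewrite in_itv.
have gM t : 0 <= t <= r -> normc (g (t%:C * u)) <= t * (M * E t).
  move=> tr; have /andP[t0 tr'] := tr.
  have sub x : 0 <= x <= t -> 0 <= x <= r by move=> /andP[? ?]; apply/andP; split; lra.
  have : normc (g (t%:C * u) / (u - t%:C * u) - g (0%:C * u) / (u - 0%:C * u)) <=
      M * E t / (1 - t) - M * E t / (1 - 0).
    apply: (@mean_value_ineq _ (fun x => g (x%:C * u) / (u - x%:C * u))
      (fun x => P x / (u - x%:C * u) ^+ 2 * u) (fun x => M * E t / (1 - x))
      (fun x => M * E t / (1 - x) ^+ 2) _ _ t0) => x xt; have xr := sub _ xt.
    - apply: (rdiff_fun_line (f := fun z => g z / (u - z))).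
      apply: cdiff_eq (cdiff_div (g := fun z => u - z) (uz0 _ xr) (gd _ (inD _ xr))
        (cdiffB (cdiff_cst u _) (cdiff_id _))) _.
      by rewrite /P /p; congr (_ / _); ring.
    - have x1 : 1 - x != 0 by case/andP: xr => *; apply: lt0r_neq0; lra.
      have := is_deriveZ (M * E t) (is_deriveV (f := fun x => 1 - x) x1
        (is_deriveB (is_derive_cst (1 : R) x (1 : R)) (is_derive_id x (1 : R)))).
      move=> H; apply: is_derive_eq H _.
      by rewrite /GRing.scale /=; field.
    - rewrite normcM u1 mulr1 normc_div normcX uz//.
      rewrite ler_wpM2r ?invr_ge0 ?sqr_ge0//; apply: le_trans (PM _ xr) _.
      by rewrite ler_wpM2l// Emon//; case/andP: xt.
  rewrite rmorph0 mul0r g0 mul0r !subr0 divr1 normc_div uz//.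
  have t1 : 0 < 1 - t by lra.
  rewrite ler_pdivrMr//; move=> /le_trans; apply.
  by rewrite le_eqVlt; apply/orP; left; apply/eqP; field; rewrite gt_eqF.
have MP0 : M <= normc (P 0).
  have /andP[s0 sr] := srr.
  have : normc (P s - P 0) <= M * E s - M * E 0.
    apply: (@mean_value_ineq _ P _ (fun t => M * E t) (fun t => M * (E t * b t)) _ _ s0).
    - by move=> t /andP[t0 ts]; apply: Pd; apply/andP; split; lra.
    - move=> t /andP[t0 ts]; apply: is_deriveZ; apply: Ed; apply/andP; split; lra.
    - move=> t /andP[t0 ts]; have tr : 0 <= t <= r by apply/andP; split; lra.
      have g2n : normc (g2 (t%:C * u)) = normc (B (t%:C * u)) * normc (g (t%:C * u)).
        by rewrite (g2E _ (inD _ tr)) mulNr normcN -normcM.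
      rewrite !normcM u1 mulr1 uz// g2n.
      have := ler_wpM2l (normc_ge0 (B (t%:C * u))) (gM _ tr).
      have t1 : 0 <= 1 - t by lra.
      move=> /(ler_wpM2l t1) /le_trans; apply.
      by rewrite /b le_eqVlt; apply/orP; left; apply/eqP; ring.
  have E00 : E 0 = 1 by rewrite /E subrr expR0.
  have ME : M * E s = normc (P s) by rewrite /M divfK// gt_eqF.
  rewrite ME E00 mulr1; have := normc_le_dist (P s) (P 0); lra.
move=> t tr; apply: le_trans (gM _ tr) _; have /andP[t0 _] := tr.
rewrite ler_wpM2l// ler_wpM2r ?(ltW (E0 _))//; apply: le_trans MP0 _.
by rewrite /P /p rmorph0 mul0r g0 add0r subr0 normcM u1 mul1r.
Qed.

End RayBound.

(** * Zeros of solutions *)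

Section Zeros.
Context {R : realType}.
Implicit Types (f g h A : R[i] -> R[i]) (a b c z w u : R[i]) (t s x r : R).

Definition divides f b := exists2 k, analytic_disc k &
  forall z, disc z -> f z = (z - b) * k z.

Lemma cdiff_roots (S : seq R[i]) z :
  exists l, cdiff (fun u => \prod_(b <- S) (u - b)) z l.
Proof.
elim: S => [|b S [l hl]].
  exists 0; apply: cdiff_ext (cdiff_cst 1 z) _ => u; by rewrite big_nil.
eexists; apply: cdiff_ext (cdiffM (cdiffB (cdiff_id z) (cdiff_cst b z)) hl) _ => u.
by rewrite big_cons.
Qed.

Lemma analyticI f : (forall z, disc z -> exists l, cdiff f z l) -> analytic_disc f.
Proof. by move=> h z /h[l /cdiff_derivable]. Qed.

(** The quotients by the single factors are glued: away from [c] divide the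
    quotient by the other factors by [z - c], near [c] divide the quotient by
    [z - c] by the other factors. *)
Lemma divide_roots f (S : seq R[i]) : analytic_disc f -> uniq S ->
  (forall b, b \in S -> disc b /\ divides f b) ->
  exists2 F, analytic_disc F &
    forall z, disc z -> f z = \prod_(b <- S) (z - b) * F z.
Proof.
move=> fa; elim: S => [_ _|c S ih /= /andP[cS uS] hS].
  by exists f => // z _; rewrite big_nil mul1r.
have [|F Fa FE] := ih uS.
  by move=> b bS; apply: hS; rewrite inE bS orbT.
have [|cD [k ka kE]] := hS c; first by rewrite mem_head.
pose P z := \prod_(b <- S) (z - b).
have Pc : P c != 0.
  rewrite /P prodf_seq_neq0; apply/allP => b bS /=.
  by rewrite subr_eq0; apply: contraNneq cS => ->.
pose F2 z := if z == c then k c / P c else F z / (z - c).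
exists F2; last first.
  move=> z zD; rewrite big_cons /F2; case: eqVneq => [->|zc].
    by rewrite subrr !mul0r (kE _ cD) subrr mul0r.
  rewrite FE//; have zc0 : z - c != 0 by rewrite subr_eq0.
  by rewrite -/(P z); field.
apply: analyticI => z zD; have [->|zc] := eqVneq z c; last first.
  have zc0 : z - c != 0 by rewrite subr_eq0.
  eexists; apply: cdiff_near (cdiff_div (g := fun u => u - c) zc0 (analytic_cdiff Fa zD)
    (cdiffB (cdiff_id z) (cdiff_cst c z))) _.
  exists (normc (z - c)); first by rewrite normc_gt0.
  move=> w wz; rewrite /F2; case: eqVneq => // wc.
  by rewrite wc normcB ltxx in wz.
have [l Pl] := cdiff_roots S c.
have [d d0 hd] := ccont_neq0 (cdiff_ccont Pl) Pc.
eexists; apply: cdiff_near (cdiff_div (g := P) Pc (analytic_cdiff ka cD) Pl) _.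
exists (Num.min d (1 - normc c)); first by rewrite lt_min d0 subr_gt0.
move=> w; rewrite lt_min => /andP[/hd Pw wc1].
have wD : disc w by rewrite /disc /=; have := normc_le_dist w c; lra.
rewrite /F2; case: eqVneq => [->//|wc].
have wc0 : w - c != 0 by rewrite subr_eq0.
have e : P w * F w = (w - c) * k w by rewrite -FE// kE.
rewrite -/(P w) in Pw.
have -> : k w = P w * F w / (w - c) by rewrite e; field.
by field; rewrite wc0 Pw.
Qed.

(** The potential of the equation solved by the solution moved by [mobius a]. *)
Definition potential A a z : R[i] :=
  A (mobius a z) * (defect a / (1 - a^* * z) ^+ 2) ^+ 2.

Definition ode A f := forall z, disc z -> cderive (cderive f) z + A z * f z = 0.

(** The factor [1 - a^* z] is, up to a constant, the inverse square root of the
    derivative of [mobius a]; it removes the first order term. *)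
Lemma transform_ode A f a : analytic_disc f -> ode A f -> disc a ->
  exists g1 g2, let g := fun z => (1 - a^* * z) * f (mobius a z) in
  [/\ forall z, disc z -> cdiff g z (g1 z), forall z, disc z -> cdiff g1 z (g2 z),
      forall z, disc z -> g2 z = - potential A a z * g z &
      f a = 0 -> g1 0 = - defect a * cderive f a].
Proof.
move=> fa fode aD.
have [f1 [f2 [f1E fd1 fd2 f2E]]] : exists f1 f2, [/\ cderive f = f1,
    forall z, disc z -> cdiff f z (f1 z), forall z, disc z -> cdiff f1 z (f2 z) &
    forall z, disc z -> f2 z = - A z * f z].
  exists (cderive f), (cderive (cderive f)); split=> [//|z zD|z zD|z zD].
  - exact: analytic_cdiff.
  - exact: (analytic_cdiff (analytic_cderive fa) zD).
  - by have /eqP := fode z zD; rewrite addr_eq0 mulNr => /eqP.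
rewrite f1E.
exists (fun z => - a^* * f (mobius a z) - defect a * (f1 (mobius a z) / (1 - a^* * z))).
exists (fun z => - potential A a z * ((1 - a^* * z) * f (mobius a z))).
split=> [z zD|z zD|//|fa0].
- have d0 := mobius_den aD zD; have wD := mobius_disc aD zD.
  apply: cdiff_eq (cdiffM (cdiff_mobius_den a z)
    (cdiff_comp (cdiff_mobius aD zD) (fd1 _ wD))) _.
  by field.
- have d0 := mobius_den aD zD; have wD := mobius_disc aD zD.
  have phid := cdiff_mobius aD zD.
  apply: cdiff_eq (cdiffB (cdiffZ (- a^*) (cdiff_comp phid (fd1 _ wD)))
    (cdiffZ (defect a) (cdiff_div (g := fun u => 1 - a^* * u) d0
      (cdiff_comp phid (fd2 _ wD)) (cdiff_mobius_den a z)))) _.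
  by rewrite /potential f2E//; field.
- by rewrite mobius0 fa0 !mulr0 sub0r subr0 divr1 mulNr.
Qed.

Lemma rayline_continuous (v : R[i] -> R) u t : vcont v (t%:C * u) -> normc u = 1 ->
  {for t, continuous (fun s => v (s%:C * u))}.
Proof.
move=> vc u1; apply/cvgrPdist_lt => e /vc[d d0 hd]; apply/nbhs_ballP.
exists d => //= s; rewrite /ball /= => ts; rewrite distrC; apply: hd.
by rewrite -mulrBl -rmorphB normcM u1 mulr1 normc_real distrC.
Qed.

Lemma analytic_vcont A z : analytic_disc A -> disc z -> vcont (fun w => normc (A w)) z.
Proof. by move=> Aa zD; apply: vcont_normc; exact: cdiff_ccont (analytic_cdiff Aa zD). Qed.

Lemma ccont_potential A a z : analytic_disc A -> disc a -> disc z ->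
  ccont (potential A a) z.
Proof.
move=> Aa aD zD; have d0 := mobius_den aD zD.
have c1 : ccont (fun u => 1 - a^* * u) z := cdiff_ccont (cdiff_mobius_den a z).
have d2 : (1 - a^* * z) ^+ 2 != 0 by rewrite expf_neq0.
have c2 : ccont (fun u => defect a / (1 - a^* * u) ^+ 2) z.
  apply: (ccontM (ccont_cst _ _)).
  by apply: (ccontV (f := fun u => (1 - a^* * u) ^+ 2) d2); exact: (ccontM c1 c1).
apply: ccontM; last exact: (ccontM c2 c2).
apply: (ccont_comp (cdiff_ccont (cdiff_mobius aD zD))).
exact: cdiff_ccont (analytic_cdiff Aa (mobius_disc aD zD)).
Qed.

Definition ray_weight A a u t : R := t * (1 - t) * normc (potential A a (t%:C * u)).

Lemma ray_disc u t r : normc u = 1 -> r < 1 -> 0 <= t <= r -> disc (t%:C * u).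
Proof.
move=> u1 r1 /andP[t0 tr]; rewrite /disc /= normcM u1 mulr1 normc_real ger0_norm//.
exact: le_lt_trans r1.
Qed.

Lemma ray_weight_continuous A a u t r : analytic_disc A -> disc a -> normc u = 1 ->
  r < 1 -> 0 <= t <= r -> {for t, continuous (ray_weight A a u)}.
Proof.
move=> Aa aD u1 r1 tr; apply: cvgM.
  by apply: cvgM; [exact: cvg_id|apply: cvgB; [exact: cvg_cst|exact: cvg_id]].
apply: (@rayline_continuous (fun z => normc (potential A a z)) u t) => //.
by apply: vcont_normc; apply: ccont_potential => //; exact: ray_disc tr.
Qed.

Lemma ray_weight_primitive A a u r : analytic_disc A -> disc a -> normc u = 1 ->
  0 <= r < 1 -> exists be : R -> R,
    forall t, 0 <= t <= r -> is_derive t 1 be (ray_weight A a u t).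
Proof.
move=> Aa aD u1 /andP[r0 r1]; apply: primitive_exists => // t tr.
exact: (@ray_weight_continuous _ _ _ _ r).
Qed.

(** The bound along rays for the solution moved by [mobius a] is proportional to
    its derivative at [0], hence to [cderive f a]. *)
Lemma double_zero A f a : analytic_disc A -> analytic_disc f -> ode A f -> disc a ->
  f a = 0 -> cderive f a = 0 -> forall z, disc z -> f z = 0.
Proof.
move=> Aa fa fode aD fa0 f'a0 z zD.
have [g1 [g2 [gd g1d g2E g10]]] := transform_ode fa fode aD.
have wD := mobius_disc aD zD; set ze := mobius a z in wD.
have zE : mobius a ze = z by rewrite mobiusK.
have [ze0|ze0] := eqVneq ze 0; first by rewrite -zE ze0 mobius0.
have n0 : 0 < normc ze by rewrite normc_gt0.
have nC : (normc ze)%:C != 0 by rewrite -normc_gt0 normc_real gtr0_norm.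
pose u := ze / (normc ze)%:C.
have u1 : normc u = 1 by rewrite normc_div normc_real gtr0_norm// divff// gt_eqF.
have r01 : 0 <= normc ze < 1 by rewrite normc_ge0; exact: wD.
have [be hbe] := ray_weight_primitive Aa aD u1 r01.
have := ray_bound u1 r01 gd g1d g2E _ hbe.
rewrite mobius0 fa0 mulr0 => /(_ erefl (normc ze)); rewrite lexx normc_ge0 => /(_ isT).
rewrite g10// f'a0 mulr0 normc0 mul0r mulr0.
have -> : (normc ze)%:C * u = ze by rewrite /u mulrC divfK.
move=> gle; have : normc ((1 - a^* * ze) * f (mobius a ze)) == 0.
  by rewrite eq_le gle normc_ge0.
rewrite normc_eq0 mulf_eq0 (negbTE (mobius_den aD wD)) /= zE.
by move=> /eqP.
Qed.

Definition ray_integral A a r u : R :=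
  (\int[lebesgue_measure]_(t in `[0%R, r]) ray_weight A a u t)%R.

(** Jensen's inequality for the moved solution [g], whose zeros are [0] and the
    points [mobius a b]: apply [jensen_average] to
    [h = g / (z * \prod_b (z - mobius a b) / (r^2 - (mobius a b)^* z))], for which
    [|h| = r^N |g| / r] on the circle of radius [r], with [N] the number of [b].
    On that circle [ray_bound] applies to [g]; and [h 0] is [g' 0] divided by the
    product of the [mobius a b], up to sign and a power of [r]. *)
Lemma zeros_product_bound A f a (S : seq R[i]) r L (ws : seq R[i]) :
  analytic_disc A -> analytic_disc f -> ode A f -> disc a -> f a = 0 ->
  cderive f a != 0 -> uniq S -> a \notin S ->
  (forall b, b \in a :: S -> disc b /\ divides f b) ->
  0 < r < 1 -> (0 < size ws)%N -> (forall w, w \in ws -> normc w = 1) ->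
  (forall u, normc u = 1 ->
     \sum_(w <- ws) ray_integral A a r (u * w) <= (size ws)%:R * L) ->
  r ^+ size S <= expR L * \prod_(b <- S) normc (mobius a b).
Proof.
move=> Aa fa fode aD fa0 f'a0 uS aS hS /andP[r0 r1] sws wn UL.
have [g1 [g2 [gd g1d g2E g10]]] := transform_ode fa fode aD.
set g := fun z => _ in gd g2E; have {}g10 := g10 fa0.
have g00 : g 0 = 0 by rewrite /g mobius0 fa0 mulr0.
have ga : analytic_disc g by apply: analyticI => z /gd h; eexists; exact: h.
have SD b : b \in S -> disc b by move=> bS; case: (hS b) => //; rewrite inE bS orbT.
have gdiv b : b \in a :: S -> divides g (mobius a b).
  move=> /hS [bD [k ka kE]].
  have bD' := mobius_disc aD bD; have d1 := mobius_den aD bD'.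
  exists (fun z => - defect a / (1 - a^* * mobius a b) * k (mobius a z)).
    apply: analyticI => z zD; eexists; apply: cdiffZ.
    exact: (cdiff_comp (cdiff_mobius aD zD) (analytic_cdiff ka (mobius_disc aD zD))).
  move=> z zD; have d0 := mobius_den aD zD.
  rewrite /g kE; last exact: mobius_disc.
  rewrite -{1}(mobiusK aD bD) mobius_sub//; set D := 1 - a^* * mobius a b in d1 *.
  by field; rewrite d0 d1.
pose ZS := map (mobius a) S.
have uZ : uniq (map (mobius a) (a :: S)).
  rewrite map_inj_in_uniq /= ?aS// => x y /hS[xD _] /hS[yD _] e.
  by rewrite -(mobiusK aD xD) e mobiusK.
have [|F Fa FE] := divide_roots ga uZ.
  move=> _ /mapP[b bS ->]; split; last exact: gdiv.
  by apply: mobius_disc => //; case: (hS b bS).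
rewrite /= mobiusa -/ZS in FE.
pose h z := F z * \prod_(b <- ZS) ((r ^+ 2)%:C - b^* * z).
have ha : analytic_disc h.
  apply: analyticI => z zD.
  have [l hl] : exists l, cdiff (fun z => \prod_(b <- ZS) ((r ^+ 2)%:C - b^* * z)) z l.
    elim: (ZS) => [|b T [l hl]].
      exists 0; apply: cdiff_ext (cdiff_cst 1 z) _ => u; by rewrite big_nil.
    eexists; apply: cdiff_ext (cdiffM (cdiffB (cdiff_cst (r ^+ 2)%:C z)
      (cdiffZ b^* (cdiff_id z))) hl) _ => u.
    by rewrite big_cons.
  by eexists; exact: (cdiffM (analytic_cdiff Fa zD) hl).
have hcirc u : normc u = 1 ->
    normc (h (r%:C * u)) <= r ^+ size S * normc (g1 0) * expR (ray_integral A a r u).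
  move=> u1; move zE: (r%:C * u) => z.
  have zr : normc z = r by rewrite -zE normcM u1 mulr1 normc_real gtr0_norm.
  have zD : disc z by rewrite /disc /= zr.
  have circ b : normc ((r ^+ 2)%:C - b^* * z) = r * normc (z - b).
    rewrite -zr normc_sqrJ (_ : _ - _ = z * Num.conj (z - b)).
      by rewrite normcM normcJ.
    by rewrite rmorphB; ring.
  have -> : normc (h z) = r ^+ size S * (normc (g z) / r).
    rewrite /h FE// big_cons subr0 !normcM !normc_prod zr.
    rewrite (eq_bigr (fun b => r * normc (z - b))) => [|b _]; last exact: circ.
    rewrite big_split /= big_const_seq count_predT -Monoid.iteropE size_map.
    by rewrite -/(r ^+ size S); field; rewrite gt_eqF.
  rewrite -mulrA ler_wpM2l ?exprn_ge0 ?(ltW r0)//.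
  rewrite ler_pdivrMr//.
  have r01 : 0 <= r < 1 by rewrite ltW.
  have [be hbe] := ray_weight_primitive Aa aD u1 r01.
  have := ray_bound u1 r01 gd g1d g2E g00 hbe.
  move=> /(_ r); rewrite lexx ltW// => /(_ isT); rewrite zE mulrC.
  suff -> : ray_integral A a r u = be r - be 0 by [].
  rewrite /ray_integral /Rintegral (@FTC2_closed _ (ray_weight A a u) be)//.
  by move=> t; exact: ray_weight_continuous.
have := jensen_average ha _ _ sws wn hcirc UL.
rewrite r0 r1 => /(_ isT).
have c0 : 0 <= r ^+ size S * normc (g1 0) by rewrite mulr_ge0 ?exprn_ge0 ?normc_ge0 ?ltW.
move=> /(_ c0).
have F0E : g1 0 = \prod_(b <- ZS) (0 - b) * F 0.
  have D0 : disc (0 : R[i]) by rewrite /disc /= normc0.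
  apply: (cdiff_unique (gd 0 D0)).
  have [l hl] := cdiff_roots ZS 0.
  have H := cdiffM (cdiff_id 0) (cdiffM hl (analytic_cdiff Fa D0)).
  rewrite mul0r addr0 mul1r in H.
  apply: cdiff_near H _; exists 1 => // w; rewrite subr0 => wD.
  by rewrite FE// big_cons subr0 mulrA.
have g1n : normc (g1 0) = \prod_(b <- S) normc (mobius a b) * normc (F 0).
  rewrite F0E normcM normc_prod big_map; congr (_ * _).
  by apply: eq_bigr => b _; rewrite sub0r normcN.
have hn : normc (h 0) = (r ^+ 2) ^+ size S * normc (F 0).
  rewrite /h normcM normc_prod mulrC; congr (_ * _).
  rewrite (eq_bigr (fun=> r ^+ 2)) => [|b _].
    by rewrite big_const_seq count_predT -Monoid.iteropE size_map.
  by rewrite mulr0 subr0 normc_real ger0_norm ?sqr_ge0.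
have F00 : 0 < normc (F 0).
  have : g1 0 != 0 by rewrite g10 mulf_neq0// oppr_eq0 defect_neq0.
  by rewrite F0E mulf_eq0 negb_or normc_gt0 => /andP[].
rewrite hn g1n expr2 exprMn => H.
rewrite -(ler_pM2r F00) -(ler_pM2l (exprn_gt0 (size S) r0)).
by apply: le_trans (le_trans _ H) _; rewrite le_eqVlt; apply/orP; left; apply/eqP; ring.
Qed.

End Zeros.

(** * Measures and integrals on the plane *)

Section Density.
Local Open Scope ereal_scope.
Context d (T : measurableType d) (R : realType).
Variables (mu nu : {measure set T -> \bar R}) (D : set T) (rho : T -> R).
Hypotheses (mD : measurable D) (mrho : measurable_fun D rho).
Hypothesis rho0 : forall x, D x -> (0 <= rho x)%R.
Hypothesis nuE : forall E, measurable E -> nu E = \int[mu]_(x in E `&` D) (rho x)%:E.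

Import HBNNSimple.

(** Linearity extends the hypothesis from sets to simple functions. *)
Let density_nnsfun (h : {nnsfun T >-> R}) :
  \int[mu]_(x in D) ((h x)%:E * (rho x)%:E) = \int[nu]_(x in D) (h x)%:E.
Proof.
have hsum x : ((h x)%:E = \sum_(y \in range h) (y * \1_(h @^-1` [set y]) x)%:E)%E.
  by rewrite fsumEFin// -fimfunE.
have h0 y : y \in range h -> (0 <= y)%R by rewrite inE => -[t _ <-].
have mrhoE : measurable_fun D (EFin \o rho) by exact/measurable_EFinP.
transitivity (\sum_(y \in range h) y%:E * nu (h @^-1` [set y])).
  transitivity (\int[mu]_(x in D)
      (\sum_(y \in range h) (y * \1_(h @^-1` [set y]) x)%:E * (rho x)%:E)).
    apply: eq_integral => x _; rewrite hsum ge0_mule_fsuml//.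
    by move=> y; exact: nnfun_muleindic_ge0.
  rewrite ge0_integral_fsum//; last 2 first.
  - move=> y; apply: emeasurable_funM => //; apply/measurable_EFinP.
    by apply: measurable_funM => //; exact: measurable_funTS.
  - by move=> y x Dx; rewrite mule_ge0 ?lee_fin ?rho0// -lee_fin nnfun_muleindic_ge0.
  apply: eq_fsbigr => y yh.
  rewrite nuE// setIC integral_mkcondr -ge0_integralZl//; last 3 first.
  - suff : measurable_fun D ((EFin \o rho) \_ (h @^-1` [set y])) by [].
    by apply/measurable_restrict => //; apply: measurable_funS mrhoE => //; exact: subIsetl.
  - by move=> x Dx; rewrite patchE; case: ifP => //; rewrite lee_fin rho0.
  - exact: h0.
  apply: eq_integral => x xD; rewrite patchE indicE; case: ifP => xy.
    by rewrite mulr1.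
  by rewrite mulr0 mul0e mule0.
transitivity (\int[nu]_(x in D) (\sum_(y \in range h) (y * \1_(h @^-1` [set y]) x)%:E)); last first.
  by apply: eq_integral => x _; rewrite -hsum.
rewrite ge0_integral_fsum//; last 2 first.
- by move=> y; apply/measurable_EFinP; apply: measurable_funM => //; exact: measurable_funTS.
- by move=> y x _; exact: nnfun_muleindic_ge0.
apply: eq_fsbigr => y yh; rewrite integralZl_indic_nnsfun// integral_indic//.
by rewrite !nuE// ?setIid -?setIA ?setIid//; exact: measurableI.
Qed.

(** Monotone convergence along simple functions increasing to [f]. *)
Lemma density_integral_le (f : T -> R) : measurable_fun D f ->
  (forall x, D x -> (0 <= f x)%R) ->
  \int[mu]_(x in D) (f x * rho x)%:E <= \int[nu]_(x in D) (f x)%:E.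
Proof.
move=> mf f0.
have mfE : measurable_fun D (EFin \o f) by exact/measurable_EFinP.
pose h := nnsfun_approx mD mfE.
have mrhoE : measurable_fun D (EFin \o rho) by exact/measurable_EFinP.
have -> : \int[mu]_(x in D) (f x * rho x)%:E =
    limn (fun n => \int[mu]_(x in D) ((h n x)%:E * (rho x)%:E)).
  rewrite -monotone_convergence//.
  - apply: eq_integral => x; rewrite inE => Dx; apply/esym/cvg_lim => //.
    rewrite EFinM; apply: cvgeZr => //.
    by apply: (cvg_nnsfun_approx mD mfE) => //= y Dy; rewrite lee_fin f0.
  - move=> n; apply: emeasurable_funM => //; apply/measurable_EFinP.
    exact: measurable_funTS.
  - by move=> n x Dx; rewrite mule_ge0 ?lee_fin ?rho0.
  - move=> x Dx m n mn; rewrite lee_wpmul2r ?lee_fin ?rho0//.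
    exact/lefP/nd_nnsfun_approx.
apply: lime_le.
  apply: ereal_nondecreasing_is_cvgn => m n mn; apply: ge0_le_integral => //.
  - by move=> x Dx; rewrite mule_ge0 ?lee_fin ?rho0.
  - apply: emeasurable_funM => //; apply/measurable_EFinP; exact: measurable_funTS.
  - apply: emeasurable_funM => //; apply/measurable_EFinP; exact: measurable_funTS.
  - move=> x Dx; rewrite lee_wpmul2r ?lee_fin ?rho0//.
    exact/lefP/nd_nnsfun_approx.
apply: nearW => n; rewrite density_nnsfun; apply: ge0_le_integral => //.
- by move=> x Dx; rewrite lee_fin.
- apply/measurable_EFinP; exact: measurable_funTS.
- move=> x Dx; rewrite /h nnsfun_approxE; apply: (@le_approx _ _ _ D (EFin \o f)) => //.
Qed.

End Density.

Section PlaneMeasure.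
Context {R : realType}.
Implicit Types (f g h A : R[i] -> R[i]) (a b c z w u : R[i]) (t s x r : R).

Let rbox (p : rat * rat * (rat * rat)) : set (plane R) :=
  `]ratr p.1.1, ratr p.1.2[%classic `*` `]ratr p.2.1, ratr p.2.2[%classic.

(** An open set is the union of the rational boxes it contains. *)
Lemma open_plane_measurable (U : set (R * R)) : open U -> measurable (U : set (plane R)).
Proof.
move=> oU.
have -> : (U : set (plane R)) = \bigcup_(p in [set p | rbox p `<=` U]) rbox p.
  apply/seteqP; split => [[x y] Uxy|q [p /= pU]]; last exact: pU.
  have /(@nbhs_ballP R (R * R)%type)[e /= e0 he] := open_nbhs_nbhs (conj oU Uxy).
  have [q1] := rat_in_itvoo (ltac:(lra) : x - e < x).
  have [q2] := rat_in_itvoo (ltac:(lra) : x < x + e).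
  have [q3] := rat_in_itvoo (ltac:(lra) : y - e < y).
  have [q4] := rat_in_itvoo (ltac:(lra) : y < y + e).
  rewrite !in_itv /= => /andP[a1 a2] /andP[a3 a4] /andP[a5 a6] /andP[a7 a8].
  exists ((q1, q2), (q3, q4)); rewrite /rbox /=; last first.
    by split; rewrite /= in_itv /=; apply/andP.
  move=> [x' y'] [/=]; rewrite !in_itv /= => /andP[b1 b2] /andP[b3 b4].
  by apply: he; split; rewrite /ball /= ltr_norml; apply/andP; split; lra.
rewrite bigcup_mkcond; apply: countable_bigcupT_measurable; first exact: countableP.
move=> p; case: ifP => _ //.
by apply: measurableX; exact: measurable_itv.
Qed.

End PlaneMeasure.

Lemma area_sigma_finite (R : realType) : sigma_finite [set: plane R] (@area R).
Proof.
have /sigma_finiteP[F [FT ndF Foo]] := sigma_finiteT (@lebesgue_measure R).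
exists (fun n => F n `*` F n).
  rewrite -setXTT FT predeqE => -[x y]; split.
    move=> [/= [n _ Fnx] [k _ Fky]]; exists (maxn n k) => //; split.
    - by move: x Fnx; exact/subsetPset/ndF/leq_maxl.
    - by move: y Fky; exact/subsetPset/ndF/leq_maxr.
  by move=> [n _ []/= ? ?]; split; exists n.
move=> n; have [mF Fn] := Foo n; split; first exact: measurableX.
by rewrite /area product_measure1E// lte_mul_pinfty// ge0_fin_numE.
Qed.

(** [area] with the structure that Tonelli's theorem asks for. *)
Definition area_sfm (R : realType) : {sigma_finite_measure set (plane R) -> \bar R} :=
  HB.pack (@lebesgue_measure R \x @lebesgue_measure R)%E
    (Measure_isSigmaFinite.Build _ _ _ (@lebesgue_measure R \x @lebesgue_measure R)%E
       (area_sigma_finite R)).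

Section LebesgueAffine.
Local Open Scope ereal_scope.
Context {R : realType}.
Local Notation mu := (@lebesgue_measure R).
Local Notation RT := (measurableTypeR R).

(** A map that pulls half-open intervals back to intervals of the same length
    preserves Lebesgue integrals. *)
Lemma ge0_integral_preserving (phi : R -> R) (f : R -> \bar R) :
  measurable_fun [set: RT] (phi : RT -> RT) ->
  (forall x y, mu (phi @^-1` `]x, y]) = mu `]x, y]) ->
  measurable_fun [set: R] f -> (forall x, 0 <= f x) ->
  \int[mu]_x f (phi x) = \int[mu]_x f x.
Proof.
move=> mphi phiE mf f0.
pose phi' : {mfun RT >-> RT} := HB.pack (phi : RT -> RT)
  (isMeasurableFun.Build _ _ _ _ _ mphi).
rewrite -[LHS]/(\int[mu]_(x in phi' @^-1` setT) (f \o phi') x).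
rewrite -ge0_integral_pushforward//.
apply: eq_measure_integral => A mA _; apply/esym.
by apply: (@lebesgue_measure_unique R (pushforward mu phi')) => // _ [[x y] _ <-]; rewrite -phiE.
Qed.

Lemma ge0_integral_translation (b : R) (f : R -> \bar R) :
  measurable_fun [set: R] f -> (forall x, 0 <= f x) ->
  \int[mu]_x f (b + x)%R = \int[mu]_x f x.
Proof.
move=> mf f0; apply: (@ge0_integral_preserving (fun x => b + x)%R) => //.
  exact: measurable_funD.
move=> x y; rewrite (_ : _ @^-1` _ = `](x - b)%R, (y - b)%R]%classic).
  rewrite !lebesgue_measure_itv/= !lte_fin ltrD2r; case: ifP => // _.
  by rewrite -!EFinB; congr (_%:E); ring.
by apply/seteqP; split => t /=; rewrite !in_itv /= => /andP[? ?]; apply/andP; split; lra.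
Qed.

Lemma ge0_integral_reflection (b : R) (f : R -> \bar R) :
  measurable_fun [set: R] f -> (forall x, 0 <= f x) ->
  \int[mu]_x f (b - x)%R = \int[mu]_x f x.
Proof.
move=> mf f0; apply: (@ge0_integral_preserving (fun x => b - x)%R) => //.
  exact: measurable_funB.
move=> x y; rewrite (_ : _ @^-1` _ = `[(b - y)%R, (b - x)%R[%classic).
  rewrite !lebesgue_measure_itv/= !lte_fin ltrD2l ltrN2; case: ifP => // _.
  by rewrite -!EFinB; congr (_%:E); ring.
by apply/seteqP; split => t /=; rewrite !in_itv /= => /andP[? ?]; apply/andP; split; lra.
Qed.

End LebesgueAffine.

Section DiscMeasurability.
Context {R : realType}.
Implicit Types (v : R[i] -> R) (z w : R[i]).

Lemma disc_open_plane (U : set R[i]) :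
  (forall z, U z -> exists2 d : R, 0 < d & forall w, normc (w - z) < d -> U w) ->
  open [set p : R * R | U (p.1 +i* p.2)].
Proof.
move=> hU; rewrite openE => -[x y] /= /hU[d d0 hd].
apply/(@nbhs_ballP R (R * R)%type); exists (d / 2) => [|q [/= h1 h2]]; first by rewrite /= divr_gt0.
apply: hd; apply: le_lt_trans (normc_le_ReIm _) _; rewrite cReD cImD cReN cImN /=.
by move: h1 h2; rewrite /ball /= distrC (distrC y); lra.
Qed.

Lemma disc_nbhs z : disc z -> exists2 d : R, 0 < d & forall w, normc (w - z) < d -> disc w.
Proof.
rewrite /disc /= => z1; exists (1 - normc z); first lra.
by move=> w wz; have := normc_le_dist w z; lra.
Qed.

Lemma measurable_disc_plane : measurable (@disc_plane R).
Proof. by apply: open_plane_measurable; apply: disc_open_plane => z; exact: disc_nbhs. Qed.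

Lemma vcont_measurable v : (forall z, disc z -> vcont v z) ->
  measurable_fun (@disc_plane R) (v \o plane_to_C).
Proof.
move=> vc; apply: (measurability _ (RGenOInfty.measurableE R)).
move=> _ [_ [x ->] <-]; apply: open_plane_measurable.
rewrite (_ : _ `&` _ = [set p : R * R | (disc `&` [set z | x < v z]) (p.1 +i* p.2)]); last first.
  by apply/seteqP; split => p; rewrite /disc_plane /plane_to_C /= in_itv /= andbT.
apply: disc_open_plane => z [zD /= xv].
have [d1 d10 h1] := disc_nbhs zD.
have [|d2 d20 h2] := vc z zD (v z - x); first by rewrite subr_gt0.
exists (Num.min d1 d2); first by rewrite lt_min d10.
move=> w; rewrite lt_min => /andP[/h1 wD /h2]; rewrite ltr_norml => /andP[k1 _].
by split => //=; lra.
Qed.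

End DiscMeasurability.

Section SubMean.
Context {R : realType}.
Implicit Types (A : R[i] -> R[i]) (z w : R[i]).
Local Notation mu := (@lebesgue_measure R).

Lemma cint_le_integral (P : R -> R[i]) (N : R -> R) a b : a < b ->
  rcont_on P a b -> (forall t, a <= t <= b -> {for t, continuous N}) ->
  (forall t, a <= t <= b -> normc (P t) <= N t) ->
  ((normc (cint P a b))%:E <= \int[mu]_(t in `[a, b]) (N t)%:E)%E.
Proof.
move=> ab Pc Nc PN; have [F hF] := primitive_exists (ltW ab) Nc.
by rewrite (FTC2_closed ab Nc hF) lee_fin; exact: (cint_normc_le (ltW ab) Pc hF).
Qed.

Lemma rcont_normc (P : R -> R[i]) t : rcont P t -> {for t, continuous (fun s => normc (P s))}.
Proof.
move=> [c1 c2].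
have -> : (fun s => normc (P s)) = (fun s => Num.sqrt (Re (P s) ^+ 2 + Im (P s) ^+ 2)).
  by apply/funext => s; rewrite -normc_sqr sqrtr_sqr ger0_norm ?normc_ge0.
apply: (@continuous_comp _ _ _ (fun s => Re (P s) ^+ 2 + Im (P s) ^+ 2) Num.sqrt).
  by apply: cvgD; rewrite expr2; under eq_fun do rewrite expr2; apply: cvgM.
exact: sqrt_continuous.
Qed.

Definition square w (r : R) : set (plane R) :=
  `[Re w - r, Re w + r]%classic `*` `[Im w - r, Im w + r]%classic.

Lemma measurable_square w r : measurable (square w r).
Proof. by apply: measurableX; exact: measurable_itv. Qed.

(** Cauchy's formula on the square of half side [s]: the kernel is at most [1 / s]
    on the boundary, and its integral is at least [4] by [index_ge4]. *)
Lemma four_sides A w (s : R) : 0 < s ->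
  (forall z, inrect (Re w - s) (Re w + s) (Im w - s) (Im w + s) z -> exists l, cdiff A z l) ->
  let I1 (y : R) := (\int[mu]_(x in `[(Re w - s)%R, (Re w + s)%R]) (normc (A (x +i* y)))%:E)%E in
  let I2 (x : R) := (\int[mu]_(y in `[(Im w - s)%R, (Im w + s)%R]) (normc (A (x +i* y)))%:E)%E in
  ((4 * s * normc (A w))%:E <= I1 (Im w - s)%R + I2 (Re w + s)%R
     + (I1 (Im w + s)%R + I2 (Re w - s)%R))%E.
Proof.
move=> s0 Ad; cbv zeta; set a := Re w; set b := Im w.
have xs : a - s < a + s by lra.
have ys : b - s < b + s by lra.
have wx : a - s < Re w < a + s by rewrite -/a; apply/andP; split; lra.
have wy : b - s < Im w < b + s by rewrite -/b; apply/andP; split; lra.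
have cf := cauchy_formula wx wy Ad.
have i4 := index_ge4 w s0; rewrite -/a -/b in i4.
have nz := bdry_neq wx wy.
have Ac z : bdry (a - s) (a + s) (b - s) (b + s) z -> ccont A z.
  by move=> /(bdry_inrect (ltW xs) (ltW ys)) /Ad[l /cdiff_ccont].
have kc z : bdry (a - s) (a + s) (b - s) (b + s) z -> ccont (fun z => A z / (z - w)) z.
  by move=> zb; apply: ccont_kernel; [exact: Ac|exact: nz].
have [c1 c2 c3 c4] := bdry_rcont kc.
have [d1 d2 d3 d4] := bdry_rcont Ac.
have far z : bdry (a - s) (a + s) (b - s) (b + s) z -> s <= normc (z - w).
  move=> [] [_ h].
    apply: le_trans (Im_le_normc _); rewrite cImD cImN -/b.
    by case: h => ->; rewrite addrAC subrr add0r ?normrN ger0_norm ?(ltW s0).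
  apply: le_trans (Re_le_normc _); rewrite cReD cReN -/a.
  by case: h => ->; rewrite addrAC subrr add0r ?normrN ger0_norm ?(ltW s0).
have kbd z : bdry (a - s) (a + s) (b - s) (b + s) z ->
    normc (A z / (z - w)) <= s^-1 * normc (A z).
  move=> /far zs; rewrite normc_div mulrC ler_wpM2r ?normc_ge0//.
  by rewrite lef_pV2 ?posrE//; lra.
have side (P Q : R -> R[i]) (x y : R) : x < y -> rcont_on P x y -> rcont_on Q x y ->
    (forall t, x <= t <= y -> normc (P t) <= s^-1 * normc (Q t)) ->
    ((s * normc (cint P x y))%:E <= \int[mu]_(t in `[x, y]) (normc (Q t))%:E)%E.
  move=> xy Pc Qc PQ.
  have Pc' : rcont_on (fun t => s%:C * P t) x y by move=> t /Pc; exact: rcontZ.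
  have := @cint_le_integral _ (fun t => normc (Q t)) _ _ xy Pc'.
  rewrite cintZ ?(ltW xy)// normcM normc_real gtr0_norm//; apply.
    by move=> t /Qc; exact: rcont_normc.
  move=> t /PQ h; rewrite normcM normc_real gtr0_norm//.
  by rewrite -ler_pdivlMl.
have t1 := side _ _ _ _ xs c1 d1 (fun t tab => kbd _ (@bdry_bottom _ _ _ _ _ _ tab)).
have t2 := side _ _ _ _ ys c2 d2 (fun t tab => kbd _ (@bdry_right _ _ _ _ _ _ tab)).
have t3 := side _ _ _ _ xs c3 d3 (fun t tab => kbd _ (@bdry_top _ _ _ _ _ _ tab)).
have t4 := side _ _ _ _ ys c4 d4 (fun t tab => kbd _ (@bdry_left _ _ _ _ _ _ tab)).
apply: le_trans (leeD (leeD t1 t2) (leeD t3 t4)).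
rewrite -!EFinD lee_fin -!mulrDr mulrAC mulrC ler_wpM2l ?(ltW s0)//.
apply: (@le_trans _ _ (normc (rect (fun z => A z / (z - w)) (a - s) (a + s) (b - s) (b + s)))).
  rewrite -cf normcM mulrC ler_wpM2l ?normc_ge0//.
  by apply: le_trans i4 _; apply: le_trans (ler_norm _) (Im_le_normc _).
rewrite /rect; apply: le_trans (normcDB _ _) _; rewrite normcM normc_i mul1r addrA lerD2r.
apply: le_trans (normcDB _ _) _; rewrite lerD2r.
by apply: le_trans (normcD _ _) _; rewrite normcM normc_i mul1r.
Qed.

(** Integrate [four_sides] over [s] in [[0, r]]: each of the four families of
    sides sweeps out a part of the square. *)
Lemma area_submean A w (r : R) : 0 < r ->
  (forall z, inrect (Re w - r) (Re w + r) (Im w - r) (Im w + r) z -> exists l, cdiff A z l) ->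
  measurable_fun (square w r) (fun p => normc (A (plane_to_C p))) ->
  ((r ^+ 2 * normc (A w))%:E <=
    2%:E * \int[area]_(p in square w r) (normc (A (plane_to_C p)))%:E)%E.
Proof.
move=> r0 Ad mA.
pose a := Re w; pose b := Im w.
pose G := (EFin \o (fun p => normc (A (plane_to_C p)))) \_ (square w r).
have mG : measurable_fun [set: plane R] G.
  apply/(measurable_restrictT _ (measurable_square w r)).
  exact/measurable_EFinP.
have G0 p : (0 <= G p)%E.
  by rewrite /G patchE; case: ifP => // _; rewrite lee_fin normc_ge0.
pose H (y : R) := (\int[mu]_x G (x, y))%E.
pose V (x : R) := (\int[mu]_y G (x, y))%E.
have mH : measurable_fun [set: R] H by exact: measurable_fun_fubini_tonelli_G.
have mV : measurable_fun [set: R] V by exact: measurable_fun_fubini_tonelli_F.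
have H0 y : (0 <= H y)%E by apply: integral_ge0.
have V0 x : (0 <= V x)%E by apply: integral_ge0.
set J := (\int[area]_(p in square w r) _)%E.
have JE : J = (\int[mu \x mu]_p G p)%E by rewrite /J /area integral_mkcond.
have HJ : (\int[mu]_y H y = J)%E by rewrite JE fubini_tonelli2.
have VJ : (\int[mu]_x V x = J)%E by rewrite JE fubini_tonelli1.
have seg (s : R) : 0 <= s <= r ->
    ((4 * s * normc (A w))%:E <= H (b - s)%R + V (a + s)%R + (H (b + s)%R + V (a - s)%R))%E.
  rewrite le_eqVlt => /andP[/predU1P[<- _|s0 sr]].
    rewrite mulr0 mul0r.
    by apply: adde_ge0; (apply: adde_ge0; [exact: H0|exact: V0]).
  have sub (x y : R) : a - s <= x <= a + s -> b - s <= y <= b + s -> square w r (x, y).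
    move=> /andP[? ?] /andP[? ?].
    by split; rewrite /= in_itv /= -/a -/b; apply/andP; split; lra.
  have GE (x y : R) : square w r (x, y) -> G (x, y) = (normc (A (x +i* y)))%:E.
    by move=> xy; rewrite /G patchE mem_set.
  apply: le_trans (four_sides s0 _) _.
    move=> z [/andP[? ?] /andP[? ?]]; apply: Ad.
    by split; apply/andP; split; lra.
  have hor y : b - s <= y <= b + s ->
      (\int[mu]_(x in `[(a - s)%R, (a + s)%R]) (normc (A (x +i* y)))%:E <= H y)%E.
    move=> yb; rewrite /H (_ : \int[mu]_(x in _) _ = \int[mu]_(x in `[(a - s)%R, (a + s)%R]) G (x, y))%E.
      apply: ge0_subset_integral => //.
      by apply: (measurableT_comp mG); exact: measurable_fun_pair.
    apply: eq_integral => x; rewrite inE /= in_itv /= => xa; rewrite GE//; exact: sub.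
  have ver x : a - s <= x <= a + s ->
      (\int[mu]_(y in `[(b - s)%R, (b + s)%R]) (normc (A (x +i* y)))%:E <= V x)%E.
    move=> xa; rewrite /V (_ : \int[mu]_(y in _) _ = \int[mu]_(y in `[(b - s)%R, (b + s)%R]) G (x, y))%E.
      apply: ge0_subset_integral => //.
      by apply: (measurableT_comp mG); exact: measurable_fun_pair.
    apply: eq_integral => y; rewrite inE /= in_itv /= => yb; rewrite GE//; exact: sub.
  by apply: leeD; (apply: leeD; [apply: hor|apply: ver]); apply/andP; split; lra.
have mHm : measurable_fun [set: R] (fun s => H (b - s)%R).
  by apply: measurableT_comp => //; exact: measurable_funB.
have mHp : measurable_fun [set: R] (fun s => H (b + s)%R).
  by apply: measurableT_comp => //; exact: measurable_funD.
have mVm : measurable_fun [set: R] (fun s => V (a - s)%R).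
  by apply: measurableT_comp => //; exact: measurable_funB.
have mVp : measurable_fun [set: R] (fun s => V (a + s)%R).
  by apply: measurableT_comp => //; exact: measurable_funD.
have I4 : (\int[mu]_(s in `[0%R, r]) (4 * s * normc (A w))%:E = (2 * r ^+ 2 * normc (A w))%:E)%E.
  have C4 (t : R) : 0 <= t <= r -> {for t, continuous (fun s : R => 4 * s * normc (A w))}.
    move=> _; apply: cvgM; last exact: cvg_cst.
    by apply: cvgM; [exact: cvg_cst|exact: cvg_id].
  have D4 (t : R) : 0 <= t <= r ->
      is_derive t 1 (fun s : R => 2 * normc (A w) * (s * s)) (4 * t * normc (A w)).
    move=> _; have D1 := is_deriveZ (2 * normc (A w))
      (is_deriveM (is_derive_id t (1 : R)) (is_derive_id t (1 : R))).
    by apply: is_derive_eq D1 _; rewrite /GRing.scale /=; ring.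
  by rewrite (FTC2_closed r0 C4 D4); congr (_%:E); ring.
clearbody H V.
have key : ((2 * r ^+ 2 * normc (A w))%:E <= 4%:E * J)%E.
  rewrite -I4.
  apply: (@le_trans _ _ (\int[mu]_s (H (b - s)%R + V (a + s)%R + (H (b + s)%R + V (a - s)%R)))%E).
    apply: (@le_trans _ _ (\int[mu]_(s in `[0%R, r])
        (H (b - s)%R + V (a + s)%R + (H (b + s)%R + V (a - s)%R)))%E).
      apply: ge0_le_integral; first exact: measurable_itv.
      - by move=> s; rewrite /= in_itv /= => /andP[s0 _]; rewrite lee_fin !mulr_ge0 ?normc_ge0.
      - apply/measurable_EFinP; apply: measurable_funM => //; exact: measurable_funM.
      - by apply: measurable_funTS; apply: emeasurable_funD; exact: emeasurable_funD.
      - by move=> s; rewrite /= in_itv /=; exact: seg.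
    apply: ge0_subset_integral; first exact: measurable_itv.
    - exact: measurableT.
    - by apply: emeasurable_funD; exact: emeasurable_funD.
    - move=> s _.
      by apply: adde_ge0; (apply: adde_ge0; [exact: H0|exact: V0]).
    - by [].
  rewrite !ge0_integralD//; try (by move=> s _; rewrite ?adde_ge0); try exact: emeasurable_funD.
  rewrite (ge0_integral_translation a mV V0) (ge0_integral_translation b mH H0).
  rewrite (ge0_integral_reflection a mV V0) (ge0_integral_reflection b mH H0) HJ VJ.
  rewrite (_ : 4%:E = (1 + 1 + (1 + 1))%:E)%E; last by congr (_%:E); ring.
  by rewrite !EFinD !ge0_muleDl ?adde_ge0 ?lee_fin// !mul1e.
have J0 : (0 <= J)%E by apply: integral_ge0 => p _; rewrite lee_fin normc_ge0.
move: key; case: (J) J0 => [j||] //= j0; last by move=> _; rewrite mulry gtr0_sg// mul1e leey.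
by rewrite -!EFinM !lee_fin; lra.
Qed.

End SubMean.

(** * The invariant form of the Carleson condition *)

Section CarlesonKernel.
Context {R : realType}.
Implicit Types (A f : R[i] -> R[i]) (a z w u : R[i]) (r t : R).
Local Notation mu := (@lebesgue_measure R).

(** The derivative of the disc automorphism [mobius a], up to sign. *)
Definition kernel a z : R[i] := defect a / (1 - a^* * z) ^+ 2.

Lemma normc_kernel a z : disc a ->
  normc (kernel a z) = (1 - normc a ^+ 2) / normc (1 - a^* * z) ^+ 2.
Proof. by move=> aD; rewrite /kernel normc_div normc_defect// normcX. Qed.

Lemma kernel_weight a z : disc a -> disc z ->
  normc (kernel a z) * (1 - normc z ^+ 2) = 1 - normc (mobius a z) ^+ 2.
Proof. by move=> aD zD; rewrite normc_kernel// one_sub_mobius_sqr// mulrAC. Qed.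

Lemma cdiff_kernel a z : disc a -> disc z -> exists l, cdiff (kernel a) z l.
Proof.
move=> aD zD; have d0 := mobius_den aD zD.
have d2 : (1 - a^* * z) ^+ 2 != 0 by rewrite expf_neq0.
eexists; apply: (cdiff_div (f := fun=> defect a) (g := fun u => (1 - a^* * u) ^+ 2) d2
  (cdiff_cst _ _)).
exact: (cdiffM (cdiff_mobius_den a z) (cdiff_mobius_den a z)).
Qed.

(** The Poisson kernel [(1 - |u|^2) / |1 - u|^2] along a circle [u = x + iy] has
    the periodic primitive [t + 2 atan (y / (1 - x))]. *)
Lemma kernel_circle_mean a r : disc a -> 0 <= r < 1 ->
  (\int[mu]_(t in `[0%R, (2 * pi)%R]) (normc (kernel a (polar r t)))%:E <= (2 * pi)%:E)%E.
Proof.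
move=> aD /andP[r0 r1].
set al := Re a; set be := Im a.
pose x t := r * (al * cos t + be * sin t); pose y t := r * (al * sin t - be * cos t).
have uE t : a^* * polar r t = x t +i* y t.
  rewrite conjE /polar -/al -/be /x /y; apply/eqP; rewrite eq_complex /=.
  by apply/andP; split; apply/eqP; ring.
have xd t : is_derive t 1 x (- y t).
  have H := is_deriveZ r (is_deriveD (is_deriveZ al (is_derive_cos t)) (is_deriveZ be (is_derive_sin t))).
  by apply: is_derive_eq H _; rewrite /GRing.scale /= /y; ring.
have yd t : is_derive t 1 y (x t).
  have H := is_deriveZ r (is_deriveB (is_deriveZ al (is_derive_sin t)) (is_deriveZ be (is_derive_cos t))).
  by apply: is_derive_eq H _; rewrite /GRing.scale /= /x; ring.
have n2 t : x t ^+ 2 + y t ^+ 2 = r ^+ 2 * normc a ^+ 2.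
  rewrite normc_sqr -/al -/be /x /y.
  rewrite (_ : _ + _ = r ^+ 2 * ((al ^+ 2 + be ^+ 2) * (cos t ^+ 2 + sin t ^+ 2))); last by ring.
  by rewrite cos2Dsin2 mulr1.
have a1 : normc a ^+ 2 < 1 by rewrite expr_lt1 ?normc_ge0//.
have r2 : r ^+ 2 < 1 by rewrite expr_lt1.
have ra : r ^+ 2 * normc a ^+ 2 <= normc a ^+ 2 by rewrite ler_piMl ?sqr_ge0 ?ltW.
pose rho2 := r ^+ 2 * normc a ^+ 2.
have rho1 : 0 < 1 - rho2 by rewrite /rho2; lra.
have x1 t : 0 < 1 - x t.
  rewrite subr_gt0 ltNge; apply/negP => h.
  have : 1 <= x t ^+ 2 by rewrite exprn_ege1.
  by have := n2 t; have := sqr_ge0 (y t); lra.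
pose ka := (1 - normc a ^+ 2) / (1 - rho2).
pose F t := ka * (t + 2 * atan (y t / (1 - x t))).
have kE t : normc (kernel a (polar r t)) = ka * ((1 - rho2) / ((1 - x t) ^+ 2 + y t ^+ 2)).
  rewrite normc_kernel// uE [normc (1 - _) ^+ 2]normc_sqr !(cReD, cReN, cImD, cImN) /= sub0r sqrrN.
  have N1 : 1 - rho2 != 0 by exact: lt0r_neq0.
  have N2 : (1 - x t) ^+ 2 + y t ^+ 2 != 0.
    by apply: lt0r_neq0; rewrite ltr_wpDr ?sqr_ge0// exprn_gt0.
  by rewrite /ka; field; rewrite N1 N2.
have Fd t : is_derive t 1 F (normc (kernel a (polar r t))).
  have xt := lt0r_neq0 (x1 t).
  have D1 := is_deriveB (is_derive_cst (1 : R) t (1 : R)) (xd t).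
  have D2 := is_deriveV (f := fun t => 1 - x t) xt D1.
  have D3 := is_deriveM (yd t) D2.
  have D4 := @is_derive1_comp _ (@atan R) (fun t => y t / (1 - x t)) t _ _ (is_derive1_atan _) D3.
  have D5 := is_deriveZ ka (is_deriveD (is_derive_id t (1 : R)) (is_deriveZ 2 D4)).
  apply: is_derive_eq D5 _; rewrite /GRing.scale /= kE /rho2 -(n2 t); field.
  by rewrite xt lt0r_neq0// ltr_wpDr ?sqr_ge0// exprn_gt0.
have pi0 : 0 < 2 * pi :> R by rewrite mulr_gt0// pi_gt0.
have kc t : 0 <= t <= 2 * pi -> {for t, continuous (fun t => normc (kernel a (polar r t)))}.
  move=> _.
  have -> : (fun t => normc (kernel a (polar r t))) =
      (fun t => ka * ((1 - rho2) / ((1 - x t) ^+ 2 + y t ^+ 2))) by apply/funext.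
  have xc : {for t, continuous x}.
    by case: (xd t) => h _; apply: differentiable_continuous; apply/derivable1_diffP.
  have yc : {for t, continuous y}.
    by case: (yd t) => h _; apply: differentiable_continuous; apply/derivable1_diffP.
  apply: cvgM; first exact: cvg_cst.
  apply: cvgM; first exact: cvg_cst.
  apply: cvgV; first by rewrite gt_eqF// ltr_wpDr ?sqr_ge0// exprn_gt0.
  have c1 : {for t, continuous (fun t => 1 - x t)} by apply: cvgB; [exact: cvg_cst|exact: xc].
  rewrite (_ : (fun t => (1 - x t) ^+ 2 + y t ^+ 2) = (fun t => (1 - x t) * (1 - x t) + y t * y t)).
    by rewrite !expr2; apply: cvgD; apply: cvgM.
  by apply/funext => s; rewrite !expr2.
rewrite (FTC2_closed pi0 kc (fun t _ => Fd t)) lee_fin /F /x /y.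
have p2 : 2 * pi = pi + pi :> R by rewrite mulr2n mulrDl mul1r.
have c2 : cos (2 * pi) = 1 :> R by rewrite p2 cosD cospi sinpi mulrNN mulr1 mulr0 subr0.
have s2 : sin (2 * pi) = 0 :> R by rewrite p2 sinD cospi sinpi mulr0 mul0r addr0.
rewrite c2 s2 cos0 sin0.
set X := atan _; rewrite (_ : _ - _ = ka * (2 * pi)); last by ring.
rewrite ler_piMl ?(ltW pi0)// /ka ler_pdivrMr// mul1r /rho2; lra.
Qed.

Lemma kernel_hardy a : disc a -> analytic_disc (kernel a) /\ (hardy_norm 1 (kernel a) <= 1)%E.
Proof.
move=> aD; split; first by apply: analyticI => z zD; exact: cdiff_kernel.
rewrite /hardy_norm invr1 poweRe1; last first.
  apply: (@le_trans _ _ (hardy_mean 1 (kernel a) 0)); last first.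
    by apply: ereal_sup_ubound; exists 0 => //=; rewrite in_itv /= lexx ltr01.
  rewrite /hardy_mean mule_ge0 ?lee_fin ?invr_ge0 ?mulr_ge0 ?pi_ge0//.
  by apply: integral_ge0 => t _; rewrite lee_fin powR_ge0.
apply: ge_ereal_sup => _ [r /= + <-]; rewrite in_itv /= => r01.
rewrite /hardy_mean.
under eq_integral do rewrite powRr1 ?normc_ge0//.
have pi0 : 0 < 2 * pi :> R by rewrite mulr_gt0// pi_gt0.
rewrite muleC -[leRHS](_ : (2 * pi)%:E * ((2 * pi)^-1)%:E = 1)%E.
  by apply: lee_wpmul2r; [rewrite lee_fin invr_ge0 ltW|exact: kernel_circle_mean].
by rewrite -EFinM divff// gt_eqF.
Qed.

(** Test the Carleson condition for [p = 1] on [kernel a], whose norm is at most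
    [1]; by [kernel_weight] its modulus turns the weight [1 - |w|^2] into
    [1 - |mobius a w|^2]. *)
Lemma carleson_invariant A (nu : {measure set (plane R) -> \bar R}) :
  analytic_disc A ->
  (forall E : set (plane R), measurable E ->
     nu E = (\int[area]_(w in E `&` disc_plane)
       (normc (A (plane_to_C w)) * (1 - normc (plane_to_C w) ^+ 2))%:E)%E) ->
  carleson_measure nu ->
  exists2 C : R, 0 < C & forall a, disc a ->
    (\int[area]_(w in disc_plane)
       (normc (A (plane_to_C w)) * (1 - normc (mobius a (plane_to_C w)) ^+ 2))%:E <= C%:E)%E.
Proof.
move=> Aa nuE /(_ 1 ltr01)[C C0 hC]; exists C => // a aD.
have [ka kn] := kernel_hardy aD.
have /hC kC : hardy 1 (kernel a) by split => //; apply: le_lt_trans kn _; rewrite ltry.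
have CC : (C%:E * (hardy_norm 1 (kernel a)) `^ 1 <= C%:E)%E.
  rewrite poweRe1; last first.
    by rewrite /hardy_norm; exact: poweR_ge0.
  rewrite -[leRHS]mule1; apply: lee_wpmul2l; last exact: kn.
  by rewrite lee_fin ltW.
apply: le_trans (le_trans kC CC).
pose rho (w : plane R) := normc (A (plane_to_C w)) * (1 - normc (plane_to_C w) ^+ 2).
have idc z : vcont (fun u => normc u) z by apply: vcont_normc; exact: ccont_id.
have mrho : measurable_fun (@disc_plane R) rho.
  apply: (@vcont_measurable _ (fun z => normc (A z) * (1 - normc z ^+ 2))) => z zD.
  apply: vcontM; first exact: analytic_vcont.
  have := vcontD (vcont_cst 1 z) (vcontM (vcont_cst (-1) z) (vcontM (idc z) (idc z))).
  by under eq_fun do rewrite mulN1r -expr2.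
have mk : measurable_fun (@disc_plane R) (fun w : plane R => normc (kernel a (plane_to_C w))).
  apply: (@vcont_measurable _ (fun z => normc (kernel a z))) => z zD.
  by apply: vcont_normc; have [l /cdiff_ccont] := cdiff_kernel aD zD.
have rho0 (w : plane R) : disc_plane w -> 0 <= rho w.
  move=> wD; rewrite /rho mulr_ge0 ?normc_ge0// subr_ge0 expr_le1 ?normc_ge0//.
  exact: ltW.
have H := @density_integral_le _ (plane R) R (lebesgue_measure \x lebesgue_measure)%E nu
  disc_plane rho measurable_disc_plane mrho rho0 nuE _ mk
  (fun (w : plane R) _ => normc_ge0 _).
have -> : (\int[nu]_(w in disc_plane) (normc (kernel a (plane_to_C w)) `^ 1)%:E =
    \int[nu]_(w in disc_plane) (normc (kernel a (plane_to_C w)))%:E)%E.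
  by apply: eq_integral => w _; rewrite powRr1 ?normc_ge0.
apply: le_trans H.
rewrite le_eqVlt; apply/orP; left; apply/eqP; apply: eq_integral => w; rewrite inE => wD.
by rewrite /rho mulrCA kernel_weight.
Qed.

End CarlesonKernel.

(** * The averaged potential *)

Section AveragedPotential.
Context {R : realType}.
Implicit Types (A f : R[i] -> R[i]) (a z u : R[i]) (r t x : R).
Local Notation mu := (@lebesgue_measure R).

(** The hypothesis bounds the pseudohyperbolic distance of the images by [1 / 3],
    and this distance is invariant under [mobius a]. *)
Lemma mobius_close a z w : disc a -> disc z -> disc w ->
  4 * normc (mobius a w - mobius a z) <= 1 - normc (mobius a z) ^+ 2 ->
  3 * normc (z - w) <= normc (1 - w^* * z).
Proof.
move=> aD zD wD close; set W := mobius a z in close *; set Z := mobius a w in close *.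
have WD : disc W by exact: mobius_disc.
have d0 := mobius_den aD zD; have d1 := mobius_den aD wD.
have e0 : 0 < normc (defect a) / (normc (1 - a^* * z) * normc (1 - a^* * w)).
  by rewrite divr_gt0 ?mulr_gt0 ?normc_gt0// defect_neq0.
have inv : normc (Z - W) * normc (1 - w^* * z) = normc (1 - Z^* * W) * normc (z - w).
  rewrite /Z /W (mobius_sub aD wD zD) (mobius_conj_sub aD zD wD).
  by rewrite !normc_div !normcM normcN normcJ (normcB w z); field; rewrite !normc_eq0 d0 d1.
have big : 3 * (1 - normc W ^+ 2) <= 4 * normc (1 - Z^* * W).
  have W1 : normc W <= 1 by exact: ltW.
  have := normc_le_dist (1 - W^* * W) (1 - Z^* * W).
  rewrite (_ : (1 - W^* * W) - (1 - Z^* * W) = Num.conj (Z - W) * W); last first.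
    by rewrite rmorphB; ring.
  rewrite normcM normcJ; have := normc_defect WD; rewrite /defect mulrC => ->.
  have := ler_piMr (normc_ge0 (Z - W)) W1; lra.
have x0 : 0 < 1 - normc W ^+ 2 by rewrite subr_gt0 expr_lt1 ?normc_ge0.
have n0 : 0 < 4 * normc (1 - Z^* * W) by lra.
rewrite -(ler_pM2l n0).
have := ler_wpM2r (normc_ge0 (1 - w^* * z)) close.
have := ler_wpM2r (normc_ge0 (1 - w^* * z)) big.
rewrite -mulrA [X in X <= _ -> _]mulrC => h1 h2.
have : 3 * (4 * (normc (Z - W) * normc (1 - w^* * z))) <= 4 * normc (1 - Z^* * W) * normc (1 - w^* * z).
  lra.
rewrite inv; lra.
Qed.

(** Points at pseudohyperbolic distance at most [1 / 3] have comparable distances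
    to the circle, and [1 - w^* z] has the size of these distances. *)
Lemma close_consequences z w : disc z -> disc w ->
  3 * normc (z - w) <= normc (1 - w^* * z) ->
  let de := 1 - normc w ^+ 2 in
  [/\ `|normc z - normc w| <= de / 2, normc (1 - w^* * z) <= 3 / 2 * de &
      de <= 2 * (1 - normc z ^+ 2)].
Proof.
move=> zD wD h /=; set L := normc (1 - w^* * z) in h *; set e := normc (z - w) in h.
have z1 : normc z < 1 by []; have w1 : normc w < 1 by [].
have e0 : 0 <= e := normc_ge0 _.
have z0 := normc_ge0 z; have w0 := normc_ge0 w.
have L1 : L <= 1 - normc w ^+ 2 + e.
  have := normc_le_dist (1 - w^* * z) (1 - w^* * w).
  rewrite (_ : (1 - w^* * z) - (1 - w^* * w) = - (w^* * (z - w))); last by ring.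
  rewrite normcN normcM normcJ -/L -/e; have := normc_defect wD; rewrite /defect mulrC => ->.
  by nra.
have L2 : L <= 1 - normc z ^+ 2 + e.
  have := normc_le_dist (1 - w^* * z) (1 - z^* * z).
  rewrite (_ : (1 - w^* * z) - (1 - z^* * z) = Num.conj (z - w) * z); last first.
    by rewrite rmorphB; ring.
  rewrite normcM normcJ -/L -/e; have := normc_defect zD; rewrite /defect mulrC => ->.
  by nra.
have d := normc_dist z w; rewrite -/e in d.
split; [lra|lra|].
move: d; rewrite ler_norml => /andP[d1 d2].
have : normc z ^+ 2 - normc w ^+ 2 <= 2 * e by nra.
lra.
Qed.

(** Both functions are extended by zero, so as to be measurable on the plane. *)
Definition absA A (p : plane R) : R := if p \in disc_plane then normc (A (plane_to_C p)) else 0.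

Definition moved a (p : plane R) : R :=
  if p \in disc_plane then normc (mobius a (plane_to_C p)) else 0.

Definition near_circle a t (p : plane R) : bool :=
  `|t - moved a p| <= (1 - moved a p ^+ 2) / 2.

Lemma measurable_absA A : analytic_disc A -> measurable_fun [set: plane R] (absA A).
Proof.
move=> Aa; have := vcont_measurable (fun z zD => analytic_vcont Aa zD).
by move/(measurable_restrictT _ measurable_disc_plane).
Qed.

Lemma measurable_moved a : disc a -> measurable_fun [set: plane R] (moved a).
Proof.
move=> aD; have : measurable_fun (@disc_plane R) ((fun z => normc (mobius a z)) \o plane_to_C).
  apply: vcont_measurable => z zD; apply: vcont_normc.
  exact: cdiff_ccont (cdiff_mobius aD zD).
by move/(measurable_restrictT _ measurable_disc_plane).
Qed.

(** The integrand of the Tonelli argument, on the product of radii and points. *)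
Definition swept A a (tp : R * plane R) : \bar R :=
  (absA A tp.2 * (near_circle a tp.1 tp.2)%:R)%:E.

Lemma swept_ge0 A a tp : (0 <= swept A a tp)%E.
Proof.
rewrite lee_fin mulr_ge0//; rewrite /absA; case: ifP => // _; exact: normc_ge0.
Qed.

Lemma measurable_swept A a : analytic_disc A -> disc a ->
  measurable_fun [set: measurableTypeR R * plane R] (swept A a).
Proof.
move=> Aa aD; apply/measurable_EFinP.
have m2 : measurable_fun [set: measurableTypeR R * plane R] (fun tp => moved a tp.2).
  by apply: measurableT_comp => //; exact: measurable_moved.
apply: measurable_funM.
  by apply: measurableT_comp => //; exact: measurable_absA.
have mb : measurable_fun [set: measurableTypeR R * plane R]
    (fun tp => near_circle a tp.1 tp.2).
  apply: measurable_fun_ler.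
    by apply: measurableT_comp => //; apply: measurable_funB.
  apply: measurable_funM => //; apply: measurable_funB => //.
  by rewrite /GRing.exp /=; apply: measurable_funM.
rewrite (_ : (fun tp => _) = (fun tp => if near_circle a tp.1 tp.2 then 1 else 0)).
  by apply: measurable_fun_ifT.
by apply/funext => tp; case: near_circle.
Qed.

Lemma swept_length A a p : disc a ->
  (\int[mu]_t swept A a (t, p) = (absA A p * (1 - moved a p ^+ 2))%:E)%E.
Proof.
move=> aD; rewrite /swept /=; set m := moved a p; set B := absA A p.
have m1 : 0 <= m < 1.
  rewrite /m /moved; case: ifPn => [|_]; last by rewrite lexx ltr01.
  by rewrite inE normc_ge0 => pD; exact: mobius_disc.
have de0 : 0 < 1 - m ^+ 2 by rewrite subr_gt0 expr_lt1//; case/andP: m1.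
pose h := (1 - m ^+ 2) / 2.
transitivity (\int[mu]_t (B%:E * (\1_(`[m - h, m + h]%classic) t)%:E))%E.
  apply: eq_integral => t _; rewrite -EFinM /near_circle -/m -/h indicE; congr ((_ * _%:R)%:E); congr nat_of_bool.
  have -> : (t \in `[m - h, m + h]%classic) = (m - h <= t <= m + h).
    by apply/idP/idP; rewrite inE /= in_itv.
  by rewrite ler_norml; apply/andP/andP => -[? ?]; split; lra.
have B0 : 0 <= B by rewrite /B /absA; case: ifP => // _; exact: normc_ge0.
rewrite ge0_integralZl//; last by apply/measurable_EFinP; exact: measurable_indic.
rewrite integral_indic// setIT /= lebesgue_measure_itv /= lte_fin.
have -> : m - h < m + h by rewrite /h; lra.
by rewrite -EFinB -EFinM; congr (_%:E); rewrite /h; field.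
Qed.

Lemma ray_integralE A a r u : analytic_disc A -> disc a -> normc u = 1 -> 0 < r < 1 ->
  ((ray_integral A a r u)%:E = \int[mu]_(t in `[0%R, r]) (ray_weight A a u t)%:E)%E.
Proof.
move=> Aa aD u1 /andP[r0 r1].
have r01 : 0 <= r < 1 by rewrite ltW.
have [be hbe] := ray_weight_primitive Aa aD u1 r01.
have wc t : 0 <= t <= r -> {for t, continuous (ray_weight A a u)}.
  exact: ray_weight_continuous.
by rewrite /ray_integral /Rintegral (FTC2_closed r0 wc hbe).
Qed.

Lemma square_sub_disc z (s : R) : disc z -> s <= (1 - normc z ^+ 2) / 8 ->
  forall w, inrect (Re z - s) (Re z + s) (Im z - s) (Im z + s) w ->
    disc w /\ 4 * normc (w - z) <= 1 - normc z ^+ 2.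
Proof.
move=> zD sz w [/andP[h1 h2] /andP[h3 h4]].
have close : 4 * normc (w - z) <= 1 - normc z ^+ 2.
  have := normc_le_ReIm (w - z); rewrite cReD cReN cImD cImN.
  have : `|Re w - Re z| <= s by rewrite ler_norml; apply/andP; split; lra.
  have : `|Im w - Im z| <= s by rewrite ler_norml; apply/andP; split; lra.
  lra.
split=> //; have z1 : normc z < 1 by []; have z0 := normc_ge0 z.
by rewrite /disc /=; have := normc_le_dist w z; nra.
Qed.

(** The derivative of [mobius a] at [z] is [(1 - |W|^2) / (1 - |z|^2)] in modulus,
    so the potential carries the factor [(1 - |W|^2)^2], which is the area of the
    square up to a constant; [area_submean] then removes the value of [A] at [W]. *)
Lemma ray_weight_le A a u t : analytic_disc A -> disc a -> normc u = 1 -> 0 <= t < 1 ->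
  let z := t%:C * u in let W := mobius a z in
  ((ray_weight A a u t)%:E <= (128 / (1 - t ^+ 2))%:E *
    \int[area]_(p in square W ((1 - normc W ^+ 2) / 8)) (normc (A (plane_to_C p)))%:E)%E.
Proof.
move=> Aa aD u1 /andP[t0 t1]; cbv zeta; set z := t%:C * u; set W := mobius a z.
have zt : normc z = t by rewrite normcM u1 mulr1 normc_real ger0_norm.
have zD : disc z by rewrite /disc /= zt.
have WD : disc W by exact: mobius_disc.
pose s := (1 - normc W ^+ 2) / 8.
have x0 : 0 < 1 - t ^+ 2 by rewrite subr_gt0 expr_lt1.
have s0 : 0 < s by rewrite divr_gt0// subr_gt0 expr_lt1 ?normc_ge0.
have inD := square_sub_disc WD (lexx s).
have := area_submean s0 (A := A) (w := W).
have Ad w : inrect (Re W - s) (Re W + s) (Im W - s) (Im W + s) w -> exists l, cdiff A w l.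
  by move=> /inD[wD _]; eexists; exact: analytic_cdiff Aa wD.
have sqD : square W s `<=` disc_plane.
  by move=> p [/=]; rewrite !in_itv /= => h1 h2; have [] := inD (plane_to_C p).
have mA : measurable_fun (square W s) (fun p => normc (A (plane_to_C p))).
  apply: measurable_funS sqD _; first exact: measurable_disc_plane.
  exact: (vcont_measurable (fun z zD => analytic_vcont Aa zD)).
move=> /(_ Ad mA); set J := (\int[area]_(p in _) _)%E => sub.
have k0 : 0 <= 64 / (1 - t ^+ 2) by rewrite divr_ge0// ltW.
apply: (@le_trans _ _ ((64 / (1 - t ^+ 2))%:E * (s ^+ 2 * normc (A W))%:E)%E); last first.
  apply: le_trans (lee_wpmul2l _ sub) _; first by rewrite lee_fin.
  by rewrite muleA -EFinM le_eqVlt; apply/orP; left; apply/eqP; congr ((_%:E) * _)%E; ring.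
rewrite -EFinM lee_fin /ray_weight /potential -/z -/W normcM normcX.
have -> : normc (defect a / (1 - a^* * z) ^+ 2) = 8 * s / (1 - t ^+ 2).
  rewrite normc_div normc_defect// normcX /s /W one_sub_mobius_sqr// zt.
  field; rewrite lt0r_neq0//= normc_eq0; exact: mobius_den.
have tt : t * (1 - t) <= 1 - t ^+ 2 by nra.
have -> : 64 / (1 - t ^+ 2) * (s ^+ 2 * normc (A W)) =
    (1 - t ^+ 2) * (normc (A W) * (8 * s / (1 - t ^+ 2)) ^+ 2).
  by field; exact: lt0r_neq0.
by rewrite ler_wpM2r// mulr_ge0 ?normc_ge0 ?sqr_ge0.
Qed.

(** If [p] lies in the square belonging to [z = t u w] then [ze = mobius a p] is
    pseudohyperbolically close to [z], so [(1 - |ze|^2) / |1 - ze^* z|^2] is at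
    least a multiple of [1 / (1 - t^2)]. Hence the sum over these [w] is at most a
    multiple of a sum of Poisson kernels, which [unit_points_poisson] bounds. *)
Lemma square_count A a u t r (ws : seq R[i]) (p : plane R) : disc a -> normc u = 1 ->
  0 <= t <= r -> r < 1 -> (0 < size ws)%N -> (forall w, w \in ws -> normc w = 1) ->
  r ^+ size ws <= 2^-1 ->
  (forall x : R[i], normc x < 1 ->
     \sum_(w <- ws) (1 - w * x)^-1 = (size ws)%:R / (1 - x ^+ size ws)) ->
  disc_plane p ->
  let W w := mobius a (t%:C * (u * w)) in
  \sum_(w <- ws) 128 / (1 - t ^+ 2) * (p \in square (W w) ((1 - normc (W w) ^+ 2) / 8))%:R
    <= 1728 * (size ws)%:R * (near_circle a t p)%:R.
Proof.
move=> aD u1 /andP[t0 tr] r1 s0 wn rN wE pD.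
cbv zeta; set W := fun w => mobius a (t%:C * (u * w)).
set Z := plane_to_C p; set ze := mobius a Z.
have ZD : disc Z by [].
have zeD : disc ze by exact: mobius_disc.
have mE : moved a p = normc ze by rewrite /moved mem_set.
set de := 1 - normc ze ^+ 2.
have de0 : 0 < de by rewrite subr_gt0 expr_lt1 ?normc_ge0.
have x0 : 0 < 1 - t ^+ 2 by rewrite subr_gt0 expr_lt1//; lra.
have tD w : w \in ws -> disc (t%:C * (u * w)).
  by move=> /wn w1; rewrite /disc /= !normcM u1 w1 !mulr1 normc_real ger0_norm//; lra.
have tn w : w \in ws -> normc (t%:C * (u * w)) = t.
  by move=> /wn w1; rewrite !normcM u1 w1 !mulr1 normc_real ger0_norm.
have facts w : w \in ws -> p \in square (W w) ((1 - normc (W w) ^+ 2) / 8) ->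
    [/\ near_circle a t p, normc (1 - ze^* * (t%:C * (u * w))) <= 3 / 2 * de &
        de <= 2 * (1 - t ^+ 2)].
  move=> ww; rewrite inE => -[/=]; rewrite !in_itv /= => h1 h2.
  have zD := tD w ww; have WD : disc (W w) by exact: mobius_disc.
  have [_ close] := square_sub_disc WD (lexx _) (conj h1 h2 : inrect _ _ _ _ Z).
  rewrite -(mobiusK aD ZD) -/ze in close.
  have := close_consequences zD zeD (mobius_close aD zD zeD close).
  by rewrite tn//= /near_circle mE => -[].
have kn w : w \in ws -> 0 < normc (1 - w * (ze^* * (t%:C * u))).
  move=> ww; rewrite normc_gt0 (_ : w * _ = ze^* * (t%:C * (u * w))); last by ring.
  exact: mobius_den (tD w ww).
(* [576 = 128 * (3 / 2) ^+ 2 * 2], the last two factors from [close_consequences] *)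
have term w : w \in ws ->
    128 / (1 - t ^+ 2) * (p \in square (W w) ((1 - normc (W w) ^+ 2) / 8))%:R <=
    576 * de * (near_circle a t p)%:R * (normc (1 - w * (ze^* * (t%:C * u))) ^+ 2)^-1.
  move=> ww; have k0 := kn w ww.
  case: (boolP (p \in square _ _)) => [/(facts w ww)[-> Lde dex]|_]; last first.
    rewrite mulr0; apply: mulr_ge0; last by rewrite invr_ge0 sqr_ge0.
    apply: mulr_ge0; last exact: ler0n.
    by apply: mulr_ge0; [exact: ler0n|exact: ltW].
  rewrite /= !mulr1; rewrite (_ : ze^* * (t%:C * (u * w)) = w * (ze^* * (t%:C * u))) in Lde; last by ring.
  set L := normc _ in k0 Lde *.
  rewrite ler_pdivlMr ?exprn_gt0// mulrAC ler_pdivrMr//.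
  have L2 : L ^+ 2 <= (3 / 2 * de) ^+ 2 by rewrite lerXn2r ?nnegrE// ?(ltW k0)//; lra.
  have : de * de <= de * (2 * (1 - t ^+ 2)) by rewrite ler_wpM2l ?(ltW de0).
  by move: L2; rewrite exprMn !expr2; lra.
apply: le_trans (_ : \sum_(w <- ws) 576 * de * (near_circle a t p)%:R *
    (normc (1 - w * (ze^* * (t%:C * u))) ^+ 2)^-1 <= _).
  by rewrite [leLHS]big_seq [leRHS]big_seq; apply: ler_sum => w; exact: term.
rewrite -mulr_sumr.
set x := ze^* * (t%:C * u).
have xn : normc x = normc ze * t.
  rewrite /x [normc (_ * _)]normcM [normc (t%:C * _)]normcM normcJ u1 mulr1.
  by rewrite normc_real ger0_norm.
have ze1 : normc ze <= 1 by exact: ltW.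
have xt : normc x <= r.
  by rewrite xn; have := ler_wpM2r t0 ze1; lra.
have x1 : normc x < 1 by lra.
have xN : normc x ^+ size ws <= 2^-1.
  by apply: le_trans rN; rewrite lerXn2r ?nnegrE ?normc_ge0//; lra.
have := unit_points_poisson erefl wn (wE x x1) x1 xN.
have xde : de <= 1 - normc x ^+ 2.
  rewrite /de lerD2l lerN2 xn exprMn ler_piMr ?sqr_ge0// expr_le1//; lra.
move=> S.
have {S} : de * \sum_(w <- ws) (normc (1 - w * x) ^+ 2)^-1 <= 3 * (size ws)%:R.
  apply: le_trans (ler_wpM2l (ltW de0) S) _.
  have y0 : 0 < 1 - normc x ^+ 2 by lra.
  by rewrite mulrA ler_pdivrMr// mulrC ler_wpM2l.
case: (near_circle a t p); last by rewrite !(mulr0, mul0r).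
by rewrite !mulr1; lra.
Qed.

(** At each radius, [ray_weight_le] and [square_count] bound the sum over [ws] by
    the integral of [|A|] over the points that [mobius a] brings near the circle
    of that radius. By Tonelli, integrating over the radii charges a point [p] of
    the disc for a set of radii of length [1 - |mobius a p|^2], and this is the
    weight in the hypothesis. *)
Lemma averaged_potential A a r C : analytic_disc A -> disc a -> 0 < r < 1 ->
  (\int[area]_(w in disc_plane)
       (normc (A (plane_to_C w)) * (1 - normc (mobius a (plane_to_C w)) ^+ 2))%:E <= C%:E)%E ->
  exists ws : seq R[i], [/\ (0 < size ws)%N, (forall w, w \in ws -> normc w = 1) &
    forall u, normc u = 1 ->
      \sum_(w <- ws) ray_integral A a r (u * w) <= (size ws)%:R * (1728 * C)].
Proof.
move=> Aa aD /[dup] r01 /andP[r0 r1] hC.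
(* the number of points depends on [r] alone: it has to make [r ^+ (2 ^ n)] small *)
have [n rn] : exists n : nat, r ^+ (2 ^ n) <= 2^-1.
  have [n hn] : exists n : nat, (1 - r)^-1 < n%:R.
    by exists (Num.truncn (1 - r)^-1).+1; exact: truncnS_gt.
  exists n.+1; have q0 : 0 < 1 - r by lra.
  have q : 1 < n%:R * (1 - r) by rewrite -ltr_pdivrMr// div1r.
  have bern (m : nat) : r ^+ m * (1 + m%:R * (1 - r)) <= 1.
    elim: m => [|m ih]; first by rewrite expr0 mul0r addr0 mulr1.
    have rm : 0 <= r ^+ m by rewrite exprn_ge0// ltW.
    have k0 : 0 <= m%:R * (1 - r) :> R by rewrite mulr_ge0// ltW.
    rewrite exprS -(natr1 m).
    have e : r * (1 + (m%:R + 1) * (1 - r)) <= 1 + m%:R * (1 - r) by nra.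
    by apply: le_trans ih; rewrite (mulrC r) -mulrA ler_wpM2l.
  have nN : (n <= 2 ^ n.+1)%N by rewrite ltnW// (ltn_trans (ltn_expl n (ltnSn 1)))// ltn_exp2l.
  have hb := bern (2 ^ n.+1)%N.
  have : n%:R * (1 - r) <= (2 ^ n.+1)%N%:R * (1 - r) by rewrite ler_wpM2r ?ler_nat// ltW.
  have : 0 <= r ^+ (2 ^ n.+1) by rewrite exprn_ge0// ltW.
  move: hb; set X := r ^+ _; set Y := _%:R * (1 - r); move=> hb X0 Yn.
  by rewrite -div1r ler_pdivlMr//; nra.
have [ws [sw wn wE]] := @unit_points R n.
have sN : (0 < size ws)%N by rewrite sw expn_gt0.
exists ws; split=> // u u1; set N := size ws.
have uw1 w : w \in ws -> normc (u * w) = 1 by move=> ww; rewrite normcM u1 wn// mulr1.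
have wge0 w t : 0 <= t <= r -> 0 <= ray_weight A a (u * w) t.
  move=> /andP[t0 tr]; rewrite /ray_weight !mulr_ge0 ?normc_ge0//; lra.
have mw w : w \in ws -> measurable_fun `[0, r] (fun t => (ray_weight A a (u * w) t)%:E).
  move=> ww; apply/measurable_EFinP; apply: subspace_continuous_measurable_fun => //.
  apply: continuous_in_subspaceT => t; rewrite inE /= in_itv /= => tr.
  exact: (ray_weight_continuous Aa aD (uw1 w ww) r1 tr).
rewrite -lee_fin -sumEFin big_seq.
under eq_bigr => w ww do rewrite (ray_integralE Aa aD (uw1 w ww) r01).
rewrite -big_seq.
have [K KE] : exists K : R, 1728 * N%:R = K by eexists.
have K0 : (0 <= K%:E)%E by rewrite lee_fin -KE mulr_ge0 ?ler0n.

apply: (@le_trans _ _ (K%:E * C%:E)%E); last first.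
  by rewrite -EFinM lee_fin -KE mulrAC mulrC.
pose m2 := area_sfm R.
have msw := measurable_swept Aa aD.
pose S t := (\int[m2]_p swept A a (t, p))%E.
have mS : measurable_fun [set: R] S.
  exact: (measurable_fun_fubini_tonelli_F (swept A a) msw (swept_ge0 A a)).
have S0 t : (0 <= S t)%E by apply: integral_ge0 => p _; exact: swept_ge0.
have IS : (\int[mu]_t S t <= C%:E)%E.
  rewrite (@fubini_tonelli _ _ _ _ _ mu m2 (swept A a) msw (swept_ge0 A a)).
  under eq_integral do rewrite swept_length//.
  apply: le_trans hC; rewrite [leRHS]integral_mkcond.
  rewrite le_eqVlt; apply/orP; left; apply/eqP; apply: eq_integral => p _.
  rewrite patchE /absA /moved; case: ifP => // _; by rewrite mul0r.
apply: le_trans (lee_wpmul2l K0 IS).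
rewrite -ge0_integralZl//.
(* the bound at a fixed radius: each integral over a square becomes one over the
   plane of the indicator, so that [square_count] applies under the integral *)
have fixed t : 0 <= t <= r ->
    (\sum_(w <- ws) (ray_weight A a (u * w) t)%:E <= K%:E * S t)%E.
  move=> tr; have /andP[t0 tr'] := tr; have t01 : 0 <= t < 1 by rewrite t0; lra.
  pose W w := mobius a (t%:C * (u * w)).
  pose Q w := square (W w) ((1 - normc (W w) ^+ 2) / 8).
  have WD w : w \in ws -> disc (W w).
    by move=> /uw1 h; apply: mobius_disc => //; apply: ray_disc h r1 tr.
  have QD w : w \in ws -> Q w `<=` disc_plane.
    move=> /WD wD p [/=]; rewrite !in_itv /= => h1 h2.
    by have [] := square_sub_disc wD (lexx _) (conj h1 h2 : inrect _ _ _ _ (plane_to_C p)).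
  have k0 : 0 <= 128 / (1 - t ^+ 2) by rewrite divr_ge0// subr_ge0 expr_le1//; lra.
  have absA0 p : 0 <= absA A p by rewrite /absA; case: ifP => // _; exact: normc_ge0.
  have mQ w : measurable_fun [set: plane R]
      (fun p => (absA A p * (128 / (1 - t ^+ 2) * (p \in Q w)%:R))%:E).
    apply/measurable_EFinP; apply: measurable_funM; first exact: measurable_absA.
    apply: measurable_funM => //.
    rewrite (_ : (fun p => _) = \1_(Q w)); last by apply/funext => p; rewrite indicE.
    by apply: measurable_indic; exact: measurable_square.
  apply: (@le_trans _ _ (\sum_(w <- ws) \int[m2]_p
      (absA A p * (128 / (1 - t ^+ 2) * (p \in Q w)%:R))%:E)%E).
    rewrite [leLHS]big_seq [leRHS]big_seq; apply: lee_sum => w ww.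
    apply: le_trans (ray_weight_le Aa aD (uw1 w ww) t01) _.
    rewrite -/(W w) -/(Q w) /area integral_mkcond -ge0_integralZl//; last 2 first.
    - apply/(measurable_restrictT _ (measurable_square _ _)).
      apply/measurable_EFinP; apply: measurable_funS (QD w ww) _; first exact: measurable_disc_plane.
      exact: (vcont_measurable (fun z zD => analytic_vcont Aa zD)).
    - by move=> p _; rewrite patchE; case: ifP => // _; rewrite lee_fin normc_ge0.
    rewrite le_eqVlt; apply/orP; left; apply/eqP; apply: eq_integral => p _.
    rewrite patchE /absA; case: (boolP (p \in Q w)) => pQ; last by rewrite mule0 !mulr0.
    rewrite ifT; first by rewrite -EFinM mulr1 mulrC.
    by rewrite inE; apply: QD ww _ _; rewrite inE in pQ.
  rewrite -ge0_integral_sum//; last first.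
    by move=> w p _; rewrite lee_fin mulr_ge0// mulr_ge0.
  rewrite /S -ge0_integralZl//; last 2 first.
  - apply: (measurableT_comp msw); exact: measurable_fun_pair.
  - by move=> p _; exact: swept_ge0.
  apply: ge0_le_integral => //.
  - by move=> p _; apply: sume_ge0 => w _; rewrite lee_fin mulr_ge0// mulr_ge0.
  - exact: emeasurable_sum.
  - apply: emeasurable_funM => //; apply: (measurableT_comp msw); exact: measurable_fun_pair.
  move=> p _; rewrite sumEFin -mulr_sumr /swept /= -EFinM lee_fin.
  rewrite mulrCA ler_wpM2l//.
  have [pD|pD] := boolP (p \in disc_plane); last first.
    have -> : \sum_(w <- ws) 128 / (1 - t ^+ 2) * (p \in Q w)%:R = 0.
      rewrite big_seq big1// => w ww; rewrite memNset ?mulr0// => /(QD w ww) pD'.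
      by move: pD; rewrite mem_set.
    by rewrite !mulr_ge0.
  rewrite -KE; apply: (@square_count A a u t r) => //; last by rewrite inE in pD.
    by rewrite sw.
  by move=> x x1; rewrite wE// sw.
have ord (F : R[i] -> \bar R) : (\sum_(w <- ws) F w = \sum_(i < N) F (nth 0%R ws i))%E.
  by rewrite (big_nth 0%R) big_mkord.
have wi (i : 'I_N) : nth 0 ws i \in ws by rewrite mem_nth.
apply: (@le_trans _ _ (\int[mu]_(t in `[0%R, r]) \sum_(w <- ws) (ray_weight A a (u * w) t)%:E)%E).
  rewrite ord; under [leRHS]eq_integral do rewrite ord.
  rewrite ge0_integral_sum//; first by move=> i; exact: mw.
  by move=> i t; rewrite /= in_itv /= lee_fin; exact: wge0.
apply: (@le_trans _ _ (\int[mu]_(t in `[0%R, r]) (K%:E * S t))%E).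
  apply: ge0_le_integral => //.
  - by move=> t; rewrite /= in_itv /= => tr; apply: sume_ge0 => w _; rewrite lee_fin wge0.
  - under [X in measurable_fun _ X]eq_fun do rewrite ord.
    by apply: emeasurable_sum => i; exact: mw.
  - by apply: measurable_funTS; exact: emeasurable_funM.
apply: ge0_subset_integral => //; first exact: emeasurable_funM.
by move=> t _; rewrite mule_ge0.
Qed.

End AveragedPotential.

(** * Simple zeros and the separation constant *)

Section Separation.
Context {R : realType}.
Implicit Types (A f : R[i] -> R[i]) (a b z : R[i]).

(** By [double_zero] the zeros of a nontrivial solution are simple, so that the
    order in [zero_sequence] is at most [1] and each zero is listed once. *)
Lemma simple_zeros A f (I : set nat) (z : nat -> R[i]) :
  analytic_disc A -> analytic_disc f -> ode A f ->
  (exists2 x, disc x & f x != 0) -> zero_sequence f I z ->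
  (forall n, I n -> [/\ divides f (z n), f (z n) = 0 & cderive f (z n) != 0]) /\
  (forall n k, I n -> I k -> z n = z k -> n = k).
Proof.
move=> Aa fa fode [x xD fx] [zD zm].
suff h n : I n -> [/\ divides f (z n), f (z n) = 0, cderive f (z n) != 0 &
    ([set k | I k /\ z k = z n] #= `I_1)%card].
  split=> [n /h[]//|n k In Ik nk].
  have [_ _ _ /card_set_bijP[p [p1 pinj _]]] := h n In.
  have pz j : I j -> z j = z n -> p j = 0%N.
    by move=> Ij jn; have := p1 j (conj Ij jn); rewrite /= ltnS leqn0 => /eqP.
  by apply: pinj; rewrite ?inE// !pz.
move=> In; have aD := zD n In; move aE: (z n) => a in aD *.
have [m [g [ga g0 fE]] card] := zm a aD.
case: m card fE => [|m] card fE.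
  by move: card; rewrite II0 card_eq0 => /eqP E; have : set0 n by rewrite -E.
have pw u : exists l, cdiff (fun u => (u - a) ^+ m) u l.
  elim: m {card fE} => [|m [l hl]]; first by exists 0; exact: cdiff_cst.
  eexists; apply: cdiff_ext (cdiffM (cdiffB (cdiff_id u) (cdiff_cst a u)) hl) _ => w.
  by rewrite exprS.
pose k u := (u - a) ^+ m * g u.
have ka : analytic_disc k.
  apply: analyticI => u uD; have [l hl] := pw u.
  by eexists; exact: cdiffM hl (analytic_cdiff ga uD).
have fk u : disc u -> f u = (u - a) * k u by move=> uD; rewrite fE// exprS mulrA.
have fa0 : f a = 0 by rewrite fk// subrr mul0r.
have f'a : cderive f a = k a.
  have e1 := cdiffM (cdiffB (cdiff_id a) (cdiff_cst a a)) (analytic_cdiff ka aD).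
  have := cdiff_val (cdiff_near e1 (g := f) _); rewrite subrr mul0r addr0 subr0 mul1r; apply.
  exists (1 - normc a); first by rewrite subr_gt0.
  move=> w wa; rewrite fk// /disc /=; have := normc_le_dist w a; lra.
have k0 : k a != 0.
  rewrite -f'a; apply: contra_neq fx => f'a0.
  exact: (double_zero Aa fa fode aD fa0 f'a0 xD).
split=> //; first by exists k.
  by rewrite f'a.
case: m card @k k0 {pw ka fk f'a fE} => // m _ /=.
by rewrite subrr expr0n mul0r eqxx.
Qed.

(** The factor in [uniformly_separated] is the modulus of a disc automorphism. *)
Lemma pseudohyperbolic a b : normc ((b - a) / (1 - b^* * a)) = normc (mobius a b).
Proof.
rewrite /mobius !normc_div (normcB b a); congr (_ / _).
have -> : 1 - b^* * a = Num.conj (1 - a^* * b).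
  by rewrite rmorphB rmorphM rmorph1 /= conjCK mulrC.
exact: normcJ.
Qed.

(** Used to let the radius tend to [1] in [zeros_product_bound]. *)
Lemma ge1_of_powers (N : nat) (p : R) :
  (forall r : R, 0 < r < 1 -> r ^+ N <= p) -> 1 <= p.
Proof.
move=> h; apply/ler_addgt0Pl => e e0.
have bern (r : R) : 0 <= r <= 1 -> 1 - N%:R * (1 - r) <= r ^+ N.
  move=> /andP[r0 r1]; elim: N {h} => [|n ih]; first by rewrite mul0r subr0 expr0.
  rewrite exprS -natr1; have := ler_wpM2l r0 ih.
  have : 0 <= n%:R * (1 - r) ^+ 2 by rewrite mulr_ge0// sqr_ge0.
  by rewrite !expr2; lra.
have N1 : 0 < N%:R + 1 :> R by rewrite ltr_pwDr.
pose d := Num.min (e / (N%:R + 1)) 2^-1.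
have d0 : 0 < d by rewrite lt_min divr_gt0//= invr_gt0.
have d1 : d <= 2^-1 by rewrite ge_min lexx orbT.
have dN : N%:R * d <= e.
  have : d <= e / (N%:R + 1) by rewrite ge_min lexx.
  by rewrite ler_pdivlMr// mulrC; lra.
have r01 : 0 < 1 - d < 1 by apply/andP; split; lra.
have b0 : 0 <= 1 - d <= 1 by apply/andP; split; lra.
have := le_trans (bern _ b0) (h _ r01); rewrite subKr; lra.
Qed.

End Separation.

Theorem theorem1 (R : realType) (A : R[i] -> R[i])
    (mu : {measure set (plane R) -> \bar R}) :
  analytic_disc A ->
  (forall E : set (plane R), measurable E ->
     mu E = (\int[area]_(w in E `&` disc_plane)
       (normc (A (plane_to_C w)) * (1 - normc (plane_to_C w) ^+ 2))%:E)%E) ->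
  carleson_measure mu ->
  forall f : R[i] -> R[i],
    analytic_disc f ->
    (forall z, disc z -> cderive (cderive f) z + A z * f z = 0) ->
    (exists2 z, disc z & f z != 0) ->
    forall (I : set nat) (z : nat -> R[i]),
      zero_sequence f I z -> uniformly_separated I z.
Proof.
move=> Aa muE muC f fa fode nt I z zs.
have [C C0 hC] := carleson_invariant Aa muE muC.
have [zD _] := zs; have [sz inj] := simple_zeros Aa fa fode nt zs.
have [L LE] : exists L : R, 1728 * C = L by eexists.
pose S k N := [seq z n | n <- index_iota 0 N & (n \in I) && (n != k)].
have SP k N b : b \in S k N -> exists n, [/\ I n, n != k & b = z n].
  move=> /mapP[n]; rewrite mem_filter => /andP[/andP[In nk] _] ->.
  by exists n; split=> //; rewrite inE in In.
have uS k N : uniq (S k N).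
  rewrite map_inj_in_uniq ?filter_uniq ?iota_uniq// => n j.
  rewrite !mem_filter => /andP[/andP[In _] _] /andP[/andP[Ij _] _].
  by rewrite !inE in In Ij; exact: inj.
have kS k N : I k -> z k \notin S k N.
  move=> Ik; apply/negP => /SP[n [In nk]] /(inj _ _ Ik In) e.
  by rewrite e eqxx in nk.
pose P k N := \prod_(0 <= n < N | (n \in I) && (n != k))
  normc ((z n - z k) / (1 - (z n)^* * z k)).
have PE k N : I k -> P k N = \prod_(b <- S k N) normc (mobius (z k) b).
  move=> Ik; rewrite /S big_map big_filter; apply: eq_bigr => n /andP[In _].
  by rewrite pseudohyperbolic.
have low k N : I k -> expR (- L) <= P k N.
  move=> Ik; rewrite PE// expRN -div1r ler_pdivrMr ?expR_gt0//.
  apply: (@ge1_of_powers _ (size (S k N))) => r r01; rewrite mulrC.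
  have [ws [ws0 wn wL]] := averaged_potential Aa (zD k Ik) r01 (hC _ (zD k Ik)).
  rewrite LE in wL; have [_ fzk f'zk] := sz k Ik.
  apply: (zeros_product_bound Aa fa fode (zD k Ik) fzk f'zk (uS k N) (kS k N Ik) _ r01 ws0 wn wL).
  move=> b; rewrite inE => /predU1P[->|/SP[n [In _ ->]]].
    by split; [exact: zD|have [] := sz k Ik].
  by split; [exact: zD|have [] := sz n In].
have fac k n : I k -> I n -> normc ((z n - z k) / (1 - (z n)^* * z k)) <= 1.
  move=> Ik In; have := mobius_disc (zD k Ik) (zD n In).
  by rewrite -pseudohyperbolic /disc /= => /ltW.
(* the partial products decrease, so the bound passes to their limit *)
have step k N : I k -> P k N.+1 <= P k N.
  move=> Ik; rewrite /P big_mkcond big_nat_recr//= -big_mkcond/=.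
  case: ifP => [/andP[In _]|_]; last by rewrite mulr1.
  rewrite ler_piMr ?fac// ?prodr_ge0// => [n _|]; first exact: normc_ge0.
  by rewrite inE in In.
have cv k : I k -> cvgn (P k).
  move=> Ik; apply: nonincreasing_is_cvgn.
    by apply/nonincreasing_seqP => n; exact: step.
  by exists (expR (- L)) => _ [n _ <-]; exact: low.
apply: (@lt_le_trans _ _ (expR (- L))%:E); first by rewrite lte_fin expR_gt0.
apply: le_ereal_inf_tmp => _ [k Ik <-]; rewrite lee_fin.
by apply: limr_ge; [exact: cv|apply: nearW => N; exact: low].
Qed.
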